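(* Let $\alpha\ge0$, $g_\alpha(z)=(z-1)^\alpha$ and $\mu_\alpha=|g_\alpha|^2=|z-1|^{2\alpha}$. Then the weighted Szegő projection $\mathbf{S}_{\mu_\alpha}$ is bounded on $L^p(\mathbb{T},\mu_\alpha)$ if and only if $p\in\left(\frac{2\alpha+1}{\alpha+1},\frac{2\alpha+1}{\alpha}\right)$ (for $\alpha=0$ the interval is $(1,\infty)$).
   Context: $\mathbb{D}$ is the unit disc, $\mathbb{T}$ the unit circle with measure $d\theta$; $(z-1)^\alpha$ is defined on $\mathbb{D}$ via a holomorphic branch of $\log(z-1)$ (so it is holomorphic, nonvanishing on $\mathbb{D}$ and continuous on $\overline{\mathbb{D}}$). $L^p(\mathbb{T},\mu_\alpha)$ is the space of measurable $f$ with $\|f\|_{p,\mu_\alpha}^p=\int_{\mathbb{T}}|f|^p\mu_\alpha d\theta<\infty$. $\mathcal{H}^2(\mathbb{T},\mu_\alpha)$ is the space of holomorphic $f$ on $\mathbb{D}$ with $\sup_{r<1}\int_0^{2\pi}|f(re^{i\theta})|^2|g_\alpha(re^{i\theta})|^2d\theta<\infty$, identified with its boundary values, a closed subspace of $L^2(\mathbb{T},\mu_\alpha)$; $\mathbf{S}_{\mu_\alpha}$ is the orthogonal projection of $L^2(\mathbb{T},\mu_\alpha)$ onto it. ''Bounded on $L^p(\mathbb{T},\mu_\alpha)$'' means $\|\mathbf{S}_{\mu_\alpha}f\|_{p,\mu_\alpha}\le C\|f\|_{p,\mu_\alpha}$ for all $f\in L^2(\mathbb{T},\mu_\alpha)\cap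 L^p(\mathbb{T},\mu_\alpha)$. *)

(* Defs.v *)
From HB Require Import structures.
From mathcomp Require Import all_boot all_order all_algebra.
From mathcomp Require Import complex.
From mathcomp Require Import all_classical all_reals all_analysis.
Set Implicit Arguments. Unset Strict Implicit. Unset Printing Implicit Defensive.
Import Order.TTheory GRing.Theory Num.Theory.
Import numFieldNormedType.Exports.
Local Open Scope classical_set_scope.
Local Open Scope ring_scope.

Section WeightedSzego.
Variable R : realType.
Local Notation C := (R[i]).

Definition cmod (z : C) : R := Num.sqrt (complex.Re z ^+ 2 + complex.Im z ^+ 2).

Definition cR (x : R) : C := Complex x 0.

Definition expi (t : R) : C := Complex (cos t) (sin t).

(* the parameter domain of the circle T: theta in [0, 2 pi] with Lebesgue measure d theta *)
Definition Tdom : set R := `[0, 2 * pi]%classic.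

Definition Disc : set C := [set z | cmod z < 1].

Definition mu (alpha : R) (t : R) : R := cmod (expi t - 1) `^ (2 * alpha).

Definition absg2 (alpha : R) (z : C) : R := cmod (z - 1) `^ (2 * alpha).

Definition cmeasurable (f : R -> C) : Prop :=
  measurable_fun Tdom (fun t => complex.Re (f t)) /\
  measurable_fun Tdom (fun t => complex.Im (f t)).

Definition wint (alpha p : R) (f : R -> C) : \bar R :=
  (\int[lebesgue_measure]_(t in Tdom) ((cmod (f t)) `^ p * mu alpha t)%:E)%E.

Definition InLp (alpha p : R) (f : R -> C) : Prop :=
  cmeasurable f /\ (wint alpha p f < +oo)%E.

Definition holomorphic_on_disc (F : C -> C) : Prop :=
  forall z, Disc z -> exists l : C, forall eps : R, 0 < eps ->
    exists2 delta : R, 0 < delta & forall h : C, h != 0 -> cmod h < delta ->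
      cmod ((F (z + h) - F z) / h - l) < eps.

Definition radial_limit (F : C -> C) (t : R) (w : C) : Prop :=
  forall eps : R, 0 < eps -> exists2 delta : R, 0 < delta &
    forall r : R, 1 - delta < r -> r < 1 -> cmod (F (cR r * expi t) - w) < eps.

Definition InH2 (alpha : R) (f : R -> C) : Prop :=
  exists F : C -> C,
    [/\ holomorphic_on_disc F,
        (exists M : R, forall r : R, 0 <= r -> r < 1 ->
           (\int[lebesgue_measure]_(t in Tdom)
               ((cmod (F (cR r * expi t))) ^+ 2 * absg2 alpha (cR r * expi t))%:E
             <= M%:E)%E) &
        {ae lebesgue_measure, forall t, Tdom t -> radial_limit F t (f t)}].

Definition worth (alpha : R) (u v : R -> C) : Prop :=
  (\int[lebesgue_measure]_(t in Tdom)
      (complex.Re (u t * conjc (v t)) * mu alpha t)%:E = 0)%E /\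
  (\int[lebesgue_measure]_(t in Tdom)
      (complex.Im (u t * conjc (v t)) * mu alpha t)%:E = 0)%E.

Definition is_Szego_projection (alpha : R) (S : (R -> C) -> (R -> C)) : Prop :=
  forall f, InLp alpha 2 f ->
    InH2 alpha (S f) /\ (forall h, InH2 alpha h -> worth alpha (f \- S f) h).

(* S bounded on L^p(T, mu_alpha):
   ||S f||_{p,mu} <= K ||f||_{p,mu} for all f in L^2 cap L^p, written with p-th powers *)
Definition bounded_on_Lp (alpha p : R) (S : (R -> C) -> (R -> C)) : Prop :=
  exists K : R, 0 <= K /\ forall f, InLp alpha 2 f -> InLp alpha p f ->
    (wint alpha p (S f) <= (K `^ p)%:E * wint alpha p f)%E.

End WeightedSzego.

(* Main.v *)
Require Import Defs.
From HB Require Import structures.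
From mathcomp Require Import all_boot all_order all_algebra.
From mathcomp Require Import complex.
From mathcomp Require Import all_classical all_reals all_analysis.
From mathcomp Require Import measurable_realfun.
From mathcomp Require Import ring lra.
Set Implicit Arguments. Unset Strict Implicit. Unset Printing Implicit Defensive.
Import Order.TTheory GRing.Theory Num.Theory.
Import numFieldNormedType.Exports.
Local Open Scope classical_set_scope.
Local Open Scope ring_scope.

Local Notation Re := complex.Re.
Local Notation Im := complex.Im.

(* Writing G for the boundary values of (1 - z)^alpha, the projection sends f to k where G k is the ordinary Szego projection of G f; the L^p(mu_alpha) norm of f is the L^p norm of G f with weight |1 - z|^b, b = alpha (2 - p).

For 1 < p < 2 and b < p - 1 it suffices to treat G f = u >= 0. Then G k = H is holomorphic with Re H > 0 and boundary real part (u + mean u) / 2. The principal values satisfy Re (H^p (1 - z)^b) <= C (Re H)^p |1 - z|^b - c |H|^p |1 - z|^b, and the left side has nonnegative mean, so |H|^p |1 - z|^b is controlled by (Re H)^p |1 - z|^b; the mean of u is controlled by Young's inequality, where b < p - 1 enters again. The case p = 2 is trivial and p > 2 follows by duality.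

For p >= (2 alpha + 1) / alpha, the unimodular function f = conj(G) / G is sent to 1 / G, which is not in L^p(mu_alpha); the lower range is excluded by duality. For p = 1 the functions f = P / G, with P a Poisson kernel concentrating at -1, are bounded in L^1(mu_alpha) while their projections, Szego kernels over G, are not. *)

(** * Complex limits and derivatives *)

(** With [b = alpha (2 - p)] the endpoints of the range turn into two short conditions: [b < p - 1]
    says that [p] exceeds the lower one, and [alpha (2 - q) <= -1] that [q] is at least the upper
    one. The first condition has two faces: the phase of [H^p (1 - z)^b] must have negative cosine
    whenever [|arg H|] is near [pi / 2], and the dual weight [|1 - z|^(-b / (p - 1))] must be
    integrable. Working with [1 < p < 2] makes the passage to the boundary easy: circle means of
    [|H|^2] are bounded, so [(Re H)^p] is bounded in [L^(2/p)] with [2 / p > 1] and converges in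
    mean, without maximal functions. In the duality argument the projection is not yet known to lie
    in [L^p], hence a truncation there. The boundary real part is extracted from orthogonality
    alone, by testing with the logarithms [log (1 - c z)], instead of from a boundary theorem for
    Poisson integrals. The exponent [p = 1] needs its own example because its conjugate is
    infinite. *)

Section ComplexModulus.
Variable R : realType.
Local Notation C := (R[i]).
Implicit Types z w : C.

Lemma cmodE z : cmod z = ComplexField.Normc.normc z.
Proof. by case: z. Qed.

Lemma ReD z w : Re (z + w) = Re z + Re w. Proof. by case: z w => [a b] [c d]. Qed.
Lemma ImD z w : Im (z + w) = Im z + Im w. Proof. by case: z w => [a b] [c d]. Qed.
Lemma ReN z : Re (- z) = - Re z. Proof. by case: z. Qed.
Lemma ImN z : Im (- z) = - Im z. Proof. by case: z. Qed.
Lemma ReB z w : Re (z - w) = Re z - Re w. Proof. by rewrite ReD ReN. Qed.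
Lemma ImB z w : Im (z - w) = Im z - Im w. Proof. by rewrite ImD ImN. Qed.
Lemma ReM z w : Re (z * w) = Re z * Re w - Im z * Im w.
Proof. by case: z w => [a b] [c d]. Qed.
Lemma ImM z w : Im (z * w) = Re z * Im w + Im z * Re w.
Proof. by case: z w => [a b] [c d]. Qed.
Lemma ReV z : Re z^-1 = Re z / (Re z ^+ 2 + Im z ^+ 2).
Proof. by case: z => [a b]. Qed.
Lemma ImV z : Im z^-1 = - Im z / (Re z ^+ 2 + Im z ^+ 2).
Proof. by case: z => [a b]; rewrite /= mulNr. Qed.
Lemma Re1 : Re (1 : C) = 1. Proof. by []. Qed.
Lemma Im1 : Im (1 : C) = 0. Proof. by []. Qed.
Lemma Re_conj z : Re (conjc z) = Re z. Proof. by case: z. Qed.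
Lemma Im_conj z : Im (conjc z) = - Im z. Proof. by case: z. Qed.

Definition ReImE := (ReD, ImD, ReN, ImN, ReM, ImM, Re1, Im1, Re_conj, Im_conj).

Lemma cmplx_eq z w : Re z = Re w -> Im z = Im w -> z = w.
Proof. by case: z w => [a b] [c d] /= -> ->. Qed.

Lemma cmod_ge0 z : 0 <= cmod z. Proof. exact: sqrtr_ge0. Qed.
Lemma cmod_sqr z : cmod z ^+ 2 = Re z ^+ 2 + Im z ^+ 2.
Proof. by rewrite sqr_sqrtr // addr_ge0 ?sqr_ge0. Qed.
Lemma cmodM z w : cmod (z * w) = cmod z * cmod w.
Proof. by rewrite !cmodE ComplexField.Normc.normcM. Qed.
Lemma cmodN z : cmod (- z) = cmod z.
Proof. by rewrite /cmod ReN ImN !sqrrN. Qed.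
Lemma cmodBC z w : cmod (z - w) = cmod (w - z).
Proof. by rewrite -cmodN opprB. Qed.
Lemma cmod0 : cmod (0 : C) = 0.
Proof. by rewrite /cmod /= expr0n /= addr0 sqrtr0. Qed.
Lemma cmod1 : cmod (1 : C) = 1.
Proof. by rewrite /cmod /= expr1n expr0n /= addr0 sqrtr1. Qed.
Lemma cmod_eq0 z : (cmod z == 0) = (z == 0).
Proof.
apply/eqP/eqP => [|->]; last exact: cmod0.
by rewrite cmodE; exact: ComplexField.Normc.eq0_normc.
Qed.
Lemma cmod_gt0 z : (0 < cmod z) = (z != 0).
Proof. by rewrite lt_neqAle cmod_ge0 andbT eq_sym cmod_eq0. Qed.
Lemma cmodV z : cmod z^-1 = (cmod z)^-1.
Proof. by rewrite !cmodE ComplexField.Normc.normcV. Qed.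
Lemma cmod_cR (x : R) : cmod (cR x) = `|x|.
Proof. by rewrite /cmod /= expr0n /= addr0 sqrtr_sqr. Qed.
Lemma cmod_conj z : cmod (conjc z) = cmod z.
Proof. by rewrite /cmod Re_conj Im_conj sqrrN. Qed.
Lemma cmod_expi (t : R) : cmod (expi t) = 1.
Proof. by rewrite /cmod /= cos2Dsin2 sqrtr1. Qed.
Lemma Re_le_cmod z : `|Re z| <= cmod z.
Proof. by rewrite -sqrtr_sqr ler_wsqrtr // lerDl sqr_ge0. Qed.
Lemma Im_le_cmod z : `|Im z| <= cmod z.
Proof. by rewrite -sqrtr_sqr ler_wsqrtr // lerDr sqr_ge0. Qed.
Lemma cmod_le z : cmod z <= `|Re z| + `|Im z|.
Proof.
rewrite -(@ler_pXn2r _ 2%N) ?nnegrE ?cmod_ge0 ?addr_ge0 // cmod_sqr.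
rewrite sqrrD !real_normK ?num_real // -subr_ge0.
have -> : forall a b c : R, a + c *+ 2 + b - (a + b) = c *+ 2 by move=> *; ring.
by rewrite mulrn_wge0 // mulr_ge0.
Qed.
Lemma cmodD z w : cmod (z + w) <= cmod z + cmod w.
Proof.
have : (`|z + w| <= `|z| + `|w| :> C) by exact: ler_normD.
by rewrite !normc_def lecE /= => /andP[_].
Qed.
Lemma cmodB_le z w : cmod (z - w) <= cmod z + cmod w.
Proof. by rewrite (le_trans (cmodD _ _)) // cmodN. Qed.
Lemma cmodB_ge z w : cmod z - cmod w <= cmod (z - w).
Proof. by rewrite lerBlDr -{1}[z](subrK w) cmodD. Qed.

Lemma cRM (x y : R) : cR (x * y) = cR x * cR y.
Proof. by apply: cmplx_eq; rewrite !ReImE /= ?mulr0 ?mul0r ?subr0 ?addr0. Qed.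

End ComplexModulus.

Section ComplexLimits.
Variable R : realType.
Local Notation C := (R[i]).

(** Stated along an arbitrary filter, so that radial sequences, parametrised paths and full
    neighbourhoods share the same limit rules, each a pair of real ones. *)
Definition cvgC T (G : set_system T) (f : T -> C) (l : C) :=
  (Re (f x) @[x --> G] --> Re l) /\ (Im (f x) @[x --> G] --> Im l).

Definition nbC (z : C) : set_system C :=
  (fun p : R * R => Complex p.1 p.2) @ nbhs (Re z, Im z).

Definition contC (F : C -> C) (z : C) := cvgC (nbC z) F (F z).

Global Instance nbC_filter z : ProperFilter (nbC z).
Proof. exact: fmap_proper_filter. Qed.

Lemma nbC_self z (A : set C) : nbC z A -> A z.
Proof. by move=> /nbhs_singleton /=; case: z. Qed.

Section Ops.
Context {T : Type} {G : set_system T} {FG : Filter G}.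
Implicit Types (f h : T -> C).

Lemma cvgC_cst a : cvgC G (fun=> a) a.
Proof. by split; exact: cvg_cst. Qed.

Lemma cvgC_add f h a b : cvgC G f a -> cvgC G h b -> cvgC G (fun x => f x + h x) (a + b).
Proof.
move=> [fa1 fa2] [hb1 hb2]; split.
  rewrite ReD; under eq_fun do rewrite ReD; exact: cvgD.
rewrite ImD; under eq_fun do rewrite ImD; exact: cvgD.
Qed.

Lemma cvgC_opp f a : cvgC G f a -> cvgC G (fun x => - f x) (- a).
Proof.
move=> [fa1 fa2]; split.
  rewrite ReN; under eq_fun do rewrite ReN; exact: cvgN.
rewrite ImN; under eq_fun do rewrite ImN; exact: cvgN.
Qed.

Lemma cvgC_sub f h a b : cvgC G f a -> cvgC G h b -> cvgC G (fun x => f x - h x) (a - b).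
Proof. by move=> fa hb; apply: cvgC_add => //; exact: cvgC_opp. Qed.

Lemma cvgC_mul f h a b : cvgC G f a -> cvgC G h b -> cvgC G (fun x => f x * h x) (a * b).
Proof.
move=> [fa1 fa2] [hb1 hb2]; split.
  rewrite ReM; under eq_fun do rewrite ReM.
  by apply: cvgB; apply: cvgM.
rewrite ImM; under eq_fun do rewrite ImM.
by apply: cvgD; apply: cvgM.
Qed.

Lemma cvgC_cR (f : T -> R) a : f x @[x --> G] --> a -> cvgC G (fun x => cR (f x)) (cR a).
Proof. by move=> fa; split => //=; exact: cvg_cst. Qed.

Lemma cvgC_inv f a : a != 0 -> cvgC G f a -> cvgC G (fun x => (f x)^-1) a^-1.
Proof.
move=> a0 [fa1 fa2].
have d0 : Re a ^+ 2 + Im a ^+ 2 != 0 by rewrite -cmod_sqr expf_neq0 // cmod_eq0.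
have cv : (Re (f x) ^+ 2 + Im (f x) ^+ 2)^-1 @[x --> G] --> (Re a ^+ 2 + Im a ^+ 2)^-1.
  by apply: cvgV => //; apply: cvgD; apply: cvgM.
split.
  by rewrite ReV; under eq_fun do rewrite ReV; exact: cvgM.
rewrite ImV; under eq_fun do rewrite ImV; apply: cvgM => //; exact: cvgN.
Qed.

Lemma cvgC_cmod f a : cvgC G f a -> cmod (f x) @[x --> G] --> cmod a.
Proof.
move=> [fa1 fa2]; rewrite /cmod.
have cv : (Re (f x) ^+ 2 + Im (f x) ^+ 2) @[x --> G] --> (Re a ^+ 2 + Im a ^+ 2).
  by apply: cvgD; apply: cvgM.
exact: (cvg_comp _ _ cv (@sqrt_continuous R _)).
Qed.

(** Coordinatewise convergence becomes convergence of filters, the form that composition with a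
    function defined near the limit requires. *)
Lemma cvgC_to_nbC f a : cvgC G f a -> f @ G --> nbC a.
Proof.
move=> [fa1 fa2].
have pc : (Re (f x), Im (f x)) @[x --> G] --> (Re a, Im a).
  exact: (@cvg_pair _ _ _ _ (nbhs (Re a)) (nbhs (Im a)) _ _ _ (fun x => Re (f x)) (fun x => Im (f x))).
move=> A /pc /=; rewrite !nbhs_simpl /=.
by apply: filterS => x /=; case: (f x).
Qed.

Lemma cvgC_comp f a F : cvgC G f a -> contC F a -> cvgC G (fun x => F (f x)) (F a).
Proof.
move=> /cvgC_to_nbC fa [Fa1 Fa2].
by split; [exact: (cvg_comp _ _ fa Fa1)|exact: (cvg_comp _ _ fa Fa2)].
Qed.

Lemma cvgC_near f h a : (\forall x \near G, f x = h x) -> cvgC G f a -> cvgC G h a.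
Proof.
move=> fh [fa1 fa2]; split.
  apply: cvg_trans fa1; apply: near_eq_cvg.
  by apply: filterS fh => x ->.
apply: cvg_trans fa2; apply: near_eq_cvg.
by apply: filterS fh => x ->.
Qed.

Lemma cvgC_cmod0 f a : cvgC G f a <-> cmod (f x - a) @[x --> G] --> (0 : R).
Proof.
split => [fa|f0].
  have := cvgC_cmod (cvgC_sub fa (cvgC_cst a)).
  by rewrite subrr cmod0.
split; apply/cvgrPdist_le => e e0.
  move/cvgrPdist_le : f0 => /(_ _ e0); apply: filterS => x.
  rewrite sub0r normrN ger0_norm ?cmod_ge0 //; apply: le_trans.
  by rewrite distrC -ReB Re_le_cmod.
move/cvgrPdist_le : f0 => /(_ _ e0); apply: filterS => x.
rewrite sub0r normrN ger0_norm ?cmod_ge0 //; apply: le_trans.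
by rewrite distrC -ImB Im_le_cmod.
Qed.

End Ops.

Lemma cvgC_id z : cvgC (nbC z) id z.
Proof.
by split => /=; rewrite /nbC -fmap_comp; [exact: (@cvg_fst _ _ (nbhs (Re z)))|exact: (@cvg_snd _ _ (nbhs (Re z)))].
Qed.

Lemma nbC_ball z (A : set C) :
  nbC z A <-> exists2 d : R, 0 < d & forall w : C, cmod (w - z) < d -> A w.
Proof.
split.
  rewrite /nbC /= => -[[B1 B2]] /= [/nbhs_ballP [d1 /= d10 h1] /nbhs_ballP [d2 /= d20 h2]] sub.
  exists (Num.min d1 d2); first by rewrite lt_min d10.
  move=> w; rewrite lt_min => /andP[wd1 wd2].
  have := sub (Re w, Im w); case: w wd1 wd2 => a b wd1 wd2; apply; split => /=.
    by apply: h1; rewrite /ball /= distrC; apply: le_lt_trans wd1; have := Re_le_cmod ((a +i* b)%C - z); rewrite ReB.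
  by apply: h2; rewrite /ball /= distrC; apply: le_lt_trans wd2; have := Im_le_cmod ((a +i* b)%C - z); rewrite ImB.
move=> [d d0 dA].
have cz : cmod (w - z) @[w --> nbC z] --> (0 : R).
  exact: (cvgC_cmod0 id z).1 (cvgC_id z).
move/cvgrPdist_lt : cz => /(_ _ d0); apply: filterS => w; rewrite sub0r normrN ger0_norm ?cmod_ge0 //; exact: dA.
Qed.

Lemma contCP F z : contC F z <-> forall eps, 0 < eps ->
  exists2 d : R, 0 < d & forall w : C, cmod (w - z) < d -> cmod (F w - F z) < eps.
Proof.
rewrite /contC (cvgC_cmod0 F (F z)); split => [/cvgrPdist_lt H eps eps0|H].
  have /nbC_ball[d d0 dH] := H _ eps0.
  by exists d => // w /dH; rewrite sub0r normrN ger0_norm ?cmod_ge0.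
apply/cvgrPdist_lt => eps eps0; apply/nbC_ball; have [d d0 dH] := H _ eps0.
by exists d => // w /dH; rewrite sub0r normrN ger0_norm ?cmod_ge0.
Qed.

End ComplexLimits.

Section ComplexDerivative.
Variable R : realType.
Local Notation C := (R[i]).
Implicit Types (F G : C -> C) (z l m : C).

(* Caratheodory's formulation, for which the chain rule needs no case distinction. *)
Definition derC F z l := exists phi : C -> C,
  [/\ contC phi z, phi z = l & \forall w \near nbC z, F w - F z = phi w * (w - z)].

Lemma derC_cont F z l : derC F z l -> contC F z.
Proof.
move=> [phi [cphi _ H]]; rewrite /contC.
have : cvgC (nbC z) (fun w => F z + phi w * (w - z)) (F z + phi z * (z - z)).
  apply: cvgC_add; first exact: cvgC_cst.
  apply: cvgC_mul => //; apply: cvgC_sub; [exact: cvgC_id|exact: cvgC_cst].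
rewrite subrr mulr0 addr0; apply: cvgC_near.
by apply: filterS H => w <-; rewrite addrC subrK.
Qed.

Lemma derC_near F G z l : (\forall w \near nbC z, F w = G w) -> derC F z l -> derC G z l.
Proof.
move=> FG [phi [c p H]]; exists phi; split => //.
have FGz := nbC_self FG.
by apply: filterS2 FG H => w -> <-; rewrite FGz.
Qed.

Lemma derC_cst a z : derC (fun=> a) z 0.
Proof.
exists (fun=> 0); split => //; first exact: cvgC_cst.
by apply: nearW => w; rewrite subrr mul0r.
Qed.

Lemma derC_id z : derC id z 1.
Proof.
exists (fun=> 1); split => //; first exact: cvgC_cst.
by apply: nearW => w; rewrite mul1r.
Qed.

Lemma derC_add F G z l m : derC F z l -> derC G z m -> derC (fun w => F w + G w) z (l + m).
Proof.
move=> [p [cp <- Fp]] [q [cq <- Gq]]; exists (fun w => p w + q w); split => //.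
  exact: cvgC_add.
by apply: filterS2 Fp Gq => w Fw Gw; rewrite mulrDl -Fw -Gw; ring.
Qed.

Lemma derC_mul F G z l m : derC F z l -> derC G z m ->
  derC (fun w => F w * G w) z (l * G z + F z * m).
Proof.
move=> dF [q [cq <- Gq]]; have cF := derC_cont dF.
move: dF => [p [cp <- Fp]]; exists (fun w => p w * G z + F w * q w); split => //.
  by apply: cvgC_add; apply: cvgC_mul => //; exact: cvgC_cst.
apply: filterS2 Fp Gq => w Fw Gw.
have -> : (p w * G z + F w * q w) * (w - z) = (p w * (w - z)) * G z + F w * (q w * (w - z)) by ring.
by rewrite -Fw -Gw; ring.
Qed.

Lemma derC_opp F z l : derC F z l -> derC (fun w => - F w) z (- l).
Proof.
move=> [p [cp <- Fp]]; exists (fun w => - p w); split => //; first exact: cvgC_opp.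
by apply: filterS Fp => w Fw; rewrite mulNr -Fw; ring.
Qed.

Lemma derC_sub F G z l m : derC F z l -> derC G z m -> derC (fun w => F w - G w) z (l - m).
Proof. by move=> dF dG; apply: derC_add => //; exact: derC_opp. Qed.

Lemma derC_comp F G z l m : derC F z l -> derC G (F z) m ->
  derC (fun w => G (F w)) z (m * l).
Proof.
move=> dF; have cF := derC_cont dF; move: dF => [p [cp <- Fp]] [q [cq <- Gq]].
exists (fun w => q (F w) * p w); split => //.
  by apply: cvgC_mul => //; exact: cvgC_comp.
have Gq' : \forall w \near nbC z, G (F w) - G (F z) = q (F w) * (F w - F z).
  exact: (cvgC_to_nbC cF Gq).
by apply: filterS2 Fp Gq' => w Fw ->; rewrite Fw mulrA.
Qed.

Lemma nbC_neq z a : z != a -> \forall w \near nbC z, w != a.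
Proof.
move=> za; apply/nbC_ball; exists (cmod (z - a)); first by rewrite cmod_gt0 subr_eq0.
by move=> w; apply: contraTneq => ->; rewrite cmodBC -leNgt.
Qed.

Lemma derC_inv z : z != 0 -> derC (fun w => w^-1) z (- (z^-1 * z^-1)).
Proof.
move=> z0; exists (fun w => - (w^-1 * z^-1)); split => //.
  apply: cvgC_opp; apply: cvgC_mul; last exact: cvgC_cst.
  by apply: cvgC_inv => //; exact: cvgC_id.
by apply: filterS (nbC_neq z0) => w w0; field; rewrite z0 w0.
Qed.

Lemma derC_quotient F z l : derC F z l <-> forall eps : R, 0 < eps ->
    exists2 delta : R, 0 < delta & forall h : C, h != 0 -> cmod h < delta ->
      cmod ((F (z + h) - F z) / h - l) < eps.
Proof.
split=> [[p [cp <- Fp]] eps eps0|H].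
  have /nbC_ball[d1 d10 H1] := Fp; have /contCP/(_ _ eps0)[d2 d20 H2] := cp.
  exists (Num.min d1 d2); first by rewrite lt_min d10.
  move=> h h0; rewrite lt_min => /andP[hd1 hd2].
  have e : z + h - z = h by rewrite addrC addKr.
  rewrite H1 e // mulfK //; apply: H2; by rewrite e.
exists (fun w => if w == z then l else (F w - F z) / (w - z)); split => //.
- apply/contCP => eps eps0; have [d d0 dH] := H _ eps0; exists d => // w wd.
  rewrite eqxx; case: eqP => [_|/eqP wz]; first by rewrite subrr cmod0.
  have := dH (w - z); rewrite subr_eq0 wz subrKC; exact.
- by rewrite eqxx.
- apply: nearW => w; case: eqP => [->|/eqP wz]; first by rewrite !subrr mulr0.
  by rewrite divfK // subr_eq0.
Qed.

Lemma derC_eps F z l : (forall eps : R, 0 < eps ->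
    \forall w \near nbC z, cmod (F w - F z - l * (w - z)) <= eps * cmod (w - z)) ->
  derC F z l.
Proof.
move=> H; apply/derC_quotient => eps eps0.
have e2 : 0 < eps / 2 by rewrite divr_gt0.
have /nbC_ball[d d0 dH] := H _ e2; exists d => // h h0 hd.
have e : z + h - z = h by rewrite addrC addKr.
have := dH (z + h); rewrite e => /(_ hd) Hh.
have -> : (F (z + h) - F z) / h - l = (F (z + h) - F z - l * h) / h by field.
rewrite cmodM cmodV ltr_pdivrMr ?cmod_gt0 //; apply: (le_lt_trans Hh).
by rewrite ltr_pM2r ?cmod_gt0 // ltr_pdivrMr // ltr_pMr // ltrDl.
Qed.

End ComplexDerivative.

(** * Complex exponential, principal logarithm and real powers *)

Section ExpLog.
Variable R : realType.
Local Notation C := (R[i]).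
Implicit Types z w : C.

Definition cexp z : C := cR (expR (Re z)) * expi (Im z).
(* Principal branch on the right half-plane; [clog] and [cpow] carry no meaning elsewhere. *)
Definition clog z : C := Complex (ln (cmod z)) (atan (Im z / Re z)).
Definition cpow z (a : R) : C := cexp (cR a * clog z).

Lemma expiD (s t : R) : expi (s + t) = expi s * expi t.
Proof. by apply: cmplx_eq; rewrite !ReImE /= ?cosD ?sinD // addrC. Qed.

Lemma expi0 : expi (0 : R) = 1.
Proof. by apply: cmplx_eq; rewrite /= ?cos0 ?sin0. Qed.

Lemma cexpD z w : cexp (z + w) = cexp z * cexp w.
Proof. by rewrite /cexp !ReImE expRD expiD cRM; ring. Qed.

Lemma cexp0 : cexp 0 = 1.
Proof. by rewrite /cexp /= expR0 expi0 mulr1. Qed.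

Lemma cvg_Re z : Re w @[w --> nbC z] --> Re z.
Proof. exact: (cvgC_id z).1. Qed.
Lemma cvg_Im z : Im w @[w --> nbC z] --> Im z.
Proof. exact: (cvgC_id z).2. Qed.

Lemma is_derive_eps (f : R -> R) (x l : R) : is_derive x 1 f l ->
  forall eps, 0 < eps -> exists2 d : R, 0 < d &
    forall y, `|y| < d -> `|f (y + x) - f x - l * y| <= eps * `|y|.
Proof.
move=> [df lf] eps eps0; have : h^-1 *: (f (h *: 1 + x) - f x) @[h --> 0^'] --> l.
  by rewrite -lf; exact: df.
move=> /cvgrPdist_le/(_ _ eps0)/nbhs_ballP[d /= d0 dH]; exists d => // y yd.
have [->|y0] := eqVneq y 0; first by rewrite add0r subrr mulr0 subrr normr0 mulr0.
have := dH y; rewrite /ball /= sub0r normrN => /(_ yd y0).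
rewrite [_ *: 1]mulr1 /GRing.scale /= => H.
have -> : f (y + x) - f x - l * y = - ((l - y^-1 * (f (y + x) - f x)) * y) by field.
by rewrite normrN normrM ler_wpM2r.
Qed.

Lemma derC_cexp0 : derC cexp 0 1.
Proof.
(* The remainder of [cexp] splits into three real and three imaginary terms, each at most
   [e * cmod w], whence the 6. The bound [e <= 1] and the radius [e / 2] give [|sin y| <= e]. *)
apply: derC_eps => eps eps0; set e := Num.min (eps / 6) 1.
have e0 : 0 < e by rewrite lt_min divr_gt0 // ltr01.
have e1 : e <= 1 by rewrite ge_min lexx orbT.
have e6 : e * 6 <= eps by rewrite -ler_pdivlMr // ge_min lexx.
clearbody e.
have [d1 d10 H1] := is_derive_eps (is_derive_expR 0) e0.
have [d2 d20 H2] := is_derive_eps (is_derive_cos 0) e0.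
have [d3 d30 H3] := is_derive_eps (is_derive_sin 0) e0.
apply/nbC_ball; exists (Num.min d1 (Num.min d2 (Num.min d3 (e / 2)))).
  by rewrite !lt_min d10 d20 d30 divr_gt0.
move=> w; rewrite subr0 !lt_min => /and4P[w1 w2 w3 w4].
rewrite cexp0 mul1r; move: (Re_le_cmod w) (Im_le_cmod w) (H1 (Re w)) (H2 (Im w)) (H3 (Im w)).
rewrite !addr0 expR0 cos0 sin0 !mul1r oppr0 !mul0r ?oppr0 !addr0.
set k := cmod w in w1 w2 w3 w4 *; set x := Re w; set y := Im w => xk yk.
move=> /(_ (le_lt_trans xk w1)) h1 /(_ (le_lt_trans yk w2)) h2 /(_ (le_lt_trans yk w3)) h3.
have c1 : `|cos y| <= 1 by rewrite ler_norml cos_geN1 cos_le1.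
have s1 : `|sin y| <= 1 by rewrite ler_norml sin_geN1 sin_le1.
have k0 : 0 <= k by exact: cmod_ge0.
have m : forall a b : R, `|a| <= b -> forall c, `|c| <= 1 -> `|a * c| <= b.
  by move=> a b ab c c1'; rewrite normrM (le_trans _ ab) // ler_piMr.
have h1' := le_trans h1 (ler_wpM2l (ltW e0) xk).
have h2' := le_trans h2 (ler_wpM2l (ltW e0) yk).
have h3' := le_trans h3 (ler_wpM2l (ltW e0) yk).
have hc : `|cos y - 1| <= e by apply: (le_trans h2'); rewrite ler_piMr ?(ltW e0) //; lra.
have hs : `|sin y| <= e.
  rewrite -[sin y](subrK y) (le_trans (ler_normD _ _)) //.
  have : e * k <= k by rewrite ler_piMl.
  by move: h3' yk w4 => /=; lra.
have hxc : `|x * (cos y - 1)| <= e * k by rewrite normrM mulrC ler_pM.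
have hxs : `|x * sin y| <= e * k by rewrite normrM mulrC ler_pM.
have a1 := m _ _ h1' _ c1; have a2 := m _ _ h1' _ s1.
apply: (le_trans (cmod_le _)); rewrite !ReImE /= -/x -/y !mul0r subr0 addr0 oppr0 addr0.
have -> : expR x * cos y - 1 - x = (expR x - 1 - x) * cos y + (cos y - 1) + x * (cos y - 1) by ring.
have -> : expR x * sin y - y = (expR x - 1 - x) * sin y + (sin y - y) + x * sin y by ring.
have ek : e * 6 * k <= eps * k by rewrite ler_wpM2r.
have := ler_normD ((expR x - 1 - x) * cos y + (cos y - 1)) (x * (cos y - 1)).
have := ler_normD ((expR x - 1 - x) * cos y) (cos y - 1).
have := ler_normD ((expR x - 1 - x) * sin y + (sin y - y)) (x * sin y).
have := ler_normD ((expR x - 1 - x) * sin y) (sin y - y).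
lra.
Qed.

Lemma derC_cexp z : derC cexp z (cexp z).
Proof.
have dz : derC (fun w => w - z) z 1.
  by have := derC_sub (derC_id z) (derC_cst z z); rewrite subr0.
have d0 : derC cexp (z - z) 1 by rewrite subrr; exact: derC_cexp0.
have := derC_mul (derC_cst (cexp z) z) (derC_comp dz d0).
rewrite mul0r add0r !mulr1; apply: derC_near.
by apply: nearW => w; rewrite -cexpD subrKC.
Qed.

Lemma Re_gt0_cmod z : 0 < Re z -> 0 < cmod z.
Proof. by move=> z0; apply: lt_le_trans (Re_le_cmod z); rewrite gtr0_norm. Qed.

Lemma contC_clog z : 0 < Re z -> contC clog z.
Proof.
move=> z0; have zn0 := Re_gt0_cmod z0.
split => /=.
  exact: (cvg_comp _ _ (cvgC_cmod (cvgC_id z)) (continuous_ln zn0)).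
have cv : Im w / Re w @[w --> nbC z] --> Im z / Re z.
  by apply: cvgM; [exact: cvg_Im|apply: cvgV; [rewrite gt_eqF|exact: cvg_Re]].
exact: (cvg_comp _ _ cv (@continuous_atan R _)).
Qed.

Lemma expi_arg z : 0 < Re z -> cR (cmod z) * expi (atan (Im z / Re z)) = z.
Proof.
move=> z0; have zn0 := Re_gt0_cmod z0.
have c : cos (atan (Im z / Re z)) = Re z / cmod z.
  rewrite cos_atan.
  have -> : 1 + (Im z / Re z) ^+ 2 = (cmod z / Re z) ^+ 2.
    by rewrite !expr_div_n cmod_sqr; field; rewrite gt_eqF.
  by rewrite sqrtr_sqr ger0_norm ?divr_ge0 ?ltW // invf_div.
have s : sin (atan (Im z / Re z)) = Im z / cmod z.
  have c0 : cos (atan (Im z / Re z)) != 0 by rewrite c mulf_neq0 // ?invr_neq0 // gt_eqF.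
  apply: (mulIf (invr_neq0 c0)); rewrite -/(tan _) atanK c.
  by field; rewrite !gt_eqF.
by apply: cmplx_eq; rewrite !ReImE /= c s mul0r ?subr0 ?addr0 mulrC divfK // gt_eqF.
Qed.

Lemma clogK z : 0 < Re z -> cexp (clog z) = z.
Proof.
move=> z0; have zn0 := Re_gt0_cmod z0.
by rewrite /cexp /= lnK ?posrE // expi_arg.
Qed.

Lemma near_Re_gt0 z : 0 < Re z -> \forall w \near nbC z, 0 < Re w.
Proof.
move=> z0; move/cvgrPdist_lt : (@cvg_Re z) => /(_ _ z0).
by apply: filterS => w; rewrite ltr_distl => /andP[]; lra.
Qed.

(** Inverse function rule in Caratheodory form: the factor [psi] of [cexp] at [clog z] takes the
    value [z <> 0] there, so it stays nonzero nearby and its inverse is the factor of [clog]. *)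
Lemma derC_clog z : 0 < Re z -> derC clog z z^-1.
Proof.
move=> z0; have zn0 : z != 0 by rewrite -cmod_gt0 Re_gt0_cmod.
have cl := contC_clog z0.
have [psi [cpsi psiz H]] := derC_cexp (clog z).
rewrite clogK // in psiz.
have cc : cvgC (nbC z) (fun w => psi (clog w)) z.
  suff : cvgC (nbC z) (fun w => psi (clog w)) (psi (clog z)) by rewrite psiz.
  exact: cvgC_comp.
exists (fun w => (psi (clog w))^-1); split.
- by rewrite /contC psiz; exact: cvgC_inv.
- by rewrite psiz.
have H' : \forall w \near nbC z, cexp (clog w) - cexp (clog z) = psi (clog w) * (clog w - clog z).
  exact: (cvgC_to_nbC cl H).
have H0 : \forall w \near nbC z, psi (clog w) != 0 by exact: (cvgC_to_nbC cc (nbC_neq zn0)).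
have Hp := near_Re_gt0 z0.
near=> w.
have -> : w - z = psi (clog w) * (clog w - clog z).
  rewrite -(near H' w) // !clogK //; exact: (near Hp w).
by rewrite mulKf //; exact: (near H0 w).
Unshelve. all: by end_near.
Qed.

Lemma derC_cpow z a : 0 < Re z -> derC (fun w => cpow w a) z (cR a * cpow z a / z).
Proof.
move=> z0; have := derC_comp (derC_mul (derC_cst (cR a) z) (derC_clog z0)) (derC_cexp _).
by rewrite mul0r add0r; congr derC; rewrite /cpow; ring.
Qed.

Definition carg z : R := atan (Im z / Re z).

Lemma carg_bound z : `|carg z| < pi / 2.
Proof. by rewrite ltr_norml atan_gtNpi2 atan_ltpi2. Qed.

Lemma cpowE z a : 0 < Re z -> cpow z a = cR (cmod z `^ a) * expi (a * carg z).
Proof.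
move=> /Re_gt0_cmod z0; rewrite /cpow /cexp !ReImE /= !mul0r subr0 addr0.
by rewrite /powR gt_eqF.
Qed.

Lemma cmod_cpow z a : 0 < Re z -> cmod (cpow z a) = cmod z `^ a.
Proof. by move=> z0; rewrite cpowE // cmodM cmod_expi mulr1 cmod_cR ger0_norm // powR_ge0. Qed.

Lemma cpowN z a : cpow z a * cpow z (- a) = 1.
Proof.
rewrite /cpow -cexpD -mulrDl.
have -> : cR a + cR (- a) = 0 :> C by apply: cmplx_eq; rewrite /= ?subrr ?addr0.
by rewrite mul0r cexp0.
Qed.

Lemma cpow_neq0 z a : cpow z a != 0.
Proof. by apply/negP => /eqP h; have := cpowN z a; rewrite h mul0r => /eqP; rewrite eq_sym oner_eq0. Qed.

Lemma cpow1 a : cpow (1 : C) a = 1.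
Proof.
rewrite /cpow /clog cmod1 ln1 /= mul0r atan0.
have -> : Complex 0 0 = 0 :> C by [].
by rewrite mulr0 cexp0.
Qed.

End ExpLog.

(** * Cauchy's theorem on circles *)

Section IntervalIntegral.
Variable R : realType.
Local Notation leb := (@lebesgue_measure R).
Implicit Types (f g : R -> R) (a b c : R).

Definition Jint f a b : R := \int[leb]_(t in `[a, b]) f t.

Lemma cont_integrable f a b : continuous f -> leb.-integrable `[a, b] (EFin \o f).
Proof.
move=> cf; apply: continuous_compact_integrable; first exact: segment_compact.
exact: continuous_subspaceT.
Qed.

Lemma Jint_split f a b c : continuous f -> a <= b -> b <= c -> Jint f a c = Jint f a b + Jint f b c.
Proof.
move=> cf ab bc; have := @Rintegral_itvB R f (BLeft a) (BRight c) b (cont_integrable _ _ cf).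
rewrite !bnd_simp => /(_ ab bc) /eqP; rewrite subr_eq addrC => /eqP.
rewrite /Jint => ->; congr (_ + _); apply: Rintegral_itv_obnd_cbnd.
by apply: integrableS (cont_integrable b c cf) => //; exact: subset_itv_oc_cc.
Qed.

Lemma Jint_le f a b (m : R) : continuous f -> a <= b ->
  (forall t, a <= t <= b -> `|f t| <= m) -> `|Jint f a b| <= m * (b - a).
Proof.
move=> cf ab fm.
have mc : leb.-integrable `[a, b] (EFin \o (fun=> m)) by apply: cont_integrable; exact: cst_continuous.
have e : \int[leb]_(t in `[a, b]) m = m * (b - a).
  by rewrite Rintegral_cst //=; rewrite lebesgue_measure_itv /= lte_fin; case: ltgtP ab => // ->; rewrite subrr.
apply: (le_trans (le_normr_Rintegral _ (cont_integrable _ _ cf))) => //.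
rewrite -e; apply: le_Rintegral => //.
  apply: (@cont_integrable (fun t => `|f t|)) => x; apply: continuous_comp; first exact: cf.
  exact: norm_continuous.
Qed.

Lemma JintB f g a b : continuous f -> continuous g ->
  Jint (fun t => f t - g t) a b = Jint f a b - Jint g a b.
Proof. by move=> cf cg; rewrite /Jint RintegralB //; exact: cont_integrable. Qed.

Lemma Jint_FTC f (F : R -> R) a b : a < b -> continuous f ->
  (forall x : R, is_derive x 1 F (f x)) -> Jint f a b = F b - F a.
Proof.
move=> ab cf dF; rewrite /Jint /Rintegral (@continuous_FTC2 R f F) //.
- exact: continuous_subspaceT.
- have cF : continuous F by move=> x; apply/differentiable_continuous/derivable1_diffP.
  split; first by move=> x _.
  + by apply: cvg_at_right_filter; exact: cF.
  + by apply: cvg_at_left_filter; exact: cF.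
- by move=> x _; rewrite derive1E derive_val.
Qed.

End IntervalIntegral.

Section Bisection.
Variable R : realType.

(** Goursat's subdivision detached from integrals: [I x y s] belongs to the rectangle with corner
    [(x, y)] and sides [s (b - a)], [s (d - c)]. If the bound failed, it would fail on a nested
    sequence of quarters, contradicting the local bound at their common point. *)
Lemma quadrisection (I : R -> R -> R -> R) (a b c d eps : R) : a < b -> c < d -> 0 < eps ->
  (forall x y s, 0 < s -> I x y s = I x y (s / 2) + I (x + s / 2 * (b - a)) y (s / 2) +
     I x (y + s / 2 * (d - c)) (s / 2) + I (x + s / 2 * (b - a)) (y + s / 2 * (d - c)) (s / 2)) ->
  (forall x0 y0, exists2 delta : R, 0 < delta & forall x y s, 0 < s < delta ->
     x <= x0 <= x + s * (b - a) -> y <= y0 <= y + s * (d - c) -> `|I x y s| <= eps * s ^+ 2) ->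
  `|I a c 1| <= eps.
Proof.
move=> ab cd e0 split4 loc; rewrite leNgt; apply/negP => bad.
set A := b - a; set B := d - c.
have A0 : 0 < A by rewrite subr_gt0.
have B0 : 0 < B by rewrite subr_gt0.
pose h n : R := 2^-1 ^+ n.
have h0 n : 0 < h n by rewrite exprn_gt0 // invr_gt0.
have hS n : h n.+1 = h n / 2 by rewrite /h exprSr.
pose bd n (q : R * R) := eps * h n ^+ 2 < `|I q.1 q.2 (h n)|.
pose rel n (q q' : R * R) := [/\ bd n.+1 q', q.1 <= q'.1, q'.1 + h n.+1 * A <= q.1 + h n * A,
  q.2 <= q'.2 & q'.2 + h n.+1 * B <= q.2 + h n * B].
have step n q : bd n q -> exists q', rel n q q'.
  move=> bq; apply: contrapT => /forallNP nq.
  have lem x y : q.1 <= x -> x + h n.+1 * A <= q.1 + h n * A -> q.2 <= y ->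
      y + h n.+1 * B <= q.2 + h n * B -> `|I x y (h n.+1)| <= eps * h n.+1 ^+ 2.
    by move=> x1 x2 y1 y2; rewrite leNgt; apply/negP => H; apply: (nq (x, y)).
  move: bq; rewrite /bd split4 // -/A -/B -hS; apply/negP; rewrite -leNgt.
  have hA : 0 < h n.+1 * A by rewrite mulr_gt0.
  have hB : 0 < h n.+1 * B by rewrite mulr_gt0.
  have hAe : h n * A = h n.+1 * A + h n.+1 * A by rewrite hS; field.
  have hBe : h n * B = h n.+1 * B + h n.+1 * B by rewrite hS; field.
  have l1 := lem q.1 q.2; have l2 := lem (q.1 + h n.+1 * A) q.2.
  have l3 := lem q.1 (q.2 + h n.+1 * B); have l4 := lem (q.1 + h n.+1 * A) (q.2 + h n.+1 * B).
  have {}l1 := l1 ltac:(lra) ltac:(lra) ltac:(lra) ltac:(lra).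
  have {}l2 := l2 ltac:(lra) ltac:(lra) ltac:(lra) ltac:(lra).
  have {}l3 := l3 ltac:(lra) ltac:(lra) ltac:(lra) ltac:(lra).
  have {}l4 := l4 ltac:(lra) ltac:(lra) ltac:(lra) ltac:(lra).
  have -> : eps * h n ^+ 2 = eps * h n.+1 ^+ 2 + eps * h n.+1 ^+ 2 + eps * h n.+1 ^+ 2 + eps * h n.+1 ^+ 2.
    by rewrite hS; field.
  by do 3 (apply: le_trans (ler_normD _ _) _; apply: lerD => //).
(* The default [q] is never reached from a bad rectangle, and every [sq n] is bad. *)
pose next n q := if pselect (exists q', rel n q q') is left e then projT1 (cid e) else q.
have nextP n q : bd n q -> rel n q (next n q).
  move=> /step ex; rewrite /next; case: pselect => // e; exact: projT2 (cid e).
pose sq := fix sq n : R * R := if n is m.+1 then next m (sq m) else (a, c).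
have bdsq n : bd n (sq n).
  elim: n => [|n /nextP []//]; by rewrite /bd /h expr0 expr1n mulr1.
have rl n : rel n (sq n) (sq n.+1) by exact: nextP.
have mono n k : [/\ (sq n).1 <= (sq (n + k)%N).1, (sq (n + k)%N).1 + h (n + k)%N * A <= (sq n).1 + h n * A,
   (sq n).2 <= (sq (n + k)%N).2 & (sq (n + k)%N).2 + h (n + k)%N * B <= (sq n).2 + h n * B].
  elim: k => [|k [i1 i2 i3 i4]]; first by rewrite addn0.
  rewrite addnS; have [_ r1 r2 r3 r4] := rl (n + k)%N.
  split; [exact: le_trans r1|exact: le_trans i2|exact: le_trans r3|exact: le_trans i4].
have between (u : nat -> R) (K : R) : 0 < K ->
   (forall n k, u n <= u (n + k)%N /\ u (n + k)%N + h (n + k)%N * K <= u n + h n * K) ->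
   exists x, forall n, u n <= x <= u n + h n * K.
  move=> K0 H; have hK n : 0 < h n * K by rewrite mulr_gt0.
  have ub n : ubound (range u) (u n + h n * K).
    move=> _ [m _ <-]; have [nm|/ltnW mn] := leqP n m.
      by have [_] := H n (m - n)%N; rewrite subnKC //; have := hK m; lra.
    by have [+ _] := H m (n - m)%N; rewrite subnKC //; have := hK n; lra.
  (* Each right endpoint bounds all left endpoints, so the supremum of the left endpoints lies in
     every interval. *)
  exists (sup (range u)) => n; apply/andP; split.
    by apply: ub_le_sup; [exists (u 0%N + h 0%N * K); exact: ub|exists n].
  by apply: ge_sup; [exists (u 0%N); exists 0%N|exact: ub].
have [x0 xP] : exists x, forall n, (sq n).1 <= x <= (sq n).1 + h n * A.
  by apply: between => // n k; have [? ? _ _] := mono n k.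
have [y0 yP] : exists x, forall n, (sq n).2 <= x <= (sq n).2 + h n * B.
  by apply: between => // n k; have [_ _ ? ?] := mono n k.
have [delta d0 H] := loc x0 y0.
have hcv : h n @[n --> \oo] --> (0 : R) by apply: cvg_expr; rewrite ger0_norm; lra.
move/cvgrPdist_lt : hcv => /(_ _ d0) [N _ /(_ N (leqnn N))].
rewrite /= sub0r normrN ger0_norm ?ltW // => hN.
have := H _ _ (h N) _ (xP N) (yP N); rewrite h0 hN => /(_ isT).
by rewrite leNgt; have := bdsq N; rewrite /bd => ->.
Qed.

End Bisection.

Section PathDerivative.
Variable R : realType.
Local Notation C := (R[i]).

Definition dC (g : R -> C) (t : R) (l : C) :=
  is_derive t 1 (fun x => Re (g x)) (Re l) /\ is_derive t 1 (fun x => Im (g x)) (Im l).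

Lemma dC_cvg g t l : dC g t l -> cvgC (nbhs t) g (g t).
Proof.
by move=> [[d1 _] [d2 _]]; split; apply/differentiable_continuous/derivable1_diffP.
Qed.

Lemma dC_mul g h t l m : dC g t l -> dC h t m -> dC (fun x => g x * h x) t (l * h t + g t * m).
Proof.
move=> [d1 d2] [e1 e2]; split.
  under eq_fun do rewrite ReM.
  apply: is_derive_eq; rewrite !ReImE /GRing.scale /=; ring.
under eq_fun do rewrite ImM.
apply: is_derive_eq; rewrite !ReImE /GRing.scale /=; ring.
Qed.

Lemma dC_cst (z : C) t : dC (fun=> z) t 0.
Proof. by split; exact: is_derive_cst. Qed.

Lemma dC_add g h t l m : dC g t l -> dC h t m -> dC (fun x => g x + h x) t (l + m).
Proof.
move=> [d1 d2] [e1 e2]; split.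
  by rewrite ReD; under eq_fun do rewrite ReD; exact: is_deriveD.
by rewrite ImD; under eq_fun do rewrite ImD; exact: is_deriveD.
Qed.

End PathDerivative.

Section Goursat.
Variable R : realType.
Local Notation C := (R[i]).
(* [phi dz] is pulled back by the parametrisation [Phi] of a region; [B] integrates it over the boundary of a rectangle, real part only. *)
Variables (phi : C -> C) (Phi Phis Phiy : R -> R -> C) (L : R).
Hypothesis dPs : forall s y, dC (Phi ^~ y) s (Phis s y).
Hypothesis dPy : forall s y, dC (Phi s) y (Phiy s y).
Hypothesis cPs : forall s y, cvgC (nbhs s) (Phis ^~ y) (Phis s y).
Hypothesis cPy : forall s y, cvgC (nbhs y) (Phiy s) (Phiy s y).
Hypothesis bPs : forall s y, cmod (Phis s y) <= L.
Hypothesis bPy : forall s y, cmod (Phiy s y) <= L.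
Hypothesis Lip : forall s y s0 y0, cmod (Phi s y - Phi s0 y0) <= L * (`|s - s0| + `|y - y0|).
Hypothesis dphi : forall s y, exists l, derC phi (Phi s y) l.

Let P (f : C -> C) s y := Re (f (Phi s y) * Phis s y).
Let Q (f : C -> C) s y := Re (f (Phi s y) * Phiy s y).
Let B f a c b d := Jint (P f ^~ c) a b + Jint (Q f b) c d - Jint (P f ^~ d) a b - Jint (Q f a) c d.

Let contP f y : (forall s y, contC f (Phi s y)) -> continuous (P f ^~ y).
Proof.
move=> cf s.
suff cc : cvgC (nbhs s) (fun s => f (Phi s y) * Phis s y) (f (Phi s y) * Phis s y) by exact: cc.1.
by apply: cvgC_mul => //; apply: cvgC_comp => //; exact: (dC_cvg (dPs s y)).
Qed.

Let contQ f s : (forall s y, contC f (Phi s y)) -> continuous (Q f s).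
Proof.
move=> cf y.
suff cc : cvgC (nbhs y) (fun y => f (Phi s y) * Phiy s y) (f (Phi s y) * Phiy s y) by exact: cc.1.
by apply: cvgC_mul => //; apply: cvgC_comp => //; exact: (dC_cvg (dPy s y)).
Qed.

Let cphi s y : contC phi (Phi s y).
Proof. by have [l /derC_cont] := dphi s y. Qed.

(** An affine function has the primitive [u z + v (z - z0)^2 / 2], so the four sides telescope. *)
Let B_linear (u v z0 : C) a c b d : a < b -> c < d -> B (fun z => u + v * (z - z0)) a c b d = 0.
Proof.
move=> ab cd; set f := fun z => _.
have cf s y : contC f (Phi s y).
  by apply: cvgC_add; [exact: cvgC_cst|apply: cvgC_mul; [exact: cvgC_cst|apply: cvgC_sub; [exact: cvgC_id|exact: cvgC_cst]]].
pose U s y := Re (u * Phi s y + (v * (Complex 2^-1 0)) * ((Phi s y - z0) * (Phi s y - z0))).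
have half : (Complex 2^-1 0 : C) + Complex 2^-1 0 = 1.
  by apply: cmplx_eq; rewrite /= ?addr0 //; field.
have key (g : R -> C) t l : dC g t l -> is_derive t 1
    (fun x => Re (u * g x + (v * Complex 2^-1 0) * ((g x - z0) * (g x - z0)))) (Re (f (g t) * l)).
  move=> dg; have dz : dC (fun x => g x - z0) t l by have := dC_add dg (dC_cst (- z0) t); rewrite addr0.
  have [H _] := dC_add (dC_mul (dC_cst u t) dg) (dC_mul (dC_cst (v * Complex 2^-1 0) t) (dC_mul dz dz)).
  apply: (is_derive_eq H); congr Re; rewrite /f !mul0r !add0r.
  have -> : v * Complex 2^-1 0 * (l * (g t - z0) + (g t - z0) * l) = v * (Complex 2^-1 0 + Complex 2^-1 0) * (g t - z0) * l by ring.
  by rewrite half; ring.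
have dUs (s y : R) : is_derive s 1 (U ^~ y) (P f s y) by exact: (key (Phi ^~ y)).
have dUy (s y : R) : is_derive y 1 (U s) (Q f s y) by exact: (key (Phi s)).
rewrite /B (Jint_FTC ab (@contP f _ cf) (fun x => dUs x c)) (Jint_FTC ab (@contP f _ cf) (fun x => dUs x d)).
rewrite (Jint_FTC cd (@contQ f _ cf) (dUy b)) (Jint_FTC cd (@contQ f _ cf) (dUy a)).
ring.
Qed.

Let B_sub f g a c b d : (forall s y, contC f (Phi s y)) -> (forall s y, contC g (Phi s y)) ->
  B (fun z => f z - g z) a c b d = B f a c b d - B g a c b d.
Proof.
move=> cf cg; rewrite /B.
have eP y : P (fun z => f z - g z) ^~ y = (fun s => P f s y - P g s y).
  by apply/funext => s; rewrite /P mulrBl ReB.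
have eQ s : Q (fun z => f z - g z) s = (fun y => Q f s y - Q g s y).
  by apply/funext => y; rewrite /Q mulrBl ReB.
rewrite !eP !eQ !JintB; try (exact: contP || exact: contQ).
ring.
Qed.

Let B_bound f (m : R) a c b d : (forall s y, contC f (Phi s y)) -> a <= b -> c <= d ->
  (forall s y, a <= s <= b -> c <= y <= d -> cmod (f (Phi s y)) <= m) ->
  `|B f a c b d| <= (m * L) * ((b - a) + (d - c)) *+ 2.
Proof.
move=> cf ab cd H.
have hP y : c <= y <= d -> `|Jint (P f ^~ y) a b| <= (m * L) * (b - a).
  move=> cyd; apply: Jint_le => //; first exact: contP.
  move=> t tab; apply: (le_trans (Re_le_cmod _)); rewrite cmodM.
  by rewrite ler_pM ?cmod_ge0 // H.
have hQ s : a <= s <= b -> `|Jint (Q f s) c d| <= (m * L) * (d - c).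
  move=> sab; apply: Jint_le => //; first exact: contQ.
  move=> t tab; apply: (le_trans (Re_le_cmod _)); rewrite cmodM.
  by rewrite ler_pM ?cmod_ge0 // H.
have := hP c; rewrite lexx cd => /(_ isT) h1.
have := hP d; rewrite lexx cd => /(_ isT) h2.
have := hQ a; rewrite lexx ab => /(_ isT) h3.
have := hQ b; rewrite lexx ab => /(_ isT) h4.
rewrite /B; have := ler_normB (Jint (P f ^~ c) a b + Jint (Q f b) c d - Jint (P f ^~ d) a b) (Jint (Q f a) c d).
have := ler_normB (Jint (P f ^~ c) a b + Jint (Q f b) c d) (Jint (P f ^~ d) a b).
have := ler_normD (Jint (P f ^~ c) a b) (Jint (Q f b) c d).
rewrite mulrDr mulr2n; lra.
Qed.

(** The first-order Taylor polynomial at a point has zero boundary integral by [B_linear]; what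
    remains on a rectangle of scale [s] around that point is [o(s)] times a boundary of length
    [O(s)], as [quadrisection] requires. Continuity of the derivative of [phi] is never at hand. *)
Lemma goursat a b c d : a < b -> c < d -> B phi a c b d = 0.
Proof.
move=> ab cd; apply/normr0_eq0/eqP; rewrite eq_le normr_ge0 andbT.
apply/ler_addgt0Pr => eps e0; rewrite add0r.
have L0 : 0 <= L by apply: le_trans (bPs 0 0); exact: cmod_ge0.
set A1 := b - a; set B1 := d - c.
have A0 : 0 < A1 by rewrite subr_gt0.
have B0 : 0 < B1 by rewrite subr_gt0.
pose I x y s := B phi x y (x + s * A1) (y + s * B1).
have := @quadrisection R I a b c d eps ab cd e0.
rewrite /I !mul1r [a + _]addrC [c + _]addrC !subrK; apply.
  move=> x y s s0; rewrite -/A1 -/B1.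
  have hA : 0 < s / 2 * A1 by rewrite !mulr_gt0.
  have hB : 0 < s / 2 * B1 by rewrite !mulr_gt0.
  have eA : s * A1 = s / 2 * A1 + s / 2 * A1 by field.
  have eB : s * B1 = s / 2 * B1 + s / 2 * B1 by field.
  rewrite eA eB !addrA; set x1 := x + s / 2 * A1; set y1 := y + s / 2 * B1.
  set x2 := x1 + s / 2 * A1; set y2 := y1 + s / 2 * B1.
  have x01 : x <= x1 by rewrite lerDl ltW.
  have x12 : x1 <= x2 by rewrite lerDl ltW.
  have y01 : y <= y1 by rewrite lerDl ltW.
  have y12 : y1 <= y2 by rewrite lerDl ltW.
  have sP z := Jint_split (@contP phi z cphi) x01 x12.
  have sQ z := Jint_split (@contQ phi z cphi) y01 y12.
  rewrite /B !sP !sQ; ring.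
move=> x0 y0; rewrite -/A1 -/B1; have [l [psi [cpsi psil H]]] := dphi x0 y0.
set z0 := Phi x0 y0 in cpsi psil H.
(* The sup of the remainder, [(eps / k) L s (A1 + B1)], times the speed bound [L], times the
   parameter perimeter [2 s (A1 + B1)], is then at most [eps s^2]; the 1 keeps [k] positive. *)
pose k := L * L * (A1 + B1) * (A1 + B1) * 2 + 1.
have k0 : 0 < k by rewrite ltr_wpDl // !mulr_ge0 // addr_ge0 // ltW.
have ek : 0 < eps / k by rewrite divr_gt0.
have /nbC_ball[d1 d10 H1] := H; have /contCP/(_ _ ek)[d2 d20 H2] := cpsi.
set dd := Num.min d1 d2; have dd0 : 0 < dd by rewrite lt_min d10.
(* With [s < dd / q] the image of the rectangle stays in the ball of radius [dd] about [z0]. *)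
pose q := L * (A1 + B1) + 1.
have q0 : 0 < q by rewrite ltr_wpDl // mulr_ge0 // addr_ge0 // ltW.
exists (dd / q); first by rewrite divr_gt0.
move=> x y s /andP[s0 sd] xx yy.
have cf s' y' : contC (fun z => phi z0 + l * (z - z0)) (Phi s' y').
  by apply: cvgC_add; [exact: cvgC_cst|apply: cvgC_mul; [exact: cvgC_cst|apply: cvgC_sub; [exact: cvgC_id|exact: cvgC_cst]]].
have sA : 0 < s * A1 by rewrite mulr_gt0.
have sB : 0 < s * B1 by rewrite mulr_gt0.
have -> : B phi x y (x + s * A1) (y + s * B1) =
  B (fun z => phi z - (phi z0 + l * (z - z0))) x y (x + s * A1) (y + s * B1).
  by rewrite B_sub // B_linear ?subr0 // ltrDl.
have hb s' y' : x <= s' <= x + s * A1 -> y <= y' <= y + s * B1 ->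
    cmod (phi (Phi s' y') - (phi z0 + l * (Phi s' y' - z0))) <= eps / k * (L * (s * (A1 + B1))).
  move=> hs hy.
  have dist : cmod (Phi s' y' - z0) <= L * (s * (A1 + B1)).
    apply: (le_trans (Lip _ _ _ _)); apply: ler_wpM2l => //; rewrite mulrDr.
    by apply: lerD; rewrite ler_norml; apply/andP; split; lra.
  have small : L * (s * (A1 + B1)) < dd.
    have : s * q < dd by rewrite -ltr_pdivlMr.
    by rewrite /q mulrDr mulr1 mulrCA; lra.
  have := le_lt_trans dist small; rewrite lt_min => /andP[c1 c2].
  rewrite opprD addrA H1 // -mulrBl cmodM -psil; apply: ler_pM; rewrite ?cmod_ge0 //.
  by apply: ltW; exact: H2.
have cdiff s' y' : contC (fun z => phi z - (phi z0 + l * (z - z0))) (Phi s' y').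
  by apply: cvgC_sub; [exact: cphi|exact: cf].
have xx' : x <= x + s * A1 by rewrite lerDl ltW.
have yy' : y <= y + s * B1 by rewrite lerDl ltW.
apply: (le_trans (B_bound cdiff xx' yy' hb)).
have -> : (eps / k * (L * (s * (A1 + B1))) * L * (x + s * A1 - x + (y + s * B1 - y))) *+ 2 =
  (eps * s ^+ 2) * ((L * L * (A1 + B1) * (A1 + B1) * 2) / k) by field; rewrite gt_eqF.
rewrite ler_piMr //; first by rewrite mulr_ge0 ?sqr_ge0 ?ltW.
by rewrite ler_pdivrMr // mul1r lerDl.
Qed.

End Goursat.

Section Cauchy.
Variable R : realType.
Local Notation C := (R[i]).

Definition hol (F : C -> C) := forall z, cmod z < 1 -> exists l, derC F z l.

Lemma derive1_lipschitz (f df : R -> R) (L : R) : (forall x : R, is_derive x 1 f (df x)) ->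
  (forall x, `|df x| <= L) -> forall x y, `|f x - f y| <= L * `|x - y|.
Proof.
move=> d b; have cf : continuous f by move=> x; apply/differentiable_continuous/derivable1_diffP.
have main x y : y <= x -> `|f x - f y| <= L * `|x - y|.
  move=> yx; have [c _ ->] := MVT_segment yx (fun x _ => d x) (continuous_subspaceT cf).
  by rewrite normrM ler_wpM2r.
move=> x y; have [|/ltW] := leP y x; first exact: main.
by rewrite distrC [`|x - y|]distrC; exact: main.
Qed.

Lemma cos_lipschitz (x y : R) : `|cos x - cos y| <= `|x - y|.
Proof.
rewrite -[leRHS]mul1r; apply: (derive1_lipschitz (df := fun x => - sin x)) => z.
by rewrite normrN sin_max.
Qed.

Lemma sin_lipschitz (x y : R) : `|sin x - sin y| <= `|x - y|.
Proof.
rewrite -[leRHS]mul1r; apply: (derive1_lipschitz (df := cos)) => z.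
by rewrite ler_norml cos_geN1 cos_le1.
Qed.

Lemma expi_lipschitz (x y : R) : cmod (expi x - expi y) <= 2 * `|x - y|.
Proof.
apply: (le_trans (cmod_le _)); rewrite ReB ImB /=.
by have := cos_lipschitz x y; have := sin_lipschitz x y; lra.
Qed.

Lemma dC_expi (y : R) : dC (@expi R) y (Complex 0 1 * expi y).
Proof. by split => /=; apply: is_derive_eq; rewrite mul0r mul1r ?sub0r ?add0r. Qed.

Lemma dC_cR (f : R -> R) (x l : R) : is_derive x 1 f l -> dC (fun x => cR (f x)) x (cR l).
Proof. by move=> df; split => //=; exact: is_derive_cst. Qed.

Lemma expi_2pi : expi (2 * pi) = 1 :> C.
Proof. by apply: cmplx_eq; rewrite /= mulr_natl ?cos2pi ?sin2pi. Qed.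

Section Circle.
Variables (H : C -> C) (rho : R) (w : C).
Hypothesis holH : hol H.
Hypothesis wrho : cmod w < rho.
Hypothesis rho1 : rho < 1.

(** The Cauchy kernel in the angle: on the circle of radius [rho],
    [dz / (i (z - w)) = kern y dy]. *)
Let kern y : C := cR rho * expi y / (cR rho * expi y - w).

Let rho0 : 0 < rho. Proof. exact: le_lt_trans (cmod_ge0 _) wrho. Qed.

Let den_ge y : rho - cmod w <= cmod (cR rho * expi y - w).
Proof. by apply: le_trans (cmodB_ge _ _); rewrite cmodM cmod_expi mulr1 cmod_cR gtr0_norm. Qed.

Let den_le y : cmod (cR rho * expi y - w) <= 2.
Proof.
apply: (le_trans (cmodB_le _ _)); rewrite cmodM cmod_expi mulr1 cmod_cR gtr0_norm //.
by have h1 := wrho; have h2 := rho1; move: (cmod w) h1 => k h1; lra.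
Qed.

Let den_neq0 y : cR rho * expi y - w != 0.
Proof. by rewrite -cmod_gt0; apply: lt_le_trans (den_ge y); rewrite subr_gt0. Qed.

Let Phi (l y : R) : C := w + cR l * (cR rho * expi y - w).

Let Phi_disc l y : 0 <= l <= 1 -> cmod (Phi l y) < 1.
Proof.
move=> /andP[l0 l1]; have -> : Phi l y = (1 - cR l) * w + cR l * (cR rho * expi y) by rewrite /Phi; ring.
apply: (le_lt_trans (cmodD _ _)); rewrite !cmodM cmod_expi mulr1 !cmod_cR.
have -> : cmod (1 - cR l) = 1 - l.
  by rewrite -[1 - cR l]/(Complex (1 - l) (0 - 0)) subr0 cmod_cR ger0_norm // subr_ge0.
rewrite !ger0_norm ?(ltW rho0) //.
have : (1 - l) * cmod w <= (1 - l) * rho by rewrite ler_wpM2l ?subr_ge0 // ltW.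
have h2 := rho1; lra.
Qed.

Let J l := Jint (fun y => Re (H (Phi l y) * kern y)) 0 (2 * pi).

(* The homothety is run through by [cos], so that the parametrisation of the annulus is defined and smooth on the whole plane. *)
Let J_const l0 : 0 < l0 < 1 -> J l0 = J 1.
Proof.
move=> /andP[l00 l01].
(* These give [x 0 = 1] and [x pi = l0], so that [0 <= s <= pi] sweeps the region between the two
   circles. *)
pose m := (1 + l0) / 2; pose n := (1 - l0) / 2.
have n0 : 0 < n by rewrite divr_gt0 // subr_gt0.
have n1 : n <= 1 by rewrite /n; lra.
pose x (s : R) := m + n * cos s.
have xb s : l0 <= x s <= 1.
  have := cos_geN1 s; have := cos_le1 s; rewrite /x /m => c1 c2.
  have h1 : n * cos s <= n by rewrite ler_piMr // ltW.
  have h2 : - n <= n * cos s by rewrite -[leLHS]mulrN1 ler_pM2l.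
  by move: h1 h2; rewrite /n; lra.
have xb' s : 0 <= x s <= 1 by have := xb s; lra.
have x_neq0 s : cR (x s) != 0.
  by rewrite -cmod_gt0 cmod_cR normr_gt0 gt_eqF //; have := xb s; lra.
(* The factor [-i] cancels the [i] in the derivative of [expi], so that the circular sides carry
   exactly [H * kern]. *)
pose phi (z : C) := - Complex 0 1 * H z / (z - w).
pose Ps (s y : R) : C := cR (- (n * sin s)) * (cR rho * expi y - w).
pose Py (s y : R) : C := cR (x s) * (cR rho * (Complex 0 1 * expi y)).
have dx (s : R) : is_derive s 1 x (- (n * sin s)).
  by rewrite /x; apply: is_derive_eq; rewrite /GRing.scale /=; ring.
have dPs s y : dC (fun s => Phi (x s) y) s (Ps s y).
  have := dC_add (dC_cst w s) (dC_mul (dC_cR (dx s)) (dC_cst (cR rho * expi y - w) s)).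
  by rewrite mulr0 addr0 add0r.
have dPy s y : dC (fun y => Phi (x s) y) y (Py s y).
  have := dC_add (dC_cst w y) (dC_mul (dC_cst (cR (x s)) y)
     (dC_add (dC_mul (dC_cst (cR rho) y) (dC_expi y)) (dC_cst (- w) y))).
  by rewrite !mul0r !add0r addr0.
have cexpi (y : R) : cvgC (nbhs y) (@expi R) (expi y) by exact: (dC_cvg (dC_expi y)).
have cPs (s y : R) : cvgC (nbhs s) (Ps ^~ y) (Ps s y).
  apply: cvgC_mul; last exact: cvgC_cst.
  apply: cvgC_cR; apply: cvgN; apply: cvgM; [exact: cvg_cst|exact: continuous_sin].
have cPy (s y : R) : cvgC (nbhs y) (Py s) (Py s y).
  apply: cvgC_mul; first exact: cvgC_cst.
  apply: cvgC_mul; first exact: cvgC_cst.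
  by apply: cvgC_mul; [exact: cvgC_cst|exact: cexpi].
have bPs s y : cmod (Ps s y) <= 4.
  rewrite cmodM cmod_cR normrN normrM (gtr0_norm n0).
  have : n * `|sin s| <= 1 by rewrite mulr_ile1 ?sin_max // ltW.
  have := den_le y; have := cmod_ge0 (cR rho * expi y - w) => h1 h2 h3.
  by apply: (@le_trans _ _ (1 * 2)); [rewrite ler_pM // mulr_ge0 // ltW|lra].
have bPy s y : cmod (Py s y) <= 4.
  rewrite !cmodM cmod_expi !cmod_cR mulr1 !ger0_norm ?(ltW rho0) //; last by have := xb' s; lra.
  have -> : cmod (Complex 0 1 : C) = 1 by rewrite /cmod /= expr0n expr1n /= add0r sqrtr1.
  rewrite mulr1; apply: (@le_trans _ _ (1 * 1)); last lra.
  by have := xb' s => /andP[? ?]; rewrite ler_pM // ltW.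
have Lip s y s0 y0 : cmod (Phi (x s) y - Phi (x s0) y0) <= 4 * (`|s - s0| + `|y - y0|).
  have -> : Phi (x s) y - Phi (x s0) y0 = cR (x s - x s0) * (cR rho * expi y - w)
      + cR (x s0) * cR rho * (expi y - expi y0).
    have -> : cR (x s - x s0) = cR (x s) - cR (x s0) :> C by apply: cmplx_eq; rewrite ?ReB ?ImB /= ?subr0.
    by rewrite /Phi; ring.
  apply: (le_trans (cmodD _ _)); rewrite !cmodM !cmod_cR.
  have -> : x s - x s0 = n * (cos s - cos s0) by rewrite /x; ring.
  have h1 : `|n * (cos s - cos s0)| <= `|s - s0|.
    rewrite normrM gtr0_norm //; apply: le_trans (cos_lipschitz s s0).
    by rewrite ler_piMl.
  have /andP[x0 x1] := xb' s0.
  rewrite (ger0_norm x0) (ger0_norm (ltW rho0)).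
  have h2 := expi_lipschitz y y0.
  have h3 : `|n * (cos s - cos s0)| * cmod (cR rho * expi y - w) <= `|s - s0| * 2 by rewrite ler_pM ?cmod_ge0.
  have h4 : x s0 * rho * cmod (expi y - expi y0) <= 1 * (2 * `|y - y0|).
    by rewrite ler_pM ?cmod_ge0 ?mulr_ge0 ?mulr_ile1 ?(ltW rho0) ?(ltW rho1).
  have := normr_ge0 (s - s0); have := normr_ge0 (y - y0); lra.
have dphi s y : exists l, derC phi (Phi (x s) y) l.
  have [l dl] := holH (Phi_disc y (xb' s)).
  have nw : Phi (x s) y - w != 0 by rewrite /Phi addrC addKr mulf_neq0.
  have d1 := derC_mul (derC_cst (- Complex 0 1) (Phi (x s) y)) dl.
  have d2 := derC_sub (derC_id (Phi (x s) y)) (derC_cst w (Phi (x s) y)).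
  have d3 := derC_comp d2 (derC_inv nw).
  by eexists; exact: (derC_mul d1 d3).
have := goursat dPs dPy cPs cPy bPs bPy Lip dphi (pi_gt0 R) (_ : 0 < 2 * pi).
rewrite mulr_gt0 ?pi_gt0 // => /(_ isT).
have Q s : (fun y => Re (phi (Phi (x s) y) * Py s y)) = (fun y => Re (H (Phi (x s) y) * kern y)).
  apply/funext => y; congr Re; rewrite /phi /Py.
  have -> : Phi (x s) y - w = cR (x s) * (cR rho * expi y - w) by rewrite /Phi addrC addKr.
  have i2 : Complex 0 1 * Complex 0 1 = -1 :> C by apply: cmplx_eq; rewrite /= ?mul0r ?mulr0 ?mul1r ?sub0r ?addr0 ?oppr0.
  rewrite /kern invfM; move: (den_neq0 y) (x_neq0 s); set D := (_ - w); set X := cR (x s); set h := H _ => D0 X0.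
  transitivity (- (Complex 0 1 * Complex 0 1) * (X * X^-1) * (h * (cR rho * expi y / D))); first by ring.
  by rewrite i2 mulfV // opprK !mul1r.
rewrite !Q.
(* The sides [y = 0] and [y = 2 pi] are the same segment and cancel; only the two circles remain. *)
have e0 : expi (2 * pi) = expi 0 :> C by rewrite expi_2pi expi0.
have -> : (fun s => Re (phi (Phi (x s) (2 * pi)) * Ps s (2 * pi))) = (fun s => Re (phi (Phi (x s) 0) * Ps s 0)).
  by rewrite /Phi /Ps e0.
have -> : x 0 = 1 by rewrite /x cos0 /m /n; lra.
have -> : x pi = l0 by rewrite /x cospi /m /n; lra.
rewrite -/(J l0) -/(J 1); lra.
Qed.

Let cont_kern (y : R) : cvgC (nbhs y) kern (kern y).
Proof.
have cexpi : cvgC (nbhs y) (@expi R) (expi y) by exact: (dC_cvg (dC_expi y)).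
have cr : cvgC (nbhs y) (fun y => cR rho * expi y) (cR rho * expi y) by apply: cvgC_mul => //; exact: cvgC_cst.
apply: cvgC_mul => //; apply: cvgC_inv => //; apply: cvgC_sub => //; exact: cvgC_cst.
Qed.

(** As the homothety ratio tends to zero, [H] is frozen at its value at [w] while the kernel stays
    bounded. The integral of the kernel itself is evaluated afterwards, in [cauchy_formula]. *)
Lemma circle_shrink : Jint (fun y => Re (H (cR rho * expi y) * kern y)) 0 (2 * pi) =
  Jint (fun y => Re (H w * kern y)) 0 (2 * pi).
Proof.
have J1 : J 1 = Jint (fun y => Re (H (cR rho * expi y) * kern y)) 0 (2 * pi).
  by congr Jint; apply/funext => y; rewrite /Phi mul1r subrKC.
rewrite -J1; apply/eqP; rewrite -subr_eq0 -normr_eq0 eq_le normr_ge0 andbT.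
apply/ler_addgt0Pr => eps e0; rewrite add0r.
have dw : 0 < rho - cmod w by rewrite subr_gt0.
have kb y : cmod (kern y) <= (rho - cmod w)^-1.
  rewrite /kern cmodM cmodV cmodM cmod_expi mulr1 cmod_cR gtr0_norm //.
  rewrite -[leRHS]mul1r ler_pM ?invr_ge0 ?cmod_ge0 ?(ltW rho0) ?(ltW rho1) //.
  by rewrite lef_pV2 ?posrE // cmod_gt0.
pose e := eps * (rho - cmod w) / (2 * pi).
have pi0 := pi_gt0 R.
have e'0 : 0 < e by rewrite divr_gt0 ?mulr_gt0.
have cw : cmod w < 1 by exact: lt_trans rho1.
have [l0 /derC_cont/contCP/(_ _ e'0)[d d0 dH]] := holH cw.
(* Points of the shrunken circle are within [2 l < d] of [w], and [l < 1] makes [J_const]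
   applicable. *)
pose l := Num.min (d / 4) 2^-1.
have l0' : 0 < l by rewrite lt_min divr_gt0 //= invr_gt0.
have l1 : l < 1 by rewrite gt_min; apply/orP; right; lra.
have ld : l * 2 < d.
  have : l <= d / 4 by rewrite ge_min lexx.
  lra.
rewrite -(J_const (l0 := l)) ?l0' //.
have cH z (f : R -> C) (y : R) : cvgC (nbhs y) f z -> cmod z < 1 -> cvgC (nbhs y) (fun y => H (f y)) (H z).
  move=> fz z1; apply: cvgC_comp => //; have [l2 /derC_cont //] := holH z1.
have cPhi (y : R) : cvgC (nbhs y) (Phi l) (Phi l y).
  have cexpi : cvgC (nbhs y) (@expi R) (expi y) by exact: (dC_cvg (dC_expi y)).
  apply: cvgC_add; first exact: cvgC_cst.
  apply: cvgC_mul; first exact: cvgC_cst.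
  by apply: cvgC_sub; [apply: cvgC_mul => //; exact: cvgC_cst|exact: cvgC_cst].
have lb : 0 <= l <= 1 by rewrite !ltW.
have c1 : continuous (fun y => Re (H (Phi l y) * kern y)).
  move=> y.
  suff cc : cvgC (nbhs y) (fun y => H (Phi l y) * kern y) (H (Phi l y) * kern y) by exact: cc.1.
  by apply: cvgC_mul; [apply: cH => //; exact: Phi_disc|exact: cont_kern].
have c2 : continuous (fun y => Re (H w * kern y)).
  move=> y.
  suff cc : cvgC (nbhs y) (fun y => H w * kern y) (H w * kern y) by exact: cc.1.
  by apply: cvgC_mul; [exact: cvgC_cst|exact: cont_kern].
rewrite /J -(JintB _ _ c1 c2).
have -> : eps = e * (rho - cmod w)^-1 * (2 * pi - 0).
  have gen (a k q : R) : k != 0 -> q != 0 -> a = a * k / q * k^-1 * q by move=> ? ?; field; apply/andP.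
  by rewrite /e subr0; apply: gen; rewrite gt_eqF // mulr_gt0.
apply: Jint_le.
- by move=> y; apply: continuousB; [exact: c1|exact: c2].
- by rewrite mulr_ge0 // ltW.
- move=> y _; rewrite -ReB -mulrBl; apply: (le_trans (Re_le_cmod _)); rewrite cmodM.
  rewrite ler_pM ?cmod_ge0 //; apply/ltW/dH; rewrite /Phi addrC addKr cmodM cmod_cR gtr0_norm //.
  apply: le_lt_trans ld; by rewrite ler_pM2l.
Qed.

End Circle.

Lemma mean_value (H : C -> C) (rho : R) : hol H -> 0 < rho < 1 ->
  Jint (fun y => Re (H (cR rho * expi y))) 0 (2 * pi) = 2 * pi * Re (H 0).
Proof.
move=> hH /andP[r0 r1]; have c0 : cmod (0 : C) < rho by rewrite cmod0.
have := circle_shrink hH c0 r1.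
have k y : cR rho * expi y / (cR rho * expi y - 0) = 1 :> C.
  by rewrite subr0 mulfV // -cmod_gt0 cmodM cmod_expi mulr1 cmod_cR normr_gt0 gt_eqF.
under [in X in X = _ -> _]eq_fun do rewrite k mulr1.
under [in X in _ = X -> _]eq_fun do rewrite k mulr1.
move=> ->; rewrite /Jint Rintegral_cst //=; rewrite lebesgue_measure_itv /= lte_fin.
by rewrite mulr_gt0 ?pi_gt0 //= subr0 mulrC.
Qed.

End Cauchy.

(** * Integration over the circle *)

Section TorusIntegral.
Variable R : realType.
Local Notation leb := (@lebesgue_measure R).
Local Notation T := (@Tdom R).
Implicit Types f g : R -> R.

Lemma measurable_Tdom : measurable T. Proof. exact: measurable_itv. Qed.
Local Hint Resolve measurable_Tdom : core.

Lemma lebesgue_Tdom : leb T = (2 * pi)%:E.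
Proof.
rewrite /Tdom lebesgue_measure_itv /= lte_fin mulr_gt0 ?pi_gt0 //.
by rewrite -EFinB subr0.
Qed.

Global Instance ae_leb_filter : Filter (almost_everywhere leb).
Proof. exact: (ae_filter_ringOfSetsType leb). Qed.

Definition aeT (P : R -> Prop) := {ae leb, forall t, T t -> P t}.

Lemma aeT2 (P Q S : R -> Prop) : (forall t, T t -> P t -> Q t -> S t) -> aeT P -> aeT Q -> aeT S.
Proof.
by rewrite /aeT => H; apply: filterS2 => t p q Tt; apply: H => //; [exact: p|exact: q].
Qed.

Lemma aeT1 (P Q : R -> Prop) : (forall t, T t -> P t -> Q t) -> aeT P -> aeT Q.
Proof. by move=> H p; apply: (aeT2 _ p p) => t Tt Pt _; exact: H. Qed.

Lemma aeTW (P : R -> Prop) : (forall t, T t -> P t) -> aeT P.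
Proof. by move=> H; rewrite /aeT; apply: nearW. Qed.

(** Both discarded parameters represent the point 1, the only place where [gz] may vanish or blow
    up. *)
Lemma aeT_interior : aeT (fun t => 0 < t < 2 * pi).
Proof.
exists [set 0; 2 * pi]; split.
- by apply: measurableU; exact: measurable_set1.
- by apply: (@null_set_setU _ _ _ leb); [exact: measurable_set1|exact: measurable_set1|exact: lebesgue_measure_set1|exact: lebesgue_measure_set1].
- move=> t /= /not_implyP[]; rewrite /Tdom /= in_itv /= => /andP[t0 t2] /negP.
  rewrite negb_and -!leNgt => /orP[h|h]; [left|right]; apply/eqP; rewrite eq_le.
    by rewrite h.
  by rewrite t2.
Qed.

Section AeIntegral.
Local Open Scope ereal_scope.
Import HBNNSimple.

(** The integral of an arbitrary nonnegative function is a supremum over simple functions below it;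
    cutting such a function off on the null set keeps its integral and puts it below [g]. *)
Let ge0_ae_le (f g : R -> \bar R) : (forall t, 0 <= f t) -> (forall t, 0 <= g t) ->
  {ae leb, forall t, f t = g t} -> \int[leb]_t f t <= \int[leb]_t g t.
Proof.
move=> f0 g0 [N [mN N0 fg]].
rewrite [leLHS]ge0_integralTE //; apply: ge_ereal_sup => _ [h hf <-].
have mNc : measurable (~` N) by exact: measurableC.
have -> : sintegral leb h = sintegral leb (proj_nnsfun h mNc).
  rewrite -!integralT_nnsfun.
  apply: ge0_ae_eq_integral => //.
  - by apply/measurable_EFinP.
  - by apply/measurable_EFinP.
  - by move=> x _; rewrite lee_fin.
  - by move=> x _; rewrite lee_fin.
  - exists N; split => // x /= /not_implyP[_ hx]; apply: contrapT => Nx; apply: hx.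
    by rewrite /= mindicE mem_set // mulr1.
rewrite ge0_integralTE //; apply: ereal_sup_ubound => /=.
exists (proj_nnsfun h mNc) => //= t.
rewrite mindicE; case: (boolP (t \in ~` N)) => [|_]; last by rewrite mulr0.
rewrite inE mulr1 => Nt; rewrite (le_trans (hf t)) //.
suff -> : f t = g t by [].
by apply: contrapT => /fg.
Qed.

(** Stated for arbitrary functions because [S f] and the members of [InH2] are prescribed only
    almost everywhere and come with no measurability. *)
Lemma ae_integral (f g : R -> \bar R) : aeT (fun t => f t = g t) ->
  \int[leb]_(t in T) f t = \int[leb]_(t in T) g t.
Proof.
move=> [N [mN N0 fg]].
have key (h : \bar R -> \bar R) : (forall x, 0 <= h x) -> h 0 = 0 ->
    \int[leb]_t h ((f \_ T) t) = \int[leb]_t h ((g \_ T) t).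
  move=> h0 hz; have e : {ae leb, forall t, h ((f \_ T) t) = h ((g \_ T) t)}.
    exists N; split => // t /= ht; apply: fg => /= H; apply: ht; congr h.
    by rewrite !patchE; case: ifPn => //; rewrite inE; exact: H.
  by apply/eqP; rewrite eq_le !ge0_ae_le //; apply: filterS e => t ->.
rewrite integral_mkcond [RHS]integral_mkcond integralE [RHS]integralE.
congr (_ - _).
- have k := key (fun x => maxe x 0); under eq_integral do rewrite funeposE; under [RHS]eq_integral do rewrite funeposE; apply: k => [x|]; rewrite ?le_max ?lexx ?orbT ?maxxx //.
- have k := key (fun x => maxe (- x) 0); under eq_integral do rewrite funenegE; under [RHS]eq_integral do rewrite funenegE; apply: k => [x|]; rewrite ?le_max ?lexx ?orbT ?oppe0 ?maxxx //.
Qed.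

Lemma fatouT (f_ : nat -> R -> R) (f : R -> R) (M : \bar R) :
  (forall n, measurable_fun T (f_ n)) -> (forall n t, T t -> (0 <= f_ n t)%R) ->
  aeT (fun t => f_ n t @[n --> \oo] --> f t) ->
  (forall n, \int[leb]_(t in T) (f_ n t)%:E <= M) -> \int[leb]_(t in T) (f t)%:E <= M.
Proof.
move=> mf f0 cf bM.
have -> : \int[leb]_(t in T) (f t)%:E = \int[leb]_(t in T) limn_einf ((fun n t => (f_ n t)%:E) ^~ t).
  apply: ae_integral; apply: aeT1 cf => t _ ft.
  have : (f_ n t)%:E @[n --> \oo] --> (f t)%:E by apply: cvg_EFin => //; exact: nearW.
  by move=> /cvg_limn_einf_sup[].
have h1 n : measurable_fun T (EFin \o f_ n) by exact/measurable_EFinP.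
have h2 n t : T t -> 0 <= (EFin \o f_ n) t by move=> Tt; rewrite lee_fin f0.
apply: (le_trans (fatou leb measurable_Tdom h1 h2)).
rewrite limn_einf_lim; apply: lime_le; first exact: is_cvg_einfs.
apply: nearW => n; apply: le_trans (bM n).
by apply: ereal_inf_lbound; exists n => /=.
Qed.

Lemma ae_le_integral (f g : R -> R) : measurable_fun T f -> measurable_fun T g ->
  (forall t, T t -> 0 <= f t)%R -> aeT (fun t => f t <= g t)%R ->
  \int[leb]_(t in T) (f t)%:E <= \int[leb]_(t in T) (g t)%:E.
Proof.
move=> mf mg f0 fg.
have -> : \int[leb]_(t in T) (g t)%:E = \int[leb]_(t in T) (Num.max (f t) (g t))%:E.
  by apply: ae_integral; apply: aeT1 fg => t _ h; rewrite max_r.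
apply: ge0_le_integral => //.
- exact/measurable_EFinP.
- by apply/measurable_EFinP; exact: measurable_maxr.
- by move=> t Tt; rewrite lee_fin le_max lexx.
Qed.

End AeIntegral.

End TorusIntegral.

Local Notation leb := (@lebesgue_measure _).
Local Notation T := (@Tdom _).
Local Notation mT := (@measurable_Tdom _).
Local Hint Extern 0 (measurable _) => solve [apply: measurable_Tdom] : core.
Local Notation I f := (\int[leb]_(t in T) f t).
Local Notation E f := (\int[leb]_(t in T) (f t)%:E)%E.
Local Notation tint f := (leb.-integrable T (EFin \o f)).

(** * Powers, uniform integrability and convergence of integrals *)

Section PowerLimit.
Variable R : realType.

Lemma cvg_powR_ge0 X (G : set_system X) {FG : ProperFilter G} (f : X -> R) (a s : R) : 0 < s ->
  (forall x, 0 <= f x) -> f x @[x --> G] --> a -> f x `^ s @[x --> G] --> a `^ s.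
Proof.
move=> s0 f0 fa.
have a0 : 0 <= a.
  rewrite leNgt; apply/negP => a0; have na : 0 < - a by rewrite oppr_gt0.
  move/cvgrPdist_lt : fa => /(_ _ na)/filter_ex[x]; rewrite ltr_distl => /andP[+ _].
  by have := f0 x; lra.
move: a0; rewrite le_eqVlt => /orP[/eqP a0|a0].
  rewrite -a0 powR0 ?gt_eqF //; apply/cvgrPdist_lt => eps e0.
  have e1 : 0 < eps `^ s^-1 by rewrite powR_gt0.
  move: fa; rewrite -a0 => /cvgrPdist_lt/(_ _ e1); apply: filterS => x.
  rewrite !sub0r !normrN !ger0_norm ?powR_ge0 // => fx.
  have -> : eps = (eps `^ s^-1) `^ s by rewrite -powRrM mulVf ?gt_eqF // powRr1 // ltW.
  by rewrite gt0_ltr_powR // nnegrE ?f0 // ltW.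
have c1 : expR (s * ln (f x)) @[x --> G] --> expR (s * ln a).
  have c2 : s * ln (f x) @[x --> G] --> s * ln a.
    apply: cvgM; first exact: cvg_cst.
    exact: (cvg_comp _ _ fa (continuous_ln a0)).
  exact: (cvg_comp _ _ c2 (@continuous_expR R _)).
rewrite /powR (gt_eqF a0); apply: cvg_trans c1; apply: near_eq_cvg.
move/cvgrPdist_lt : fa => /(_ _ a0); apply: filterS => x.
rewrite ltr_distl => /andP[_ fx].
by rewrite gt_eqF //; lra.
Qed.

End PowerLimit.

Section UniformIntegrability.
Variable R : realType.
Implicit Types f g : R -> R.

Lemma tint_meas f : tint f -> measurable_fun T f.
Proof. by move=> /measurable_int/measurable_EFinP. Qed.

Lemma tint_cst (c : R) : tint (fun=> c).
Proof. by apply: cont_integrable; exact: cst_continuous. Qed.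

Lemma tint_le f g : measurable_fun T f -> (forall t, T t -> `|f t| <= g t) -> tint g -> tint f.
Proof.
move=> mf fg tg; have mf' : measurable_fun T (EFin \o f) by exact/measurable_EFinP.
refine (@le_integrable _ _ _ leb T mT _ _ mf' _ tg) => t Tt /=.
by rewrite lee_fin (le_trans (fg t Tt)) // ler_norm.
Qed.

Lemma tint_bounded f (m : R) : measurable_fun T f -> (forall t, T t -> `|f t| <= m) -> tint f.
Proof. by move=> mf fm; apply: (tint_le mf fm); exact: tint_cst. Qed.

Lemma tint_cont f : continuous f -> tint f.
Proof. by move=> cf; exact: cont_integrable. Qed.

Lemma measT_cont f : continuous f -> measurable_fun T f.
Proof. by move=> cf; apply: tint_meas; exact: tint_cont. Qed.

Lemma tint_fin f : (forall t, T t -> 0 <= f t) -> measurable_fun T f ->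
  (E f < +oo)%E -> tint f.
Proof.
move=> f0 mf foo; apply/integrableP; split; first exact/measurable_EFinP.
rewrite (le_lt_trans _ foo) // le_eqVlt; apply/orP; left; apply/eqP.
by apply: eq_integral => t /set_mem Tt; rewrite /= ger0_norm // f0.
Qed.

Lemma tintD f g : tint f -> tint g -> tint (fun t => f t + g t).
Proof. by move=> tf tg; exact: (@integrableD _ _ _ leb T mT _ _ tf tg). Qed.
Lemma tintB f g : tint f -> tint g -> tint (fun t => f t - g t).
Proof. by move=> tf tg; exact: (@integrableB _ _ _ leb T mT _ _ tf tg). Qed.
Lemma tintZ (c : R) f : tint f -> tint (fun t => c * f t).
Proof. by move=> tf; exact: (@integrableZl _ _ _ leb T mT c _ tf). Qed.
Lemma tint_norm f : tint f -> tint (fun t => `|f t|).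
Proof. by move=> tf; exact: (@integrable_norm _ _ _ leb T _ tf). Qed.

Lemma EFin_I f : tint f -> (I f)%:E = (E f)%E.
Proof. by move=> tf; rewrite /Rintegral fineK //; exact: (@integrable_fin_num _ _ _ leb T mT _ tf). Qed.

Lemma I_D f g : tint f -> tint g -> I (fun t => f t + g t) = I f + I g.
Proof. by move=> tf tg; exact: (@RintegralD _ _ _ leb T _ _ mT tf tg). Qed.
Lemma I_B f g : tint f -> tint g -> I (fun t => f t - g t) = I f - I g.
Proof. by move=> tf tg; exact: (@RintegralB _ _ _ leb T _ _ mT tf tg). Qed.
Lemma I_Z f : tint f -> forall c : R, I (fun t => c * f t) = c * I f.
Proof. by move=> tf c; exact: (@RintegralZl _ _ _ leb T _ _ mT tf). Qed.
Lemma I_le f g : tint f -> tint g -> (forall t, T t -> f t <= g t) -> I f <= I g.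
Proof. by move=> tf tg; exact: (@le_Rintegral _ _ _ leb T _ _ mT tf tg). Qed.

Lemma E_le f g : measurable_fun T f -> measurable_fun T g -> (forall t, T t -> 0 <= f t) ->
  (forall t, T t -> f t <= g t) -> (E f <= E g)%E.
Proof.
move=> mf mg f0 fg; apply: ge0_le_integral => //.
- exact/measurable_EFinP.
- exact/measurable_EFinP.
Qed.

Lemma E_add f g : measurable_fun T f -> measurable_fun T g -> (forall t, T t -> 0 <= f t) ->
  (forall t, T t -> 0 <= g t) ->
  (\int[leb]_(t in T) (f t + g t)%:E = E f + E g)%E.
Proof.
move=> mf mg f0 g0; under eq_integral do rewrite EFinD.
rewrite ge0_integralD //.
- exact/measurable_EFinP.
- exact/measurable_EFinP.
Qed.

Lemma E_scale (c : R) f : 0 <= c -> measurable_fun T f -> (forall t, T t -> 0 <= f t) ->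
  (\int[leb]_(t in T) (c * f t)%:E = c%:E * E f)%E.
Proof.
move=> c0 mf f0; under eq_integral do rewrite EFinM.
by rewrite ge0_integralZl_EFin //; exact/measurable_EFinP.
Qed.

Lemma I_ae f g : aeT (fun t => f t = g t) -> I f = I g.
Proof. by move=> fg; rewrite /Rintegral (@ae_integral R _ (EFin \o g)) //; apply: aeT1 fg => t _ /= ->. Qed.

Lemma powR_gt1_le (s x : R) : 1 <= s -> 0 <= x -> x <= 1 + x `^ s.
Proof.
move=> s1 x0; have [x1|x1] := leP x 1; first by rewrite (le_trans x1) // lerDl powR_ge0.
by rewrite ler_wpDl // -[leLHS]powRr1 // ler_powR // ltW.
Qed.

(** Where [x > A], one has [x = x^s x^(1 - s)] with a negative exponent [1 - s], so the tail is
    controlled by the [s]-th power. *)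
Lemma trunc_le (s x A : R) : 1 < s -> 0 <= x -> 0 < A -> x <= Num.min x A + A `^ (1 - s) * x `^ s.
Proof.
move=> s1 x0 A0; have [xA|Ax] := leP x A; first by rewrite lerDl mulr_ge0 ?powR_ge0.
apply: ler_wpDl; first exact: ltW.
have xp : 0 < x by exact: lt_trans Ax.
have -> : x `^ s = x * x `^ (s - 1) by rewrite -{2}(powRr1 x0) -powRD ?subrKC //; apply/implyP => _; rewrite gt_eqF.
rewrite mulrCA ler_peMr //.
have -> : 1 - s = - (s - 1) by rewrite opprB.
rewrite powRN -ler_pdivrMl ?invr_gt0 ?powR_gt0 // invrK mulr1.
by rewrite ge0_ler_powR ?nnegrE ?subr_ge0 // ltW.
Qed.

(** Cut at height [A]: dominated convergence handles the truncations, and the [L^s] bound makes the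
    tails small uniformly in [n]. *)
Lemma vitali_zero (s M : R) (f_ : nat -> R -> R) : 1 < s ->
  (forall n, measurable_fun T (f_ n)) -> (forall n t, T t -> 0 <= f_ n t) ->
  aeT (fun t => f_ n t @[n --> \oo] --> (0 : R)) ->
  (forall n, \int[leb]_(t in T) (f_ n t `^ s)%:E <= M%:E)%E ->
  forall eps : R, 0 < eps -> \forall n \near \oo, (\int[leb]_(t in T) (f_ n t)%:E <= eps%:E)%E.
Proof.
move=> s1 mf f0 cf bM eps e0.
have M0 : 0 <= M.
  by rewrite -lee_fin (le_trans _ (bM 0%N)) // integral_ge0 // => t _; rewrite lee_fin powR_ge0.
have [A A0 hA] : exists2 A : R, 0 < A & A `^ (1 - s) * M <= eps / 2.
  (* With [A = K^(1 / (s - 1))] the factor [A^(1 - s)] is [1 / K], hence at most [eps / 2] after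
     multiplication by [M]. *)
  pose K := 2 * M / eps + 1.
  have K0 : 0 < K by rewrite ltr_wpDl // divr_ge0 ?mulr_ge0 // ltW.
  exists (K `^ (s - 1)^-1); first by rewrite powR_gt0.
  have -> : 1 - s = - (s - 1) by rewrite opprB.
  rewrite powRN -powRrM mulVf ?subr_eq0 ?gt_eqF // (powRr1 (ltW K0)).
  rewrite ler_pdivrMl // /K; have -> : (2 * M / eps + 1) * (eps / 2) = M + eps / 2 by field; rewrite gt_eqF.
  by rewrite lerDl divr_ge0 // ltW.
pose g n t := Num.min (f_ n t) A.
have mg n : measurable_fun T (g n) by apply: measurable_minr.
have g0 n t : T t -> 0 <= g n t by move=> Tt; rewrite le_min f0 // ltW.
have C1 : aeT (fun t => (g n t)%:E @[n --> \oo] --> (0%R : R)%:E).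
  apply: aeT1 cf => t Tt ft; apply: cvg_EFin; first exact: nearW.
  apply: (@squeeze_cvgr _ _ _ _ (fun=> 0) (fun n => f_ n t)) => //; last exact: cvg_cst.
  by apply: nearW => n /=; rewrite g0 //= ge_min lexx.
have [_ _ cvI] : [/\ leb.-integrable T (EFin \o (fun=> 0%R : R)),
    [sequence \int[leb]_(x in T) (`|(g n x)%:E - 0%:E|)]_n @ \oo --> 0%E &
    [sequence \int[leb]_(x in T) (g n x)%:E]_n @ \oo --> (\int[leb]_(x in T) (0%R : R)%:E)]%E.
  apply: (@dominated_convergence _ _ _ leb T _ (fun n => EFin \o g n) (EFin \o (fun=> 0)) (EFin \o (fun=> A))) => //.
  - by move=> n; apply/measurable_EFinP; exact: mg.
  - by apply/measurable_EFinP; exact: measurable_cst.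
  - exact: tint_cst.
  - apply: nearW => t n Tt; rewrite /= lee_fin ger0_norm ?g0 //.
    by rewrite ge_min lexx orbT.
rewrite integral0 in cvI.
have e2 : 0 < eps / 2 by rewrite divr_gt0.
have /fine_cvgP[gfin /cvgrPdist_le/(_ _ e2)] := cvI.
apply: filterS2 gfin => n gfin; rewrite sub0r normrN /= => gn.
have -> : eps%:E = ((eps / 2)%:E + (eps / 2)%:E)%E by rewrite -EFinD; congr EFin; field.
have mfs : measurable_fun T (fun t => f_ n t `^ s).
  by apply: (measurableT_comp (measurable_powR _)).
apply: (@le_trans _ _ (\int[leb]_(t in T) ((g n t)%:E + (A `^ (1 - s) * f_ n t `^ s)%:E))%E).
  apply: ge0_le_integral => //.
  - by move=> t Tt; rewrite lee_fin f0.
  - by apply/measurable_EFinP; first [exact: mf|exact: mg|exact: mfs].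
  - by apply: emeasurable_funD; apply/measurable_EFinP; [exact: mg|apply: measurable_funM].
  - by move=> t Tt; rewrite -EFinD lee_fin trunc_le // f0.
rewrite ge0_integralD //; last 4 first.
- by move=> t Tt; rewrite lee_fin g0.
- by apply/measurable_EFinP; first [exact: mf|exact: mg|exact: mfs].
- by move=> t Tt; rewrite lee_fin mulr_ge0 // powR_ge0.
- by apply/measurable_EFinP; apply: measurable_funM.
apply: leeD.
  have gfin' : (\int[leb]_(x in T) (g n x)%:E)%E \is a fin_num by exact: gfin.
  by rewrite -(fineK gfin') lee_fin; apply: le_trans gn; exact: ler_norm.
under eq_integral do rewrite EFinM.
rewrite ge0_integralZl_EFin //; last 3 first.
- by move=> t Tt; rewrite lee_fin powR_ge0.
- by apply/measurable_EFinP; first [exact: mf|exact: mg|exact: mfs].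
- exact: powR_ge0.
apply: (@le_trans _ _ ((A `^ (1 - s))%:E * M%:E)%E); last by rewrite -EFinM lee_fin.
by apply: lee_wpmul2l => //; rewrite lee_fin powR_ge0.
Qed.

Lemma powRD_le (s x y : R) : 0 <= s -> 0 <= x -> 0 <= y -> (x + y) `^ s <= 2 `^ s * (x `^ s + y `^ s).
Proof.
move=> s0 x0 y0.
wlog xy : x y x0 y0 / x <= y.
  move=> H; have [|/ltW] := leP x y; first exact: H.
  by move=> yx; rewrite addrC [x `^ s + _]addrC; exact: H.
apply: (@le_trans _ _ ((2 * y) `^ s)).
  by rewrite ge0_ler_powR ?nnegrE ?addr_ge0 ?mulr_ge0 //; lra.
by rewrite powRM // ler_wpM2l ?powR_ge0 // lerDr powR_ge0.
Qed.

Lemma tint_powR (s : R) f : 1 <= s -> measurable_fun T f ->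
  (\int[leb]_(t in T) (`|f t| `^ s)%:E < +oo)%E -> tint f.
Proof.
move=> s1 mf foo.
have ms : measurable_fun T (fun t => `|f t| `^ s).
  by apply: (measurableT_comp (measurable_powR _)); exact: measurableT_comp.
apply: (@tint_le _ (fun t => 1 + `|f t| `^ s)) => //.
  by move=> t _; exact: powR_gt1_le.
apply: tintD; first exact: tint_cst.
by apply: tint_fin => // t _; exact: powR_ge0.
Qed.

(** Takes circle means to the boundary: the functions on circles are bounded in some [L^s], [s > 1],
    but have no common integrable majorant at hand. The limit is in [L^s] by Fatou. *)
Lemma vitali (s M : R) (f_ : nat -> R -> R) f : 1 < s ->
  (forall n, measurable_fun T (f_ n)) -> measurable_fun T f ->
  aeT (fun t => f_ n t @[n --> \oo] --> f t) ->
  (forall n, \int[leb]_(t in T) (`|f_ n t| `^ s)%:E <= M%:E)%E ->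
  tint f /\ I (f_ n) @[n --> \oo] --> I f.
Proof.
move=> s1 mf_ mf cf bM.
have s0 : 0 <= s by rewrite (le_trans _ (ltW s1)).
have mps (h : R -> R) : measurable_fun T h -> measurable_fun T (fun t => `|h t| `^ s).
  move=> mh; apply: (measurableT_comp (measurable_powR _)); exact: measurableT_comp.
have sgt0 : 0 < s by rewrite (lt_trans _ s1).
have C1 : aeT (fun t => `|f_ n t| `^ s @[n --> \oo] --> `|f t| `^ s).
  apply: aeT1 cf => t _ ft; apply: cvg_powR_ge0 => //; exact: cvg_norm.
have bf : (\int[leb]_(t in T) (`|f t| `^ s)%:E <= M%:E)%E.
  apply: (@fatouT _ (fun n t => `|f_ n t| `^ s)) => //.
  by move=> n; exact: mps.
have tf : tint f by apply: (tint_powR (ltW s1)) => //; rewrite (le_lt_trans bf) // ltry.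
have tf_ n : tint (f_ n) by apply: (tint_powR (ltW s1)) => //; rewrite (le_lt_trans (bM n)) // ltry.
split => //; apply/cvgrPdist_le => eps e0.
have := @vitali_zero s (2 `^ s * (M + M)) (fun n t => `|f_ n t - f t|) s1.
have H1 n : measurable_fun T (fun t => `|f_ n t - f t|) by apply: measurableT_comp => //; exact: measurable_funB.
have H2 : aeT (fun t => `|f_ n t - f t| @[n --> \oo] --> (0 : R)).
  apply: aeT1 cf => t _ ft; rewrite -(@normr0 _ R); apply: cvg_norm.
  by rewrite -(subrr (f t)); apply: cvgB => //; exact: cvg_cst.
have H3 n : (\int[leb]_(t in T) (`|f_ n t - f t| `^ s)%:E <= (2 `^ s * (M + M))%:E)%E.
  apply: (@le_trans _ _ (\int[leb]_(t in T) (2 `^ s * (`|f_ n t| `^ s + `|f t| `^ s))%:E)%E).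
    apply: E_le => [|||t _].
    - by apply: mps; exact: measurable_funB.
    - by apply: measurable_funM => //; apply: measurable_funD; [exact: (mps _ (mf_ n))|exact: (mps _ mf)].
    - by move=> t _; exact: powR_ge0.
    - apply: le_trans (powRD_le s0 (normr_ge0 _) (normr_ge0 _)).
      by rewrite ge0_ler_powR ?nnegrE ?addr_ge0 // ler_normB.
  have msum : measurable_fun T (fun t => `|f_ n t| `^ s + `|f t| `^ s) by apply: measurable_funD; [exact: (mps _ (mf_ n))|exact: (mps _ mf)].
  rewrite E_scale ?powR_ge0 //.
  rewrite EFinM; apply: lee_wpmul2l; first by rewrite lee_fin powR_ge0.
  rewrite E_add ?EFinD; [exact: (leeD (bM n) bf)|exact: (mps _ (mf_ n))|exact: (mps _ mf)|by move=> t _; exact: powR_ge0|by move=> t _; exact: powR_ge0].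
move=> /(_ H1 (fun n t _ => normr_ge0 _) H2 H3 _ e0); apply: filterS => n hn.
rewrite -(@RintegralB _ _ _ leb T f (f_ n) mT tf (tf_ n)) -lee_fin; apply: le_trans hn.
have tB : tint (fun t => f t - f_ n t) by exact: tintB.
have tB' : tint (fun t => `|f_ n t - f t|) by apply/tint_norm/tintB.
rewrite -EFin_I // lee_fin; apply: (le_trans (@le_normr_Rintegral _ _ _ leb T _ mT tB)).
by under eq_Rintegral do rewrite distrC.
Qed.

End UniformIntegrability.

(** * Boundary values and the weighted Hardy space *)

Section HolAlgebra.
Variable R : realType.
Local Notation C := (R[i]).
Implicit Types (F G : C -> C) (z : C).

Lemma hol_mul F G : hol F -> hol G -> hol (fun z => F z * G z).
Proof. by move=> hF hG z z1; have [l dl] := hF z z1; have [m dm] := hG z z1; eexists; exact: (derC_mul dl dm). Qed.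
Lemma hol_add F G : hol F -> hol G -> hol (fun z => F z + G z).
Proof. by move=> hF hG z z1; have [l dl] := hF z z1; have [m dm] := hG z z1; eexists; exact: (derC_add dl dm). Qed.
Lemma hol_cst (a : C) : hol (fun=> a).
Proof. by move=> z z1; exists 0; exact: derC_cst. Qed.
Lemma hol_id : hol (@id C).
Proof. by move=> z z1; exists 1; exact: derC_id. Qed.
Lemma hol_scale (a : C) F : hol F -> hol (fun z => a * F z).
Proof. by move=> hF; apply: (hol_mul (hol_cst a)). Qed.
Lemma hol_comp F G : hol F -> (forall z, cmod z < 1 -> exists l, derC G (F z) l) -> hol (fun z => G (F z)).
Proof. by move=> hF hG z z1; have [l dl] := hF z z1; have [m dm] := hG z z1; eexists; exact: (derC_comp dl dm). Qed.

Lemma hol_cont F z : hol F -> cmod z < 1 -> contC F z.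
Proof. by move=> hF /hF[l /derC_cont]. Qed.

Lemma holomorphic_on_discP F : holomorphic_on_disc F <-> hol F.
Proof.
split=> hF z z1; have [l H] := hF z z1; exists l; first exact/derC_quotient.
by move/derC_quotient: H.
Qed.

Lemma contC_add F G z : contC F z -> contC G z -> contC (fun w => F w + G w) z.
Proof. by move=> *; exact: cvgC_add. Qed.
Lemma contC_mul F G z : contC F z -> contC G z -> contC (fun w => F w * G w) z.
Proof. by move=> *; exact: cvgC_mul. Qed.
Lemma contC_opp F z : contC F z -> contC (fun w => - F w) z.
Proof. by move=> *; exact: cvgC_opp. Qed.
Lemma contC_cst (a : C) z : contC (fun=> a) z.
Proof. exact: cvgC_cst. Qed.
Lemma contC_id z : contC (@id C) z.
Proof. exact: cvgC_id. Qed.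
Lemma contC_inv F z : F z != 0 -> contC F z -> contC (fun w => (F w)^-1) z.
Proof. by move=> *; exact: cvgC_inv. Qed.

Lemma cvg_expi (t : R) : cvgC (nbhs t) (@expi R) (expi t).
Proof. exact: (dC_cvg (dC_expi t)). Qed.

(** Radii tending to 1; the halving keeps the first one, [1 / 2], away from 0. *)
Definition rn (n : nat) : R := 1 - harmonic n / 2.

Lemma rn_ge n : 2^-1 <= rn n.
Proof.
have : harmonic n <= 1 :> R by rewrite /harmonic /= invf_le1 // ler1n.
rewrite /rn; lra.
Qed.
Lemma rn_gt0 n : 0 < rn n. Proof. by apply: lt_le_trans (rn_ge n); rewrite invr_gt0. Qed.
Lemma rn_lt1 n : rn n < 1. Proof. by rewrite /rn ltrBlDr ltrDl divr_gt0 // harmonic_gt0. Qed.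
Lemma rn_cvg : rn n @[n --> \oo] --> (1 : R).
Proof.
rewrite /rn -[X in _ --> X](subr0 1); apply: cvgB; first exact: cvg_cst.
by rewrite -(mul0r 2^-1); apply: cvgM; [exact: cvg_harmonic|exact: cvg_cst].
Qed.

Lemma cmod_circle (r t : R) : 0 <= r -> cmod (cR r * expi t) = r.
Proof. by move=> r0; rewrite cmodM cmod_expi mulr1 cmod_cR ger0_norm. Qed.

Lemma rn_disc n t : cmod (cR (rn n) * expi t) < 1.
Proof. by rewrite cmod_circle ?rn_lt1 // ltW // rn_gt0. Qed.

Lemma cvg_radius t : cvgC \oo (fun n => cR (rn n) * expi t) (expi t).
Proof.
rewrite -[X in cvgC _ _ X]mul1r; apply: cvgC_mul; last exact: cvgC_cst.
exact: (cvgC_cR rn_cvg).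
Qed.

Lemma radial_limit_seq F t (w : C) : radial_limit F t w -> cvgC \oo (fun n => F (cR (rn n) * expi t)) w.
Proof.
move=> rl; apply/cvgC_cmod0/cvgrPdist_lt => eps e0; have [d d0 dH] := rl _ e0.
move/cvgrPdist_lt : rn_cvg => /(_ _ d0); apply: filterS => n.
rewrite ltr_distl => /andP[h1 h2]; rewrite sub0r normrN ger0_norm ?cmod_ge0 //.
by apply: dH; [lra|exact: rn_lt1].
Qed.

Lemma contC_radial F t : contC F (expi t) -> radial_limit F t (F (expi t)).
Proof.
move=> /contCP cF eps e0; have [d d0 dH] := cF _ e0; exists d => // r r1 r2.
apply: dH; have -> : cR r * expi t - expi t = - (cR (1 - r) * expi t).
  have -> : cR (1 - r) = 1 - cR r :> C by apply: cmplx_eq; rewrite ?ReB ?ImB /= ?subr0.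
  by ring.
by rewrite cmodN cmod_circle; lra.
Qed.

Lemma cont_circle F (r : R) : hol F -> 0 <= r < 1 -> forall t, cvgC (nbhs t) (fun t => F (cR r * expi t)) (F (cR r * expi t)).
Proof.
move=> hF /andP[r0 r1] t; apply: cvgC_comp; last by apply: hol_cont => //; rewrite cmod_circle.
by apply: cvgC_mul; [exact: cvgC_cst|exact: cvg_expi].
Qed.

Lemma cos_lt1_interior (t : R) : 0 < t < 2 * pi -> cos t < 1.
Proof.
move=> /andP[t0 t2]; have -> : t = (t / 2) *+ 2 by rewrite -mulr_natr divfK.
have := @sin_gt0_pi R (t / 2); rewrite divr_gt0 //= ltr_pdivrMr // mulrC t2 => /(_ isT) s0.
have : 0 < sin (t / 2) ^+ 2 by rewrite exprn_gt0.
by rewrite cos_mulr2n cos2sin2 mulr2n; lra.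
Qed.

Lemma Re_onem_expi_gt0 (t : R) : 0 < t < 2 * pi -> 0 < Re (1 - expi t : C).
Proof. by move=> /cos_lt1_interior h; rewrite ReB /= subr_gt0. Qed.

Lemma Re_onem_gt0 (z : C) : cmod z < 1 -> 0 < Re (1 - z).
Proof. by move=> z1; rewrite ReB subr_gt0 /= (le_lt_trans _ z1) // (le_trans (ler_norm _)) // Re_le_cmod. Qed.

Lemma measT_interior (f : R -> R) : (forall t, 0 < t < 2 * pi -> {for t, continuous f}) -> measurable_fun T f.
Proof.
move=> cf; apply: (@measurable_fun_itv_cc _ _ _ false true).
apply: open_continuous_measurable_fun; first exact: interval_open.
by move=> t; rewrite inE /= in_itv /=; exact: cf.
Qed.

Lemma cmeas_interior F : (forall t, 0 < t < 2 * pi -> contC F (expi t)) -> cmeasurable (fun t => F (expi t)).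
Proof.
move=> cF; have H t : 0 < t < 2 * pi -> cvgC (nbhs t) (fun t => F (expi t)) (F (expi t)).
  by move=> /cF cFt; apply: cvgC_comp => //; exact: cvg_expi.
by split; apply: measT_interior => t /H[].
Qed.

Lemma cmeas_add (f g : R -> C) : cmeasurable f -> cmeasurable g -> cmeasurable (fun t => f t + g t).
Proof.
move=> [f1 f2] [g1 g2]; split.
  by under eq_fun do rewrite ReD; exact: measurable_funD.
by under eq_fun do rewrite ImD; exact: measurable_funD.
Qed.

Lemma cmeas_opp (f : R -> C) : cmeasurable f -> cmeasurable (fun t => - f t).
Proof.
move=> [f1 f2]; split.
  by under eq_fun do rewrite ReN; exact: measurableT_comp.
by under eq_fun do rewrite ImN; exact: measurableT_comp.
Qed.

Lemma cmeas_mul (f g : R -> C) : cmeasurable f -> cmeasurable g -> cmeasurable (fun t => f t * g t).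
Proof.
move=> [f1 f2] [g1 g2]; split.
  by under eq_fun do rewrite ReM; apply: measurable_funB; exact: measurable_funM.
by under eq_fun do rewrite ImM; apply: measurable_funD; exact: measurable_funM.
Qed.

Lemma cmeas_conj (f : R -> C) : cmeasurable f -> cmeasurable (fun t => conjc (f t)).
Proof.
move=> [f1 f2]; split.
  by under eq_fun do rewrite Re_conj.
by under eq_fun do rewrite Im_conj; exact: measurableT_comp.
Qed.

Lemma cmeas_cR (f : R -> R) : measurable_fun T f -> cmeasurable (fun t => cR (f t)).
Proof. by move=> mf; split => //=; exact: measurable_cst. Qed.

Lemma meas_cmod (f : R -> C) : cmeasurable f -> measurable_fun T (fun t => cmod (f t)).
Proof.
move=> [f1 f2]; rewrite /cmod; apply: (measurableT_comp (measurable_realfun.continuous_measurable_fun (@sqrt_continuous R))).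
by apply: measurable_funD; apply: measurable_funX.
Qed.

Lemma meas_powR (f : R -> R) (s : R) : measurable_fun T f -> measurable_fun T (fun t => f t `^ s).
Proof. by move=> mf; apply: (measurableT_comp (measurable_powR _)). Qed.

Lemma cmeas_expi : cmeasurable (@expi R).
Proof. by split; apply: measT_cont; [exact: continuous_cos|exact: continuous_sin]. Qed.

End HolAlgebra.

(** * The weight and its holomorphic square root *)

Section Weight.
Variable R : realType.
Local Notation C := (R[i]).

(* [(z - 1)^a] up to a unimodular constant: [1 - z] stays in the right half-plane. *)
Definition gz (a : R) (z : C) : C := cpow (1 - z) a.
Definition gT (a t : R) : C := gz a (expi t).

Lemma radial_limitP (F : C -> C) t (w : C) :
  radial_limit F t w <-> cvgC (at_left (1 : R)) (fun r => F (cR r * expi t)) w.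
Proof.
split=> [rl|/cvgC_cmod0/cvgrPdist_lt rl e e0].
  apply/cvgC_cmod0/cvgrPdist_lt => e e0; have [d d0 dH] := rl _ e0.
  near=> r; rewrite sub0r normrN ger0_norm ?cmod_ge0 //; apply: dH.
    by near: r; apply: nbhs_left_gt; rewrite ltrBlDr ltrDl.
  by near: r; exact: nbhs_left_lt.
have /nbhs_ballP[d /= d0 dH] := rl _ e0; exists d => // r r1 r2.
have := dH r; rewrite /ball /= => H'; have : `|1 - r| < d by rewrite gtr0_norm ?subr_gt0 //; lra.
by move=> /H' /(_ r2); rewrite sub0r normrN ger0_norm ?cmod_ge0.
Unshelve. all: by end_near.
Qed.

Lemma radial_limit_mul (F G : C -> C) t (a b : C) : radial_limit F t a -> radial_limit G t b ->
  radial_limit (fun z => F z * G z) t (a * b).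
Proof. by move=> /radial_limitP f1 /radial_limitP f2; apply/radial_limitP; exact: cvgC_mul. Qed.

Lemma gz_derC a (z : C) : 0 < Re (1 - z) -> exists l, derC (gz a) z l.
Proof.
move=> z0; have d := derC_sub (derC_cst 1 z) (derC_id z).
by eexists; exact: (derC_comp d (derC_cpow a z0)).
Qed.

Lemma gz_hol a : hol (gz a).
Proof. by move=> z z1; apply: gz_derC; exact: Re_onem_gt0. Qed.

Lemma gz_cont a t : 0 < t < 2 * pi -> contC (gz a) (expi t).
Proof. by move=> /Re_onem_expi_gt0 /(gz_derC a)[l /derC_cont]. Qed.

Lemma gzN a z : gz a z * gz (- a) z = 1. Proof. exact: cpowN. Qed.
Lemma gTN a t : gT a t * gT (- a) t = 1. Proof. exact: cpowN. Qed.
Lemma gT_neq0 a t : gT a t != 0. Proof. exact: cpow_neq0. Qed.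

Lemma gz0 a : gz a 0 = 1. Proof. by rewrite /gz subr0 cpow1. Qed.

Lemma powR_sqr_half (x a : R) : 0 <= x -> x `^ (2 * a) = (x `^ a) ^+ 2.
Proof. by move=> x0; rewrite mulrC powRrM powR_mulrn // powR_ge0. Qed.

Lemma absg2E a (z : C) : 0 < Re (1 - z) -> absg2 a z = cmod (gz a z) ^+ 2.
Proof. by move=> z0; rewrite /absg2 /gz cmod_cpow // cmodBC powR_sqr_half // cmod_ge0. Qed.

Lemma muE a t : 0 < t < 2 * pi -> mu a t = cmod (gT a t) ^+ 2.
Proof. by move=> /Re_onem_expi_gt0 h; rewrite /mu /gT /gz cmod_cpow // cmodBC powR_sqr_half // cmod_ge0. Qed.

Lemma cmod_gT a t : 0 < t < 2 * pi -> cmod (gT a t) = cmod (1 - expi t) `^ a.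
Proof. by move=> /Re_onem_expi_gt0 h; rewrite /gT /gz cmod_cpow. Qed.

Lemma mu_ge0 (a t : R) : 0 <= mu a t. Proof. exact: powR_ge0. Qed.

Lemma cmod_onem_le2 (z : C) : cmod z <= 1 -> cmod (1 - z) <= 2.
Proof. by move=> z1; apply: (le_trans (cmodB_le _ _)); rewrite cmod1; lra. Qed.

Lemma mu_le (a t : R) : 0 <= a -> mu a t <= 2 `^ (2 * a).
Proof.
move=> a0; rewrite /mu cmodBC ge0_ler_powR ?nnegrE ?cmod_ge0 ?mulr_ge0 //.
by rewrite cmod_onem_le2 // cmod_expi.
Qed.

Lemma meas_mu (a : R) : measurable_fun T (mu a).
Proof.
apply: meas_powR; apply: meas_cmod; apply: cmeas_add; first exact: cmeas_expi.
by split => /=; exact: measurable_cst.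
Qed.

Lemma cmeas_gT (a : R) : cmeasurable (gT a).
Proof. by apply: cmeas_interior => t /gz_cont. Qed.

End Weight.

Section HardyElements.
Variable R : realType.
Local Notation C := (R[i]).
Variable alpha : R.

(* [k] is a Borel representative of an element of the Hardy space and [H] is the holomorphic function [g_alpha F], whose boundary values are [g_alpha k]. *)
Definition H2rep (k : R -> C) (H : C -> C) :=
  [/\ hol H, InLp alpha 2 k,
      aeT (fun t => cvgC \oo (fun n => H (cR (rn R n) * expi t)) (gT alpha t * k t)) &
      exists2 M : R, 0 <= M & forall n, (E (fun t => cmod (H (cR (rn R n) * expi t)) ^+ 2) <= M%:E)%E].

Lemma meas_circle (H : C -> C) n : hol H -> cmeasurable (fun t => H (cR (rn R n) * expi t)).
Proof.
move=> hH; have c := cont_circle (r := rn R n) hH.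
by split; apply: measT_cont => t; [have [] := c _ t|have [] := c _ t]; rewrite ?ltW ?rn_gt0 ?rn_lt1.
Qed.

(** Off a Borel null set [N] the radial limit exists. Setting [k] to zero on [N] makes it the
    everywhere limit on [T] of continuous functions times an indicator, hence measurable; its norm
    is finite by Fatou applied to [g_alpha F]. *)
Lemma InH2_rep h : InH2 alpha h ->
  exists k H, [/\ H2rep k H, aeT (fun t => h t = k t) & InH2 alpha k].
Proof.
move=> [F [hF [M bM] rl]]; move/holomorphic_on_discP : (hF) => holF.
have [N [mN N0 sub]] : aeT (fun t => 0 < t < 2 * pi /\ radial_limit F t (h t)).
  by apply: (aeT2 _ (aeT_interior R) rl) => t.
pose k t := if t \in ~` N then h t else 0.
have mNc : measurable (~` N) by exact: measurableC.
have hk : aeT (fun t => h t = k t).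
  exists N; split => // t /= /not_implyP[Tt hk]; apply: contrapT => Nt; apply: hk.
  by rewrite /k mem_set.
have kprop t : T t -> (t \in ~` N) -> 0 < t < 2 * pi /\ radial_limit F t (h t).
  move=> Tt; rewrite inE => Nt; apply: contrapT => H; apply: Nt; apply: sub => /=.
  by apply/not_implyP.
have InHk : InH2 alpha k.
  exists F; split => //; first by exists M.
  by apply: (aeT2 _ hk rl) => t _ ->.
have mk : cmeasurable k.
  have lim t : T t -> cvgC \oo (fun n => cR (\1_(~` N) t) * F (cR (rn R n) * expi t)) (k t).
    move=> Tt; rewrite /k indicE; case: ifPn => [tN|_].
      have -> : cR (true%:R) = 1 :> C by [].
      under eq_fun do rewrite mul1r.
      by have [_ /radial_limit_seq] := kprop t Tt tN.
    have -> : cR (false%:R) = 0 :> C by [].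
    under eq_fun do rewrite mul0r.
    exact: cvgC_cst.
  have mn n : cmeasurable (fun t => cR (\1_(~` N) t) * F (cR (rn R n) * expi t)).
    by apply: cmeas_mul; [apply: cmeas_cR; exact: measurable_indic|exact: meas_circle].
  split; [apply: (measurable_fun_cvg (fun n => (mn n).1))|apply: (measurable_fun_cvg (fun n => (mn n).2))] => t /lim[] //.
pose H z := gz alpha z * F z.
have holH : hol H by apply: hol_mul => //; exact: gz_hol.
have limH : aeT (fun t => cvgC \oo (fun n => H (cR (rn R n) * expi t)) (gT alpha t * k t)).
  apply: (aeT2 _ hk _) => [t Tt <-|]; last first.
    by exists N; split => //; exact: sub.
  move=> [ti /radial_limit_seq rt]; apply: cvgC_mul => //.
  by apply: (cvgC_comp (F := gz alpha)); [exact: cvg_radius|exact: gz_cont].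
have bH n : (E (fun t => cmod (H (cR (rn R n) * expi t)) ^+ 2) <= M%:E)%E.
  have := bM _ (ltW (rn_gt0 R n)) (rn_lt1 R n); apply: le_trans.
  rewrite le_eqVlt; apply/orP; left; apply/eqP; apply: eq_integral => t _.
  rewrite /H cmodM exprMn absg2E; last by apply: Re_onem_gt0; exact: rn_disc.
  by rewrite mulrC.
have M0 : 0 <= M by rewrite -lee_fin (le_trans _ (bH 0%N)) // integral_ge0 // => t _; rewrite lee_fin sqr_ge0.
exists k, H; split => //; split => //; last by exists M.
split => //; apply: (@le_lt_trans _ _ M%:E); last exact: ltry.
rewrite /wint; apply: (@fatouT _ (fun n t => cmod (H (cR (rn R n) * expi t)) ^+ 2)) => //.
- by move=> n; apply: measurable_funX; apply: meas_cmod; exact: meas_circle.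
- by move=> n t _; exact: sqr_ge0.
- apply: (aeT2 _ limH (aeT_interior R)) => t Tt lim ti.
  have -> : cmod (k t) `^ 2 * mu alpha t = cmod (gT alpha t * k t) ^+ 2.
    by rewrite muE // cmodM exprMn powR_mulrn ?cmod_ge0 // mulrC.
  rewrite expr2; under eq_fun do rewrite expr2.
  by apply: cvgM; apply: cvgC_cmod.
Qed.

(** The weight cancels the denominator: [|q / g|^2 |g|^2 = |q|^2], which is bounded. *)
Lemma H2rep_mk (q : C -> C) (qT : R -> C) (B : R) : hol q -> (forall z, cmod z < 1 -> cmod (q z) <= B) ->
  aeT (fun t => radial_limit q t (qT t)) -> InH2 alpha (fun t => qT t * gT (- alpha) t).
Proof.
move=> hq bq rq; exists (fun z => q z * gz (- alpha) z); split.
- by apply/holomorphic_on_discP; apply: hol_mul => //; exact: gz_hol.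
- exists (B ^+ 2 * (2 * pi)) => r r0 r1.
  have B0 : 0 <= B by apply: le_trans (bq 0 _); rewrite ?cmod_ge0 // cmod0.
  have zd t : cmod (cR r * expi t) < 1 by rewrite cmod_circle.
  apply: (@le_trans _ _ (E (fun=> B ^+ 2))).
    rewrite (_ : (\int[leb]_(t in T) _)%E = E (fun t => cmod (q (cR r * expi t)) ^+ 2)).
      apply: E_le => [|||t _]; [|exact: measurable_cst|by move=> t _; exact: sqr_ge0|by rewrite ler_pXn2r ?nnegrE ?cmod_ge0 // bq].
      apply: measurable_funX; apply: meas_cmod.
      by split; apply: measT_cont => t; [have [] := cont_circle hq (r := r) _ t|have [] := cont_circle hq (r := r) _ t]; rewrite ?r0.
    apply: eq_integral => t _; congr EFin; rewrite absg2E; last exact: Re_onem_gt0.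
    rewrite -exprMn -cmodM -mulrA [gz (- alpha) _ * _]mulrC gzN mulr1 //.
  by rewrite integral_cst //= lebesgue_Tdom -EFinM.
- apply: (aeT2 _ (aeT_interior R) rq) => t Tt ti rt eps e0.
  have cg := contC_radial (gz_cont (- alpha) ti).
  exact: (radial_limit_mul rt cg).
Qed.

End HardyElements.

(** * Cauchy's formula and the Szego kernel *)

Section CauchyFormula.
Variable R : realType.
Local Notation C := (R[i]).
Implicit Types (H : C -> C) (w c : C).

Lemma onem_neq0 w : cmod w < 1 -> 1 - w != 0.
Proof. by move=> w1; rewrite -cmod_gt0; apply: Re_gt0_cmod; exact: Re_onem_gt0. Qed.

Lemma conjcM (z w : C) : conjc (z * w) = conjc z * conjc w.
Proof. by apply: cmplx_eq; rewrite !ReImE; ring. Qed.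
Lemma conjcB (z w : C) : conjc (z - w) = conjc z - conjc w.
Proof. by apply: cmplx_eq; rewrite !ReImE; ring. Qed.
Lemma conjcV (z : C) : conjc z^-1 = (conjc z)^-1.
Proof.
apply: cmplx_eq; first by rewrite Re_conj !ReV Re_conj Im_conj sqrrN.
by rewrite Im_conj !ImV Re_conj Im_conj sqrrN !mulNr.
Qed.
Lemma conjc_cR (x : R) : conjc (cR x) = cR x :> C.
Proof. by apply: cmplx_eq; rewrite /= ?oppr0. Qed.
Lemma conjc_one : conjc 1 = 1 :> C.
Proof. by apply: cmplx_eq; rewrite /= ?oppr0. Qed.
Lemma mul_conjc (z : C) : z * conjc z = cR (cmod z ^+ 2).
Proof. by apply: cmplx_eq; rewrite !ReImE /= ?cmod_sqr; ring. Qed.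
Lemma expi_conj (t : R) : expi t * conjc (expi t) = 1 :> C.
Proof. by rewrite mul_conjc cmod_expi expr1n. Qed.
Lemma expi_neq0 (t : R) : expi t != 0 :> C.
Proof. by rewrite -cmod_gt0 cmod_expi. Qed.

Lemma hol_szego c : cmod c <= 1 -> hol (fun z => (1 - c * z)^-1).
Proof.
move=> c1 z z1; have nz : 1 - c * z != 0.
  apply: onem_neq0; rewrite cmodM (le_lt_trans _ z1) // ler_piMl ?cmod_ge0 //.
have d := derC_sub (derC_cst 1 z) (derC_mul (derC_cst c z) (derC_id z)).
by eexists; exact: (derC_comp d (derC_inv nz)).
Qed.

(** On the circle conjugation is inversion, so the conjugate of the Cauchy kernel is holomorphic in
    [expi t]: it is a Szego kernel. *)
Lemma szego_kernelE (w : C) (rho t : R) : 0 < rho -> cmod w < rho ->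
  conjc (cR rho * expi t / (cR rho * expi t - w)) = (1 - conjc w / cR rho * expi t)^-1.
Proof.
move=> r0 wr; rewrite !conjcM conjcV conjcB conjcM conjc_cR.
have rn0 : cR rho != 0 :> C by rewrite -cmod_gt0 cmod_cR normr_gt0 gt_eqF.
have e1 := expi_conj t; have en0 := expi_neq0 t.
have -> : conjc (expi t) = (expi t)^-1 by apply: (mulfI en0); rewrite e1 mulfV.
have d0 : cR rho - conjc w * expi t != 0.
  rewrite -cmod_gt0; apply: lt_le_trans (cmodB_ge _ _).
  by rewrite cmodM cmod_expi mulr1 cmod_conj cmod_cR gtr0_norm // subr_gt0.
have d1 : cR rho * (expi t)^-1 - conjc w != 0.
  have -> : cR rho * (expi t)^-1 - conjc w = (cR rho - conjc w * expi t) * (expi t)^-1 by field.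
  by rewrite mulf_neq0 // invr_neq0.
have d2 : 1 - conjc w / cR rho * expi t != 0.
  have -> : 1 - conjc w / cR rho * expi t = (cR rho - conjc w * expi t) / cR rho by field.
  by rewrite mulf_neq0 // invr_neq0.
apply: (mulIf d2); rewrite mulVf // mulrAC; apply: (mulIf d1).
by rewrite divfK // mul1r; field; rewrite rn0 en0.
Qed.

(** After [circle_shrink] only the kernel is integrated. Its conjugate is the restriction to a
    circle of a holomorphic function with value 1 at the origin, so the mean value property
    evaluates it, and real parts do not see the conjugation. *)
Lemma cauchy_formula H w (rho : R) : hol H -> cmod w < rho -> rho < 1 ->
  Jint (fun y => Re (H (cR rho * expi y) * (cR rho * expi y / (cR rho * expi y - w)))) 0 (2 * pi) =
  2 * pi * Re (H w).
Proof.
move=> hH wr r1; rewrite circle_shrink //.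
have r0 : 0 < rho by exact: le_lt_trans (cmod_ge0 _) wr.
pose q := conjc w / cR rho.
have q1 : cmod q < 1 by rewrite /q cmodM cmodV cmod_conj cmod_cR gtr0_norm // ltr_pdivrMr // mul1r.
(* Writing [q e^(iy)] as [(q / r) (r e^(iy))] with [cmod q <= r < 1] gives a function holomorphic in
   the whole disc, sampled on an interior circle. *)
pose r := (1 + cmod q) / 2.
have q0 := cmod_ge0 q.
have rp : 0 < r < 1 by rewrite /r; lra.
have [rp0 rp1] := andP rp.
have rn0 : cR r != 0 :> C by rewrite -cmod_gt0 cmod_cR normr_gt0 gt_eqF.
have c1 : cmod (q / cR r) <= 1.
  by rewrite cmodM cmodV cmod_cR gtr0_norm // ler_pdivrMr // mul1r /r; lra.
have hG := hol_scale (conjc (H w)) (hol_szego c1).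
have := mean_value hG rp.
rewrite mulr0 subr0 invr1 mulr1 Re_conj => <-; congr Jint; apply/funext => y.
rewrite -[LHS]Re_conj conjcM szego_kernelE //; congr (Re (_ * _^-1)).
by rewrite -/q; congr (1 - _); rewrite mulrA divfK.
Qed.

End CauchyFormula.

(** * Passing pairings from circles to the boundary *)

Section BoundaryPairing.
Variable R : realType.
Local Notation C := (R[i]).
Variable alpha : R.
Local Notation G t := (gT alpha t).
Local Notation circ n t := (cR (rn R n) * expi t).

(** A bounded kernel preserves the uniform [L^2] bound on circles, so [vitali] applies with exponent
    2. *)
Lemma H2rep_lim k H (K : nat -> R -> C) (K1 : R -> C) (B : R) : H2rep alpha k H ->
  (forall n, cmeasurable (K n)) -> (forall n t, T t -> cmod (K n t) <= B) -> cmeasurable K1 ->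
  aeT (fun t => cvgC \oo (K ^~ t) (K1 t)) ->
  tint (fun t => Re (G t * k t * K1 t)) /\
  I (fun t => Re (H (circ n t) * K n t)) @[n --> \oo] --> I (fun t => Re (G t * k t * K1 t)).
Proof.
move=> [hH [mk _] lim [M M0 bM]] mK bK mK1 limK.
have B0 : 0 <= B by apply: le_trans (bK 0%N 0 _); rewrite ?cmod_ge0 // /Tdom /= in_itv /= lexx mulr_ge0 // pi_ge0.
apply: (@vitali R 2 (B ^+ 2 * M)); first lra.
- by move=> n; have [] := cmeas_mul (meas_circle n hH) (mK n).
- by have [] := cmeas_mul (cmeas_mul (cmeas_gT alpha) mk) mK1.
- by apply: (aeT2 _ lim limK) => t _ h1 h2; have [] := cvgC_mul h1 h2.
- move=> n; apply: (@le_trans _ _ (E (fun t => B ^+ 2 * cmod (H (circ n t)) ^+ 2))).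
    apply: E_le.
    + by apply: meas_powR; apply: measurableT_comp => //; have [] := cmeas_mul (meas_circle n hH) (mK n).
    + by apply: measurable_funM => //; apply: measurable_funX; apply: meas_cmod; exact: meas_circle.
    + by move=> t _; exact: powR_ge0.
    + move=> t Tt; rewrite powR_mulrn // -exprMn ler_pXn2r ?nnegrE ?mulr_ge0 ?cmod_ge0 //.
      by rewrite (le_trans (Re_le_cmod _)) // cmodM mulrC ler_wpM2r ?cmod_ge0 // bK.
  have mc : measurable_fun T (fun t => cmod (H (circ n t)) ^+ 2).
    by apply: measurable_funX; apply: meas_cmod; exact: meas_circle.
  rewrite (E_scale (sqr_ge0 B) mc (fun t _ => sqr_ge0 _)).
  by rewrite [leRHS]EFinM; apply: lee_wpmul2l => //; rewrite lee_fin sqr_ge0.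
Qed.

(** The product [H q] is holomorphic, so its circle means do not depend on the radius. When [q]
    vanishes at 0 this says that the conjugate of [q], divided by [g_alpha], is orthogonal to the
    Hardy space. *)
Lemma H2rep_pair k H (q : C -> C) (qT : R -> C) (B : R) : H2rep alpha k H -> hol q ->
  (forall z, cmod z < 1 -> cmod (q z) <= B) -> cmeasurable qT ->
  aeT (fun t => radial_limit q t (qT t)) ->
  tint (fun t => Re (G t * k t * qT t)) /\
  I (fun t => Re (G t * k t * qT t)) = 2 * pi * Re (H 0 * q 0).
Proof.
move=> kH hq bq mq rq; have hH : hol H by case: kH.
have [] := @H2rep_lim k H (fun n t => q (circ n t)) qT B kH.
- by move=> n; exact: meas_circle.
- by move=> n t _; apply: bq; exact: rn_disc.
- exact: mq.
- by apply: aeT1 rq => t _ /radial_limit_seq.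
move=> ti cv; split => //.
have e n : I (fun t => Re (H (circ n t) * q (circ n t))) = 2 * pi * Re (H 0 * q 0).
  by have := mean_value (hol_mul hH hq) (rho := rn R n); rewrite rn_gt0 rn_lt1 => /(_ isT).
apply: (cvg_unique _ cv) => //.
apply: (@cvg_trans _ ((fun=> 2 * pi * Re (H 0 * q 0)) @ \oo)); last exact: cvg_cst.
by apply: near_eq_cvg; apply: nearW => n; rewrite e.
Qed.

Lemma H2rep_cauchy k H (w : C) : H2rep alpha k H -> cmod w < 1 ->
  tint (fun t => Re (G t * k t * conjc (1 - conjc w * expi t)^-1)) /\
  I (fun t => Re (G t * k t * conjc (1 - conjc w * expi t)^-1)) = 2 * pi * Re (H w).
Proof.
move=> kH w1; have hH : hol H by case: kH.
pose r0 := (1 + cmod w) / 2; have w0 := cmod_ge0 w.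
have wr : cmod w < r0 by rewrite /r0; lra.
have r1 : r0 < 1 by rewrite /r0; lra.
(* The kernel is replaced by 0 until the circle encloses [w] with a margin; this makes the bound
   [1 / (r0 - cmod w)] valid for every [n] without affecting the limit. *)
pose K n t : C := if r0 < rn R n then circ n t / (circ n t - w) else 0.
have kd n t : r0 < rn R n -> r0 - cmod w <= cmod (circ n t - w).
  by move=> rr; apply: le_trans (cmodB_ge _ _); rewrite cmod_circle ?lerD2r ltW // rn_gt0.
have kn0 n t : r0 < rn R n -> circ n t - w != 0.
  by move=> rr; rewrite -cmod_gt0; apply: lt_le_trans (kd n t rr); rewrite subr_gt0.
have near_r : \forall n \near \oo, r0 < rn R n.
  have e0 : 0 < 1 - r0 by rewrite subr_gt0.
  by move/cvgrPdist_lt : (@rn_cvg R) => /(_ _ e0); apply: filterS => n; rewrite ltr_distl => /andP[]; lra.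
have szn0 t : 1 - conjc w * expi t != 0.
  by apply: onem_neq0; rewrite cmodM cmod_conj cmod_expi mulr1.
have szc t : conjc (1 - conjc w * expi t)^-1 = expi t / (expi t - w).
  have c1 : cR 1 = 1 :> C by [].
  have := @szego_kernelE R w 1 t ltr01 w1; rewrite c1 !mul1r divr1 => <-.
  by rewrite conjcK.
have [] := @H2rep_lim k H K (fun t => conjc (1 - conjc w * expi t)^-1) (r0 - cmod w)^-1 kH.
- move=> n; rewrite /K; have [rr|rr] := ltP r0 (rn R n); last by split; exact: measurable_cst.
  have cc (t : R) : cvgC (nbhs t) (fun t => circ n t) (circ n t).
    by apply: cvgC_mul; [exact: cvgC_cst|exact: cvg_expi].
  have ck (t : R) : cvgC (nbhs t) (fun t => circ n t / (circ n t - w)) (circ n t / (circ n t - w)).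
    apply: cvgC_mul => //; apply: cvgC_inv; first exact: kn0.
    by apply: cvgC_sub => //; exact: cvgC_cst.
  by split; apply: measT_cont => t; have [] := ck t.
- move=> n t _; rewrite /K; case: ifPn => rr; last by rewrite cmod0 invr_ge0 subr_ge0 ltW.
  rewrite cmodM cmodV cmod_circle ?(ltW (rn_gt0 _ _)) // -[leRHS]mul1r ler_pM ?invr_ge0 ?cmod_ge0 ?(ltW (rn_gt0 _ _)) ?(ltW (rn_lt1 _ _)) //.
  by rewrite lef_pV2 ?posrE ?subr_gt0 // ?cmod_gt0 ?kn0 // kd.
- apply: cmeas_conj; have ck (t : R) : cvgC (nbhs t) (fun t => (1 - conjc w * expi t)^-1) (1 - conjc w * expi t)^-1.
    apply: cvgC_inv => //; apply: cvgC_sub; first exact: cvgC_cst.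
    by apply: cvgC_mul; [exact: cvgC_cst|exact: cvg_expi].
  by split; apply: measT_cont => t; have [] := ck t.
- apply: aeTW => t _; rewrite szc.
  apply: (@cvgC_near _ _ _ _ (fun n => circ n t / (circ n t - w))).
    by apply: filterS near_r => n rr; rewrite /K rr.
  have cc := @cvg_radius R t; apply: cvgC_mul => //; apply: cvgC_inv.
    rewrite -cmod_gt0; apply: lt_le_trans (cmodB_ge _ _); rewrite cmod_expi subr_gt0 //.
  by apply: cvgC_sub => //; exact: cvgC_cst.
move=> ti cv; split => //; apply: (cvg_unique _ cv) => //.
apply: (@cvg_trans _ ((fun=> 2 * pi * Re (H w)) @ \oo)); last exact: cvg_cst.
apply: near_eq_cvg; apply: filterS near_r => n rr.
have wn : cmod w < rn R n by exact: lt_trans rr.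
rewrite -(cauchy_formula hH wn (rn_lt1 R n)) /Jint /K rr //.
Qed.

End BoundaryPairing.

(** * The projection and duality *)

Section WeightedSpaces.
Variable R : realType.
Local Notation C := (R[i]).
Variable alpha : R.
Hypothesis alpha0 : 0 <= alpha.
Implicit Types u v f g h k : R -> C.

Definition ip u v : R := I (fun t => Re (u t * conjc (v t)) * mu alpha t).

Lemma wint_meas p f : cmeasurable f -> measurable_fun T (fun t => cmod (f t) `^ p * mu alpha t).
Proof. by move=> mf; apply: measurable_funM; [apply: meas_powR; exact: meas_cmod|exact: meas_mu]. Qed.

Lemma wint_ge0f p f t : 0 <= cmod (f t) `^ p * mu alpha t.
Proof. by rewrite mulr_ge0 ?powR_ge0 // mu_ge0. Qed.

Lemma InLp_tint p f : InLp alpha p f -> tint (fun t => cmod (f t) `^ p * mu alpha t).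
Proof. by move=> [mf foo]; apply: tint_fin; [move=> t _; exact: wint_ge0f|exact: wint_meas|exact: foo]. Qed.

Lemma InLp_le p f g : 0 <= p -> cmeasurable g -> aeT (fun t => cmod (g t) <= cmod (f t)) ->
  InLp alpha p f -> InLp alpha p g /\ (wint alpha p g <= wint alpha p f)%E.
Proof.
move=> p0 mg gf [mf foo].
have le : (wint alpha p g <= wint alpha p f)%E.
  apply: ae_le_integral; [exact: wint_meas|exact: wint_meas|by move=> t _; exact: wint_ge0f|].
  by apply: aeT1 gf => t _ h; rewrite ler_wpM2r ?mu_ge0 // ge0_ler_powR ?nnegrE ?cmod_ge0.
by split; [split; [exact: mg|exact: le_lt_trans le foo]|exact: le].
Qed.

Lemma InLp_add p f g : 0 <= p -> InLp alpha p f -> InLp alpha p g -> InLp alpha p (fun t => f t + g t).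
Proof.
move=> p0 lf lg; have mf := lf.1; have mg := lg.1; have mfg := cmeas_add mf mg; split; first exact: mfg.
have ti : tint (fun t => 2 `^ p * (cmod (f t) `^ p * mu alpha t + cmod (g t) `^ p * mu alpha t)).
  by apply: tintZ; apply: tintD; exact: InLp_tint.
have ti2 : tint (fun t => cmod (f t + g t) `^ p * mu alpha t).
  apply: (tint_le _ _ ti); first exact: wint_meas.
  move=> t _ /=; rewrite (ger0_norm (wint_ge0f p (fun t => f t + g t) t)).
  rewrite -[leRHS]/(2 `^ p * (cmod (f t) `^ p * mu alpha t + cmod (g t) `^ p * mu alpha t)) -mulrDl mulrA ler_wpM2r ?mu_ge0 //.
  apply: le_trans (powRD_le p0 (cmod_ge0 _) (cmod_ge0 _)).
  by rewrite ge0_ler_powR ?nnegrE ?addr_ge0 ?cmod_ge0 // cmodD.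
by rewrite /wint -(EFin_I ti2) ltry.
Qed.

Lemma InLp_scale p c f : InLp alpha p f -> InLp alpha p (fun t => c * f t).
Proof.
move=> lf; have mf := lf.1.
have mcf : cmeasurable (fun t => c * f t) by apply: cmeas_mul => //; split; exact: measurable_cst.
split; first exact: mcf.
have ti : tint (fun t => cmod c `^ p * (cmod (f t) `^ p * mu alpha t)) by apply: tintZ; exact: InLp_tint.
have ti2 : tint (fun t => cmod (c * f t) `^ p * mu alpha t).
  apply: (tint_le _ _ ti); first exact: wint_meas.
  by move=> t _; rewrite (ger0_norm (wint_ge0f p (fun t => c * f t) t)) cmodM powRM ?cmod_ge0 // mulrA.
by rewrite /wint -(EFin_I ti2) ltry.
Qed.

Lemma InLp_sub p f g : 0 <= p -> InLp alpha p f -> InLp alpha p g -> InLp alpha p (fun t => f t - g t).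
Proof.
move=> p0 lf lg; have := InLp_add p0 lf (InLp_scale (-1) lg).
by under eq_fun do rewrite mulN1r.
Qed.

Lemma InLp_bounded p f (B : R) : 0 <= p -> cmeasurable f -> aeT (fun t => cmod (f t) <= B) -> InLp alpha p f.
Proof.
move=> p0 mf fB.
have B1 : 0 <= `|B| by [].
have l1 : InLp alpha p (fun=> cR `|B|).
  split; first by split; exact: measurable_cst.
  have ti : tint (fun t => cmod (cR `|B| : C) `^ p * mu alpha t).
    apply: tintZ; apply: (@tint_bounded _ _ (2 `^ (2 * alpha))); first exact: meas_mu.
    by move=> t _; rewrite ger0_norm ?mu_ge0 // mu_le.
  by rewrite /wint -(EFin_I ti) ltry.
apply: (InLp_le p0 mf _ l1).1; apply: aeT1 fB => t _ h.
by rewrite cmod_cR normr_id (le_trans h) // ler_norm.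
Qed.

Lemma ip_tint u v : InLp alpha 2 u -> InLp alpha 2 v -> tint (fun t => Re (u t * conjc (v t)) * mu alpha t).
Proof.
move=> lu lv; apply: (tint_le _ _ (tintD (InLp_tint lu) (InLp_tint lv))).
  apply: measurable_funM; last exact: meas_mu.
  by have [] := cmeas_mul lu.1 (cmeas_conj lv.1).
move=> t _; rewrite normrM (ger0_norm (mu_ge0 _ _)) -mulrDl ler_wpM2r ?mu_ge0 //.
apply: (le_trans (Re_le_cmod _)); rewrite cmodM cmod_conj !powR_mulrn ?cmod_ge0 //.
have := sqr_ge0 (cmod (u t) - cmod (v t)); have := cmod_ge0 (u t); have := cmod_ge0 (v t); nra.
Qed.

Lemma ipC u v : ip u v = ip v u.
Proof. by rewrite /ip; congr Rintegral; apply/funext => t; congr (_ * _); rewrite !ReImE; ring. Qed.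

Lemma ipDl u v h : InLp alpha 2 u -> InLp alpha 2 v -> InLp alpha 2 h ->
  ip (fun t => u t + v t) h = ip u h + ip v h.
Proof.
move=> lu lv lh; rewrite /ip -(I_D (ip_tint lu lh) (ip_tint lv lh)).
by congr Rintegral; apply/funext => t; rewrite !ReImE; ring.
Qed.

Lemma ip_scale c u v : ip (fun t => c * u t) v = ip u (fun t => conjc c * v t).
Proof. by rewrite /ip; congr Rintegral; apply/funext => t; rewrite !ReImE; ring. Qed.

Lemma ipBl u v h : InLp alpha 2 u -> InLp alpha 2 v -> InLp alpha 2 h ->
  ip (fun t => u t - v t) h = ip u h - ip v h.
Proof.
move=> lu lv lh; rewrite /ip -(I_B (ip_tint lu lh) (ip_tint lv lh)).
by congr Rintegral; apply/funext => t; rewrite !ReImE; ring.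
Qed.

Lemma ip_ae u v u' v' : aeT (fun t => u t = u' t) -> aeT (fun t => v t = v' t) -> ip u v = ip u' v'.
Proof. by move=> uu vv; apply: I_ae; apply: (aeT2 _ uu vv) => t _ -> ->. Qed.

Lemma ip_self u : InLp alpha 2 u -> (ip u u)%:E = wint alpha 2 u.
Proof.
move=> lu; rewrite /ip (EFin_I (ip_tint lu lu)) /wint; apply: eq_integral => t _; congr (_ * _)%:E.
by rewrite mul_conjc powR_mulrn ?cmod_ge0.
Qed.

Lemma ip_ge0 u : 0 <= ip u u.
Proof. by apply: Rintegral_ge0 => t _; rewrite mul_conjc /= mulr_ge0 ?sqr_ge0 ?mu_ge0. Qed.

Lemma mu_gt0 t : 0 < t < 2 * pi -> 0 < mu alpha t.
Proof. by move=> ti; rewrite muE // exprn_gt0 // cmod_gt0 gT_neq0. Qed.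

Lemma ip_eq0 u : InLp alpha 2 u -> ip u u = 0 -> aeT (fun t => u t = 0).
Proof.
move=> lu u0; have mI := measurable_int _ (ip_tint lu lu).
pose w t : R := Re (u t * conjc (u t)) * mu alpha t.
have w0 t : 0 <= w t by rewrite /w mul_conjc /= mulr_ge0 ?sqr_ge0 ?mu_ge0.
have h0 : (\int[leb]_(t in T) `|(EFin \o w) t| = 0)%E.
  transitivity (E (fun t => Re (u t * conjc (u t)) * mu alpha t)).
    by apply: eq_integral => t _; rewrite /= (ger0_norm (w0 t)).
  by rewrite -(EFin_I (ip_tint lu lu)) -/(ip u u) u0.
have /(ae_eq_integral_abs leb mT mI).1 ae0 := h0.
have ae1 : aeT (fun t => Re (u t * conjc (u t)) * mu alpha t = 0).
  by move: ae0; rewrite /ae_eq; apply: filterS => t h Tt; have [] := h Tt.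
apply: (aeT2 _ ae1 (aeT_interior R)) => t _ h ti; move: h => /eqP.
rewrite mulf_eq0 (gt_eqF (mu_gt0 ti)) orbF mul_conjc /= sqrf_eq0 cmod_eq0 => /eqP //.
Qed.

Lemma InH2_scale c h : InH2 alpha h -> InH2 alpha (fun t => c * h t).
Proof.
move=> [F [hF [M bM] rl]]; move/holomorphic_on_discP : (hF) => holF; exists (fun z => c * F z); split.
- by apply/holomorphic_on_discP; exact: hol_scale.
- exists (cmod c ^+ 2 * M) => r r0 r1; rewrite EFinM.
  have zd t : cmod (cR r * expi t) < 1 by rewrite cmod_circle.
  have e (F' : C -> C) t : cmod (F' (cR r * expi t)) ^+ 2 * absg2 alpha (cR r * expi t) =
      cmod (gz alpha (cR r * expi t) * F' (cR r * expi t)) ^+ 2.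
    rewrite absg2E; last by apply: Re_onem_gt0.
    by rewrite cmodM exprMn mulrC.
  have mm : measurable_fun T (fun t => cmod (gz alpha (cR r * expi t) * F (cR r * expi t)) ^+ 2).
    apply: measurable_funX; apply: meas_cmod; have hH := hol_mul (gz_hol alpha) holF.
    have rr : 0 <= r < 1 by rewrite r0.
    by split; apply: measT_cont => t; have [] := cont_circle hH rr t.
  have := bM r r0 r1; under eq_integral do rewrite e; move=> bM'.
  have -> : (\int[leb]_(t in T) (cmod ((fun z => c * F z) (cR r * expi t)) ^+ 2 * absg2 alpha (cR r * expi t))%:E)%E =
      E (fun t => cmod c ^+ 2 * cmod (gz alpha (cR r * expi t) * F (cR r * expi t)) ^+ 2).
    by apply: eq_integral => t _; rewrite -e cmodM exprMn mulrA.
  rewrite (E_scale (sqr_ge0 _) mm (fun t _ => sqr_ge0 _)).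
  by apply: lee_wpmul2l => //; rewrite lee_fin sqr_ge0.
- apply: (aeT1 _ rl) => t _ rt.
  have rc : radial_limit (fun=> c) t c.
    by move=> eps e0; exists 1 => // r _ _; rewrite subrr cmod0.
  exact: radial_limit_mul.
Qed.

(* [k] represents the projection of [f]; [ip] is the real inner product, which suffices because the Hardy space is stable under multiplication by [i]. *)
Definition isproj f k := [/\ InLp alpha 2 f, exists H, H2rep alpha k H, InH2 alpha k &
  forall h, InH2 alpha h -> InLp alpha 2 h -> ip (fun t => f t - k t) h = 0].

Lemma isproj_L2 f k : isproj f k -> InLp alpha 2 k.
Proof. by move=> [_ [H []]]. Qed.

Lemma isproj_ip f k h : isproj f k -> InH2 alpha h -> InLp alpha 2 h -> ip f h = ip k h.
Proof.
move=> pr ih lh; have lk := isproj_L2 pr; case: pr => lf _ _ /(_ h ih lh).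
by rewrite (ipBl lf lk lh) => /eqP; rewrite subr_eq0 => /eqP.
Qed.

(** The difference [d] is orthogonal to the Hardy space, in particular to [k], [k1] and [c k2]
    separately, hence to itself. Sums of members of [InH2] are never formed. *)
Lemma isproj_lin c f1 f2 f k1 k2 k : isproj f1 k1 -> isproj f2 k2 -> isproj f k ->
  aeT (fun t => f t = f1 t + c * f2 t) -> aeT (fun t => k t = k1 t + c * k2 t).
Proof.
move=> p1 p2 p0 fe.
have l1 := isproj_L2 p1; have l2 := isproj_L2 p2; have l0 := isproj_L2 p0.
have lf1 : InLp alpha 2 f1 by case: p1.
have lf2 : InLp alpha 2 f2 by case: p2.
have lf : InLp alpha 2 f by case: p0.
have i0 : InH2 alpha k by case: p0.
have i1 : InH2 alpha k1 by case: p1.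
have i2 : InH2 alpha k2 by case: p2.
pose k' t := k1 t + c * k2 t; pose d t := k t - k' t.
have lck := InLp_scale c l2; have lk' : InLp alpha 2 k' by exact: (InLp_add _ l1 lck).
have ld : InLp alpha 2 d by exact: (InLp_sub _ l0 lk').
have ick : InH2 alpha (fun t => c * k2 t) by exact: InH2_scale.
have dh h : InH2 alpha h -> InLp alpha 2 h -> ip d h = 0.
  move=> ih lh; rewrite /d (ipBl l0 lk' lh) /k' (ipDl l1 lck lh) -(isproj_ip p0 ih lh) -(isproj_ip p1 ih lh).
  have ih' : InH2 alpha (fun t => conjc c * h t) by exact: InH2_scale.
  have lh' := InLp_scale (conjc c) lh.
  rewrite [ip (fun t => c * k2 t) h]ip_scale -(isproj_ip p2 ih' lh') -ip_scale.
  have hh : aeT (fun t => h t = h t) by exact: aeTW.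
  rewrite (@ip_ae f h (fun t => f1 t + c * f2 t) h fe hh) (ipDl lf1 (InLp_scale c lf2) lh).
  by rewrite subrr.
have dd : ip d d = 0.
  rewrite {2}/d ipC (ipBl l0 lk' ld) /k' (ipDl l1 lck ld) [ip k d]ipC [ip k1 d]ipC [ip _ d]ipC.
  by rewrite (dh k i0 l0) (dh k1 i1 l1) (dh _ ick lck) addr0 subrr.
by apply: aeT1 (ip_eq0 ld dd) => t _ /eqP; rewrite subr_eq0 => /eqP.
Qed.

Lemma isproj_uniq f k k' : isproj f k -> isproj f k' -> aeT (fun t => k t = k' t).
Proof.
move=> p0 p1; have := isproj_lin (c := 0) p1 p1 p0.
have h : aeT (fun t => f t = f t + 0 * f t) by apply: aeTW => t _; rewrite mul0r addr0.
by move=> /(_ h); apply: aeT1 => t _ ->; rewrite mul0r addr0.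
Qed.

Lemma wint_ae p f g : aeT (fun t => f t = g t) -> wint alpha p f = wint alpha p g.
Proof. by move=> fg; apply: ae_integral; apply: aeT1 fg => t _ ->. Qed.

(** Boundedness for the relation [isproj], whose second member is a measurable square-integrable
    representative; [bounded_on_LpE] relates it to [S]. *)
Definition bdd p := exists2 K : R, 0 <= K & forall f k, InLp alpha p f -> isproj f k ->
  (wint alpha p k <= (K `^ p)%:E * wint alpha p f)%E.

Lemma bdd2 : bdd 2.
Proof.
exists 1; first exact: ler01.
move=> f k _ pr; have lk := isproj_L2 pr; have ik : InH2 alpha k by case: pr.
have lf : InLp alpha 2 f by case: pr.
rewrite powR1 mul1e -(ip_self lf) -(ip_self lk) lee_fin.
have fk := isproj_ip pr ik lk.
have l : InLp alpha 2 (fun t => f t - k t) by exact: (InLp_sub _ lf lk).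
have := ip_ge0 (fun t => f t - k t).
rewrite (ipBl lf lk l) [ip f _]ipC [ip k _]ipC (ipBl lf lk lf) (ipBl lf lk lk) fk [ip k f]ipC fk; lra.
Qed.

Variable S : (R -> C) -> (R -> C).
Hypothesis hS : is_Szego_projection alpha S.

Lemma isproj_ex f : InLp alpha 2 f -> exists2 k, isproj f k & aeT (fun t => S f t = k t).
Proof.
move=> lf; have [ih orth] := hS lf; have [k [H [kH e ik]]] := InH2_rep ih.
exists k; last exact: e.
split; [exact: lf|by exists H|exact: ik|].
move=> h /orth[+ _] _; rewrite /worth => o.
have -> : ip (fun t => f t - k t) h = ip (f \- S f) h.
  by apply: ip_ae; [apply: aeT1 e => t _ /= ->|exact: aeTW].
by rewrite /ip /Rintegral o.
Qed.

Lemma bounded_on_LpE p : bounded_on_Lp alpha p S <-> bdd p.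
Proof.
split=> [[K [K0 H]]|[K K0 H]]; exists K.
- exact: K0.
- move=> f k lp pr; have lf : InLp alpha 2 f by case: pr.
  have [k' pr' e] := isproj_ex lf; have u := isproj_uniq pr pr'.
  rewrite (wint_ae _ u) -(wint_ae _ e); exact: (H f lf lp).
split; first exact: K0.
move=> f lf lp; have [k pr e] := isproj_ex lf.
by rewrite (wint_ae _ e); exact: (H f k lp pr).
Qed.

End WeightedSpaces.

(** * Duality between conjugate exponents *)

Section Duality.
Variable R : realType.
Local Notation C := (R[i]).
Variable alpha : R.
Hypothesis alpha0 : 0 <= alpha.
Implicit Types u v f g h k : R -> C.
Hypothesis proj_ex : forall f, InLp alpha 2 f -> exists k, isproj alpha f k.

Section Truncation.
Variables (p q K A : R) (f k : R -> C) (N : R).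
Hypotheses (p1 : 1 < p) (q1 : 1 < q) (pq : p^-1 + q^-1 = 1) (K0 : 0 < K) (N0 : 0 <= N).
Hypothesis bq : forall f k, InLp alpha q f -> isproj alpha f k ->
  (wint alpha q k <= (K `^ q)%:E * wint alpha q f)%E.
Hypotheses (lp : InLp alpha p f) (pr : isproj alpha f k).

Let m t := Num.min (cmod (k t)) N.

(** Since [k] may lie outside [L^p], it is paired with a bounded function [phi] having the phase of
    [k] and modulus [m^(p - 1)]. Self-adjointness moves the projection onto [phi], where the [L^q]
    bound acts, and the resulting multiple of the left side is finite, so it can be absorbed. *)
Lemma duality_trunc : (E (fun t => m t `^ p * mu alpha t) <= (K `^ p)%:E * wint alpha p f)%E.
Proof.
have p0 : 0 < p by rewrite (lt_trans _ p1).
have q0 : 0 < q by rewrite (lt_trans _ q1).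
have epq : (p - 1) * q = p.
  have : (p^-1 + q^-1) * (p * q) = p * q by rewrite pq mul1r.
  have -> : (p^-1 + q^-1) * (p * q) = p + q by field; rewrite !gt_eqF.
  by move=> h; rewrite mulrBl mul1r -h addrK.
have lk := isproj_L2 pr; have mk := lk.1.
have mm : measurable_fun T m by apply: measurable_minr => //; exact: meas_cmod.
have m0 t : 0 <= m t by rewrite le_min cmod_ge0.
(* The power with exponent -1 serves as a measurable inverse; at zeros of [k] the factor [k t] makes
   [phi] vanish. *)
pose phi t : C := cR (m t `^ (p - 1) * cmod (k t) `^ (-1)) * k t.
have mphi : cmeasurable phi.
  apply: cmeas_mul => //; apply: cmeas_cR; apply: measurable_funM; apply: meas_powR => //.
  exact: meas_cmod.
have p10 : p - 1 != 0 by rewrite gt_eqF // subr_gt0.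
have cphi t : cmod (phi t) = m t `^ (p - 1).
  rewrite /phi cmodM cmod_cR ger0_norm ?mulr_ge0 ?powR_ge0 //.
  have [k0|k0] := eqVneq (cmod (k t)) 0.
    have -> : m t = 0 by apply/eqP; rewrite eq_le m0 andbT /m k0 ge_min lexx.
    by rewrite k0 mulr0 powR0.
  by rewrite powR_inv1 ?cmod_ge0 // divfK.
have phib : aeT (fun t => cmod (phi t) <= N `^ (p - 1)).
  apply: aeTW => t _; rewrite cphi ge0_ler_powR ?nnegrE //; first by rewrite subr_ge0 ltW.
  by rewrite /m ge_min lexx orbT.
have lphi2 : InLp alpha 2 phi by apply: (InLp_bounded alpha0 _ mphi phib).
have lphiq : InLp alpha q phi by apply: (InLp_bounded alpha0 _ mphi phib); exact: ltW.
have [kq prq] := proj_ex lphi2.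
have lkq2 := isproj_L2 prq; have ik : InH2 alpha k by case: pr.
have ikq : InH2 alpha kq by case: prq.
have wphi t : cmod (phi t) `^ q * mu alpha t = m t `^ p * mu alpha t by rewrite cphi -powRrM epq.
have tm : tint (fun t => m t `^ p * mu alpha t).
  by have := InLp_tint lphiq; under eq_fun do rewrite wphi.
set X := I (fun t => m t `^ p * mu alpha t).
have bkq := bq lphiq prq.
have wX : wint alpha q phi = X%:E.
  by rewrite /X (EFin_I tm) /wint; apply: eq_integral => t _; rewrite wphi.
have lkq : InLp alpha q kq.
  by split; [exact: lkq2.1|rewrite (le_lt_trans bkq) // wX -EFinM ltry].
have tkq := InLp_tint lkq; have tf := InLp_tint lp.
have lf2 : InLp alpha 2 f by case: pr.
have hX : X <= ip alpha k phi.
  apply: le_Rintegral => //; first exact: ip_tint.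
  move=> t _; apply: ler_wpM2r; first exact: mu_ge0.
  rewrite /phi conjcM conjc_cR mulrCA mul_conjc -cRM /=.
  have [k0|k0] := eqVneq (cmod (k t)) 0.
    have -> : m t = 0 by apply/eqP; rewrite eq_le m0 andbT /m k0 ge_min lexx.
    by rewrite k0 expr0n mulr0 powR0 // gt_eqF.
  rewrite powR_inv1 ?cmod_ge0 // expr2 mulrA divfK // .
  have -> : m t `^ p = m t `^ (p - 1) * m t.
    rewrite -{3}(powRr1 (m0 t)) -powRD ?subrK //; apply/implyP => /eqP e.
    by move: p0; rewrite e ltxx.
  by rewrite ler_wpM2l ?powR_ge0 // /m ge_min lexx.
have chain : ip alpha k phi = ip alpha f kq.
  by rewrite ipC (isproj_ip prq ik lk) ipC (isproj_ip pr ikq lkq2).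
(* Young's inequality for [K |f|] and [|kq| / K]: the factor [K^(-q)] cancels the constant of the
   [L^q] bound and leaves exactly [X / q]. *)
have hY : ip alpha f kq <= K `^ p / p * I (fun t => cmod (f t) `^ p * mu alpha t) +
    (K `^ q)^-1 / q * I (fun t => cmod (kq t) `^ q * mu alpha t).
  rewrite -(I_Z tf) -(I_Z tkq).
  rewrite -(I_D (tintZ _ tf) (tintZ _ tkq)).
  apply: le_Rintegral => //; first exact: ip_tint.
    exact: (tintD (tintZ _ tf) (tintZ _ tkq)).
  move=> t _; rewrite !mulrA -mulrDl; apply: ler_wpM2r; first exact: mu_ge0.
  apply: (le_trans (ler_norm _)); apply: (le_trans (Re_le_cmod _)); rewrite cmodM cmod_conj.
  have -> : cmod (f t) * cmod (kq t) = (K * cmod (f t)) * (cmod (kq t) / K) by field; rewrite gt_eqF.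
  have a0 : 0 <= K * cmod (f t) by rewrite mulr_ge0 ?cmod_ge0 // ltW.
  have b0 : 0 <= cmod (kq t) / K by rewrite divr_ge0 ?cmod_ge0 // ltW.
  apply: (le_trans (conjugate_powR a0 b0 p0 q0 pq)).
  rewrite powRM ?cmod_ge0 ?(ltW K0) // powRM ?cmod_ge0 ?invr_ge0 ?(ltW K0) //.
  have -> : K^-1 `^ q = (K `^ q)^-1 by rewrite -powR_inv1 ?(ltW K0) // -powRrM mulN1r powRN.
  by rewrite le_eqVlt; apply/orP; left; apply/eqP; ring.
have hkq : I (fun t => cmod (kq t) `^ q * mu alpha t) <= K `^ q * X.
  by rewrite -lee_fin (EFin_I tkq) EFinM -wX.
have Kq : 0 < K `^ q by rewrite powR_gt0.
have h1 : (K `^ q)^-1 / q * I (fun t => cmod (kq t) `^ q * mu alpha t) <= X / q.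
  apply: (@le_trans _ _ ((K `^ q)^-1 / q * (K `^ q * X))).
    by apply: ler_wpM2l hkq; rewrite divr_ge0 ?invr_ge0 ?powR_ge0 ?(ltW q0).
  by rewrite le_eqVlt; apply/orP; left; apply/eqP; field; rewrite !gt_eqF.
rewrite -(EFin_I tm) -/X /wint -(EFin_I tf) -EFinM lee_fin.
pose Z := I (fun t => cmod (f t) `^ p * mu alpha t); rewrite -/Z in hY *.
have : X <= K `^ p / p * Z + X / q by rewrite (le_trans hX) // chain (le_trans hY) // lerD2l.
have eq1 : q^-1 = 1 - p^-1 by rewrite -pq addrAC subrr add0r.
have -> : X / q = X - X / p by rewrite eq1; ring.
move=> h; have : X / p <= K `^ p / p * Z by clearbody X Z; lra.
by rewrite (ler_pdivrMr _ _ p0) mulrAC (divfK (lt0r_neq0 p0)); exact.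
Qed.

End Truncation.

Lemma bdd_dual p q : 1 < p -> 1 < q -> p^-1 + q^-1 = 1 -> bdd alpha q -> bdd alpha p.
Proof.
move=> p1 q1 pq [K K0 bK]; exists (K + 1); first by rewrite addr_ge0.
have K1 : 0 < K + 1 by rewrite ltr_wpDl.
move=> f k lp pr; have lk := isproj_L2 pr.
have q0 : 0 <= q by rewrite ltW // (lt_trans _ q1).
have p0 : 0 < p by rewrite (lt_trans _ p1).
have bq f' k' : InLp alpha q f' -> isproj alpha f' k' -> (wint alpha q k' <= ((K + 1) `^ q)%:E * wint alpha q f')%E.
  move=> lf' pr'; apply: (le_trans (bK _ _ lf' pr')); apply: lee_wpmul2r.
    by apply: integral_ge0 => t _; rewrite lee_fin wint_ge0f.
  by rewrite lee_fin ge0_ler_powR ?nnegrE ?addr_ge0 // lerDl.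
apply: (@fatouT _ (fun n t => Num.min (cmod (k t)) n%:R `^ p * mu alpha t)).
- move=> n; apply: measurable_funM; last exact: meas_mu.
  by apply: meas_powR; apply: measurable_minr => //; apply: meas_cmod; exact: lk.1.
- by move=> n t _; rewrite mulr_ge0 ?powR_ge0 // mu_ge0.
- apply: aeTW => t _; apply: cvgM; last exact: cvg_cst.
  apply: cvg_near_cst; exists (Num.bound (cmod (k t))) => // n /= hn.
  rewrite min_l // ltW // (lt_le_trans (archi_boundP (cmod_ge0 _))) // ler_nat //.
- by move=> n; apply: (duality_trunc p1 q1 pq K1 _ bq lp pr).
Qed.

End Duality.

(** * Real boundary data *)

Section Trigonometry.
Variable R : realType.

Lemma cos_nonincreasing (u v : R) : 0 <= u -> v <= pi -> u <= v -> cos v <= cos u.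
Proof.
move=> u0 v1 uv; rewrite le_eqVlt; have [->|nuv] := eqVneq u v; first by rewrite eqxx.
have iu : u \in `[0, pi] by rewrite in_itv /= u0 (le_trans uv v1).
have iv : v \in `[0, pi] by rewrite in_itv /= (le_trans u0 uv) v1.
by apply/orP; right; rewrite (ltr_cos iu iv) lt_neqAle nuv uv.
Qed.

(* [p x + b y] lies strictly between [pi / 2] and [3 pi / 2] when [x] is close to [pi / 2], because [b < p - 1]. *)
Lemma cos_combination (p b : R) : 1 < p -> p < 2 -> 0 <= b -> b < p - 1 ->
  exists c C : R, [/\ 0 < c, 0 < C & forall x y : R, `|x| < pi / 2 -> `|y| < pi / 2 ->
    cos (p * x + b * y) <= C * cos x `^ p - c].
Proof.
move=> p1 p2 b0 bp; have pi0 := pi_gt0 R.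
(* Half of the gap between [p pi / 2] and [pi / 2 + b pi / 2]. From [x0] on, the phase is at least
   [pi / 2 + d] for every [y]; it stays below [3 pi / 2 - d] because [b < p - 1] and [p < 2]. *)
pose d := (p - 1 - b) * (pi / 4).
have d0 : 0 < d by rewrite mulr_gt0 ?divr_gt0 // subr_gt0; lra.
have d1 : d < pi / 4 by rewrite /d gtr_pMl ?divr_gt0 //; lra.
pose x0 := (pi / 2 + b * (pi / 2) + d) / p.
have pp : 0 < p by lra.
have px0 : p * x0 = pi / 2 + b * (pi / 2) + d by rewrite /x0 mulrC divfK // gt_eqF.
have x00 : 0 < x0.
  by rewrite divr_gt0 // addr_gt0 // ltr_wpDr ?mulr_ge0 ?divr_gt0 ?divr_ge0 // ltW.
have x01 : x0 < pi / 2.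
  rewrite -(ltr_pM2l pp) px0 /d.
  have : 0 < (p - 1 - b) * (pi / 4) by exact: d0.
  have -> : p * (pi / 2) = pi / 2 + b * (pi / 2) + (p - 1 - b) * (pi / 4) + (p - 1 - b) * (pi / 4).
    by move: (pi : R) => q; field.
  by lra.
(* For [x >= x0] the cosine is at most [- sin d]. For [x <= x0] the constant [(1 + c) / cos x0 ^ p]
   pushes the right side up to at least 1. *)
pose c := sin d.
have c0 : 0 < c by rewrite sin_gt0_pi // d0 /=; lra.
pose k := cos x0.
have k0 : 0 < k by rewrite cos_gt0_pihalf // x01 andbT; lra.
exists c, ((1 + c) / k `^ p); split => //.
  by rewrite divr_gt0 ?powR_gt0 // addr_gt0.
have main x y : 0 <= x -> x < pi / 2 -> `|y| < pi / 2 -> cos (p * x + b * y) <= (1 + c) / k `^ p * cos x `^ p - c.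
  move=> xp xlt ylt; have [xl|xg] := leP x x0.
    have kx : k <= cos x by rewrite /k cos_nonincreasing //; lra.
    have : 1 + c <= (1 + c) / k `^ p * cos x `^ p.
      rewrite mulrAC ler_pdivlMr ?powR_gt0 // ler_wpM2l //; first lra.
      by rewrite ge0_ler_powR ?nnegrE //; lra.
    by have := cos_le1 (p * x + b * y); lra.
  have cosx : 0 <= (1 + c) / k `^ p * cos x `^ p.
    by rewrite mulr_ge0 ?powR_ge0 // divr_ge0 ?powR_ge0 // addr_ge0 // ltW.
  have : cos (p * x + b * y) <= - c; last lra.
  have yb : - (b * (pi / 2)) <= b * y <= b * (pi / 2).
    move: ylt; rewrite ltr_norml => /andP[y1 y2]; apply/andP; split.
      by rewrite -mulrN ler_wpM2l // ltW.
    by rewrite ler_wpM2l // ltW.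
  have xb : p * x0 <= p * x <= p * (pi / 2) by rewrite !ler_pM2l // !ltW.
  have lo : pi / 2 + d <= p * x + b * y by move: xb yb; rewrite px0; lra.
  have hi : p * x + b * y <= 3 * (pi / 2) - d.
    have : p * (pi / 2) + b * (pi / 2) + d <= 3 * (pi / 2).
      have -> : p * (pi / 2) + b * (pi / 2) + d = (3 * p + b - 1) * (pi / 4) by rewrite /d; move: (pi : R) => q; field.
      have -> : 3 * (pi / 2) = 6 * (pi / 4) :> R by move: (pi : R) => q; field.
      by rewrite ler_pM2r ?divr_gt0 //; lra.
    by move: xb yb; lra.
  have -> : p * x + b * y = (p * x + b * y - pi) + pi by rewrite subrK.
  rewrite cosDpi lerN2 /c; set z := _ - pi.
  have -> : sin d = cos (pi / 2 - d) by rewrite cosB cos_pihalf sin_pihalf mul0r add0r mul1r.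
  have zb : `|z| <= pi / 2 - d by rewrite ler_norml /z; apply/andP; split; lra.
  have -> : cos z = cos `|z| by have [] := ger0P z => // _; rewrite cosN.
  by apply: cos_nonincreasing => //; lra.
move=> x y xl yl; have [x_ge0|x_lt0] := leP 0 x.
  by apply: main => //; move: xl; rewrite ger0_norm.
have := main (- x) (- y); rewrite cosN.
have -> : p * - x + b * - y = - (p * x + b * y) by ring.
by rewrite cosN normrN; apply => //; move: xl; rewrite ltr0_norm //; lra.
Qed.

(** The left side is the argument of [1 - e^(it)]; half-angle formulas turn the quotient into a
    tangent. *)
Lemma sawtooth (t : R) : 0 < t < 2 * pi -> atan (- sin t / (1 - cos t)) = t / 2 - pi / 2.
Proof.
move=> /andP[t0 t2]; have s0 : 0 < sin (t / 2) by apply: sin_gt0_pi; rewrite divr_gt0 //=; lra.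
have -> : - sin t / (1 - cos t) = tan (t / 2 - pi / 2).
  rewrite /tan sinBpihalf cosBpihalf.
  have th : t = (t / 2) *+ 2 by rewrite mulr2n -splitr.
  have -> : sin t = sin (t / 2) * cos (t / 2) * 2.
    by rewrite {1}th sin_mulr2n [cos _ * _]mulrC mulr_natr.
  have -> : 1 - cos t = sin (t / 2) ^+ 2 * 2.
    by rewrite {1}th cos_mulr2n cos2sin2 mulr2n; move: (sin _) => s; ring.
  move: (sin (t / 2)) (cos (t / 2)) s0 => s e s0.
  by field; rewrite gt_eqF.
by rewrite tanK // in_itv /=; lra.
Qed.

End Trigonometry.

Section ZeroByPrimitive.
Variable R : realType.

(** The primitive of [d] extended by zero vanishes identically, and by Lebesgue differentiation its
    derivative is [d] almost everywhere. *)
Lemma ae_zero (d : R -> R) : tint d -> (forall x, 0 < x < 2 * pi -> I (d \_ `]-oo, x]) = 0) -> I d = 0 ->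
  aeT (fun t => d t = 0).
Proof.
move=> td H0 Hd; pose f := d \_ T.
have tf : leb.-integrable setT (EFin \o f).
  by rewrite /f -restrict_EFin; apply/integrable_restrict => //; rewrite setTI.
have loc : locally_integrable setT f by exact: integrable_locally.
have intf y : leb.-integrable `]-oo, y] (EFin \o f) by exact: (integrableS measurableT).
have F0 x : \int[leb]_(t in [set` `]-oo, x]]) f t = 0.
  have -> : \int[leb]_(t in [set` `]-oo, x]]) f t = I (d \_ `]-oo, x]).
    by rewrite -Rintegral_mkcondl -Rintegral_mkcondr.
  have [x0|x0] := leP x 0.
    have -> : I (d \_ `]-oo, x]) = I (fun=> 0).
      apply: I_ae; apply: aeT1 (aeT_interior R) => t _ /andP[t0 _].
      by rewrite patchE memNset //= in_itv /= => tx; move: (lt_le_trans t0 tx); rewrite ltNge x0.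
    by rewrite /Rintegral integral0.
  have [x2|x2] := ltP x (2 * pi); first by apply: H0; rewrite x0.
  rewrite -Hd; apply: I_ae; apply: aeTW => t; rewrite /Tdom /= in_itv /= => /andP[_ t2].
  by rewrite patchE mem_set //= in_itv /= (le_trans t2 x2).
have := FTC1Ny intf loc; apply: filterS => t [_].
have -> : (fun x => \int[leb]_(t0 in [set` `]-oo, x]]) f t0) = cst 0 by apply/funext => x; exact: F0.
by rewrite derive1_cst => h Tt; move: h; rewrite /f patchE mem_set // => <-.
Qed.

Lemma I_dct (f_ : nat -> R -> R) (f g : R -> R) : (forall n, measurable_fun T (f_ n)) -> measurable_fun T f ->
  aeT (fun t => f_ n t @[n --> \oo] --> f t) -> tint g -> (forall n t, T t -> `|f_ n t| <= g t) ->
  tint f /\ I (f_ n) @[n --> \oo] --> I f.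
Proof.
move=> mf_ mf cf tg fg.
have C1 : {ae leb, forall t, T t -> (EFin \o f_ n) t @[n --> \oo] --> (EFin \o f) t}.
  move: cf; rewrite /aeT; apply: filterS => t h Tt; apply: cvg_EFin; first exact: nearW.
  exact: h.
have C2 : {ae leb, forall t n, T t -> (`|(EFin \o f_ n) t| <= (EFin \o g) t)%E}.
  by apply: nearW => t n Tt; rewrite /= lee_fin fg.
have M1 n : measurable_fun T (EFin \o f_ n) by apply/measurable_EFinP; exact: mf_.
have M2 : measurable_fun T (EFin \o f) by apply/measurable_EFinP.
have [ti _ cv] := @dominated_convergence _ _ _ leb T mT (fun n => EFin \o f_ n) (EFin \o f) (EFin \o g) M1 M2 C1 tg C2.
split; first exact: ti.
by apply: fine_cvg; rewrite (EFin_I ti).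
Qed.

End ZeroByPrimitive.

(** * Test functions and the real part of the boundary values *)

Section TestFunctions.
Variable R : realType.
Local Notation C := (R[i]).
Variable alpha : R.
Implicit Types f k : R -> C.
Local Notation G t := (gT alpha t).

(** Continuity is asked for on the circle minus the point 1 only, which admits powers of [1 - z].
    Divided by [g_alpha], such functions lie in the Hardy space. *)
Definition testfun (q : C -> C) (B : R) := [/\ hol q, (forall z, cmod z < 1 -> cmod (q z) <= B) &
  forall t, 0 < t < 2 * pi -> contC q (expi t) /\ cmod (q (expi t)) <= B].

Lemma testfun_cst (c : C) : testfun (fun=> c) (cmod c).
Proof. by split => // [|t _]; [exact: hol_cst|split => //; exact: cvgC_cst]. Qed.

Lemma testfun_scale (c : C) q B : testfun q B -> testfun (fun z => c * q z) (cmod c * B).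
Proof.
move=> [hq bq cq]; split; first exact: hol_scale.
  by move=> z z1; rewrite cmodM ler_wpM2l ?cmod_ge0 // bq.
move=> t /cq[ct bt]; split; last by rewrite cmodM ler_wpM2l ?cmod_ge0.
by apply: contC_mul => //; exact: contC_cst.
Qed.

Lemma testfun_meas q B : testfun q B -> cmeasurable (fun t => q (expi t)).
Proof. by move=> [_ _ cq]; apply: cmeas_interior => t /cq[]. Qed.

Lemma testfun_radial q B : testfun q B -> aeT (fun t => radial_limit q t (q (expi t))).
Proof. by move=> [_ _ cq]; apply: aeT1 (aeT_interior R) => t _ /cq[/contC_radial]. Qed.

Lemma testfun_InH2 q B : testfun q B -> InH2 alpha (fun t => q (expi t) * gT (- alpha) t).
Proof. by move=> tq; have [hq bq _] := tq; apply: (H2rep_mk alpha hq bq (testfun_radial tq)). Qed.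

Lemma testfun_L2 q B : testfun q B -> InLp alpha 2 (fun t => q (expi t) * gT (- alpha) t).
Proof.
move=> tq; have mq := cmeas_mul (testfun_meas tq) (cmeas_gT (- alpha)); split; first exact: mq.
apply: (@le_lt_trans _ _ (E (fun=> B ^+ 2))); last first.
  by rewrite -(EFin_I (tint_cst (B ^+ 2))) ltry.
apply: ae_le_integral; [exact: wint_meas|exact: measurable_cst|by move=> t _; rewrite mulr_ge0 ?powR_ge0 // mu_ge0|].
apply: aeT1 (aeT_interior R) => t _ ti; have [_ _ /(_ t ti)[_ bt]] := tq.
rewrite muE // powR_mulrn ?cmod_ge0 // -exprMn -cmodM -mulrA [gT (- alpha) t * _]mulrC gTN mulr1.
by rewrite ler_pXn2r ?nnegrE ?cmod_ge0 // (le_trans (cmod_ge0 _) bt).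
Qed.

(** The weight is [G conj(G)], and [conj(G)] cancels against the conjugate of [1 / G]. *)
Lemma testfun_ip f q (t : R) : 0 < t < 2 * pi ->
  Re (f t * conjc (q (expi t) * gT (- alpha) t)) * mu alpha t = Re (G t * f t * conjc (q (expi t))).
Proof.
move=> ti; have -> : Re (f t * conjc (q (expi t) * gT (- alpha) t)) * mu alpha t =
    Re (f t * conjc (q (expi t) * gT (- alpha) t) * cR (mu alpha t)) by rewrite [RHS]ReM /= mulr0 subr0.
congr Re; rewrite muE // -mul_conjc conjcM.
have -> : f t * (conjc (q (expi t)) * conjc (gT (- alpha) t)) * (G t * conjc (G t)) =
  G t * f t * conjc (q (expi t)) * (conjc (gT alpha t * gT (- alpha) t)) by rewrite conjcM; ring.
by rewrite gTN conjc_one mulr1.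
Qed.

Lemma tint_ae (f g : R -> R) : measurable_fun T g -> aeT (fun t => f t = g t) -> tint f -> tint g.
Proof.
move=> mg fg tf; apply/integrableP; split; first exact/measurable_EFinP.
have /integrableP[_] := tf; rewrite (ae_integral (g := fun t => `|(EFin \o g) t|%E)) //.
by apply: aeT1 fg => t _ /= ->.
Qed.

Lemma testfun_tint f q B : InLp alpha 2 f -> testfun q B -> tint (fun t => Re (G t * f t * conjc (q (expi t)))).
Proof.
move=> lf tq; apply: (tint_ae _ _ (ip_tint lf (testfun_L2 tq))).
  by have [] := cmeas_mul (cmeas_mul (cmeas_gT alpha) lf.1) (cmeas_conj (testfun_meas tq)).
by apply: aeT1 (aeT_interior R) => t _ ti; rewrite testfun_ip.
Qed.

Lemma testfun_orth f k q B : isproj alpha f k -> testfun q B ->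
  I (fun t => Re (G t * f t * conjc (q (expi t)))) = I (fun t => Re (G t * k t * conjc (q (expi t)))).
Proof.
move=> pr tq; have := isproj_ip pr (testfun_InH2 tq) (testfun_L2 tq).
have e h : ip alpha h (fun t => q (expi t) * gT (- alpha) t) = I (fun t => Re (G t * h t * conjc (q (expi t)))).
  by apply: I_ae; apply: aeT1 (aeT_interior R) => t _ ti; rewrite testfun_ip.
by rewrite !e.
Qed.

Lemma testfun_szego (c : C) : cmod c < 1 -> testfun (fun z => (1 - c * z)^-1) (1 - cmod c)^-1.
Proof.
move=> c1; have c0 : 0 < 1 - cmod c by rewrite subr_gt0.
have bd z : cmod z <= 1 -> 1 - cmod c <= cmod (1 - c * z).
  move=> z1; apply: le_trans (cmodB_ge _ _); rewrite cmod1 cmodM lerD2l lerN2.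
  by rewrite ler_piMr ?cmod_ge0.
have bd' z : cmod z <= 1 -> cmod ((1 - c * z)^-1) <= (1 - cmod c)^-1.
  move=> z1; have := bd _ z1 => h; rewrite cmodV lef_pV2 ?posrE //.
  exact: lt_le_trans h.
split; first by apply: hol_szego; exact: ltW.
  by move=> z z1; apply: bd'; exact: ltW.
move=> t _; have e1 : cmod (expi t) <= 1 by rewrite cmod_expi.
split; last exact: bd'.
apply: contC_inv; first by rewrite -cmod_gt0; apply: lt_le_trans (bd _ e1).
apply: contC_add; first exact: contC_cst.
by apply: contC_opp; apply: contC_mul; [exact: contC_cst|exact: contC_id].
Qed.

Lemma testfun_log (c : C) : cmod c < 1 -> testfun (fun z => clog (1 - c * z)) (`|ln (1 - cmod c)| + `|ln 2| + pi / 2).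
Proof.
move=> c1; have c0 : 0 < 1 - cmod c by rewrite subr_gt0.
have bd z : cmod z <= 1 -> 1 - cmod c <= Re (1 - c * z).
  move=> z1; rewrite ReB Re1 lerD2l lerN2 (le_trans (ler_norm _)) // (le_trans (Re_le_cmod _)) // cmodM.
  by rewrite ler_piMr ?cmod_ge0.
have bd' z : cmod z <= 1 -> cmod (clog (1 - c * z)) <= `|ln (1 - cmod c)| + `|ln 2| + pi / 2.
  move=> z1; have h := bd _ z1; apply: (le_trans (cmod_le _)) => /=; apply: lerD; last exact/ltW/carg_bound.
  have l1 : 1 - cmod c <= cmod (1 - c * z) by rewrite (le_trans h) // (le_trans (ler_norm _)) // Re_le_cmod.
  have l2 : cmod (1 - c * z) <= 2.
    by apply: cmod_onem_le2; rewrite cmodM mulr_ile1 ?cmod_ge0 // ltW.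
  have lp : 0 < cmod (1 - c * z) by exact: lt_le_trans l1.
  have e1 : ln (1 - cmod c) <= ln (cmod (1 - c * z)) by rewrite ler_ln ?posrE.
  have e2 : ln (cmod (1 - c * z)) <= ln 2 by rewrite ler_ln ?posrE.
  have := ler_norm (ln 2 : R); have := ler_norm (- ln (1 - cmod c)); rewrite normrN => n1 n2.
  have n3 := normr_ge0 (ln 2 : R); have n4 := normr_ge0 (ln (1 - cmod c)).
  by rewrite ler_norml; apply/andP; split; lra.
have dd z : cmod z <= 1 -> exists l, derC (fun z => clog (1 - c * z)) z l.
  move=> z1; have d := derC_sub (derC_cst 1 z) (derC_mul (derC_cst c z) (derC_id z)).
  have p0 : 0 < Re (1 - c * z) by exact: lt_le_trans (bd _ z1).
  by eexists; exact: (derC_comp d (derC_clog p0)).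
split; first by move=> z z1; apply: dd; exact: ltW.
  by move=> z z1; apply: bd'; exact: ltW.
move=> t _; have e1 : cmod (expi t) <= 1 by rewrite cmod_expi.
by split; [have [l /derC_cont] := dd _ e1|exact: bd'].
Qed.

Section RealData.
Variables (f k : R -> C) (H : C -> C) (u : R -> R).
Hypotheses (pr : isproj alpha f k) (kH : H2rep alpha k H) (mu_ : measurable_fun T u).
Hypothesis fu : aeT (fun t => G t * f t = cR (u t)).

Let lf : InLp alpha 2 f. Proof. by case: pr. Qed.
Let lk : InLp alpha 2 k. Proof. exact: isproj_L2 pr. Qed.

Lemma tint_u : tint u.
Proof.
have := testfun_tint lf (testfun_cst 1); apply: tint_ae => //.
by apply: aeT1 fu => t _ ->; rewrite conjc_one mulr1.
Qed.

Lemma tint_v : tint (fun t => Re (G t * k t)).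
Proof. by have := testfun_tint lk (testfun_cst 1); under eq_fun do rewrite conjc_one mulr1. Qed.

Lemma I_u_v : I u = I (fun t => Re (G t * k t)).
Proof.
have := testfun_orth pr (testfun_cst 1).
under [in RHS]eq_Rintegral do rewrite conjc_one mulr1.
move=> <-; apply: I_ae; apply: aeT1 fu => t _ ->.
by rewrite conjc_one mulr1.
Qed.

(** Cauchy's formula pairs [k] with a Szego kernel over [g_alpha], a member of the Hardy space;
    orthogonality replaces [k] by [f], and [G f = u] is real. *)
Lemma H_real_part w : cmod w < 1 -> 2 * pi * Re (H w) = I (fun t => u t * Re (1 - conjc w * expi t)^-1).
Proof.
move=> w1; have cw : cmod (conjc w) < 1 by rewrite cmod_conj.
have [_ <-] := H2rep_cauchy kH w1.
rewrite -(testfun_orth pr (testfun_szego cw)); apply: I_ae; apply: aeT1 fu => t _ ->.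
by rewrite ReM /= mul0r subr0 Re_conj.
Qed.

Lemma H0_real : H 0 = cR (I u / (2 * pi)).
Proof.
have pi0 : 2 * pi != 0 :> R by rewrite gt_eqF // mulr_gt0 ?pi_gt0.
apply: cmplx_eq => /=.
  apply: (mulfI pi0); rewrite H_real_part ?cmod0 // mulrCA mulfV // mulr1.
  congr Rintegral; apply/funext => t.
  have -> : conjc (0 : C) = 0 by apply: cmplx_eq; rewrite /= ?oppr0.
  by rewrite mul0r subr0 invr1 mulr1.
(* Testing with the constant [i] gives the imaginary part of [H 0], which vanishes because [u] is
   real. *)
pose q := fun _ : C => Complex 0 1 : C.
have tq : testfun q (cmod (Complex 0 1 : C)) by exact: testfun_cst.
pose q' := fun _ : C => conjc (Complex 0 1) : C.
have tq' : testfun q' (cmod (conjc (Complex 0 1) : C)) by exact: testfun_cst.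
have [hq bq _] := tq'.
have [_] := H2rep_pair kH hq bq (testfun_meas tq') (testfun_radial tq').
have := testfun_orth pr tq; rewrite /q /q' => <-.
rewrite (I_ae (g := fun=> 0)); last first.
  by apply: aeT1 fu => t _ ->; rewrite ReM /= mul0r mulr0 subrr.
rewrite /Rintegral integral0 ReM /= mulr0 sub0r mulrN1 opprK => /esym/eqP.
by rewrite mulf_eq0 (negbTE pi0) => /eqP.
Qed.

Let d t := u t - 2 * Re (G t * k t).

Let tint_d : tint d.
Proof. by apply: tintB; [exact: tint_u|apply: tintZ; exact: tint_v]. Qed.

(* [Im log(1 - c e^(it))] integrates [2 Re (G k) - u] to zero; as [c] tends to the circle it becomes a sawtooth with one jump, and differences of sawtooths are indicators of intervals up to affine functions. *)
Let log_pairing (c : C) : cmod c < 1 -> I (fun t => Im (clog (1 - c * expi t)) * d t) = 0.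
Proof.
move=> c1; set q := fun z => clog (1 - c * z); pose iq z := Complex 0 1 * q z.
have tq := testfun_log c1; have tiq : testfun iq _ := testfun_scale (Complex 0 1) tq.
have [hq bq _] := tiq.
have [ti2 e2] := H2rep_pair kH hq bq (testfun_meas tiq) (testfun_radial tiq).
have q0 : iq 0 = 0 by rewrite /iq /q mulr0 subr0 /clog cmod1 ln1 /= mul0r atan0 mulr0.
rewrite q0 mulr0 /= mulr0 in e2.
have e1 := testfun_orth pr tiq.
have tf := testfun_tint lf tiq; have tk := testfun_tint lk tiq.
(* Orthogonality cancels the first two pairings and [iq 0 = 0] kills the third. As [G f = u] is
   real, the three integrands add up to [- Im q * d]. *)
have : I (fun t => Re (G t * f t * conjc (iq (expi t))) - Re (G t * k t * conjc (iq (expi t))) - Re (G t * k t * iq (expi t))) = 0.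
  rewrite (I_B (tintB tf tk) ti2) (I_B tf tk) e1 e2.
  by rewrite subrr subr0.
have -> : I (fun t => Re (G t * f t * conjc (iq (expi t))) - Re (G t * k t * conjc (iq (expi t))) - Re (G t * k t * iq (expi t)))
   = I (fun t => -1 * (Im (q (expi t)) * d t)).
  apply: I_ae; apply: aeT1 fu => t _ ->; rewrite /iq /d.
  by move: (G t * k t) (q (expi t)) => a b; rewrite !ReImE /=; ring.
have mb : measurable_fun T (fun t => Im (q (expi t))) by have [] := testfun_meas tq.
have tb : tint (fun t => Im (q (expi t)) * d t).
  apply: (tint_le _ _ (tintZ (pi / 2) (tint_norm tint_d))).
    by apply: measurable_funM => //; exact: tint_meas tint_d.
  move=> t _; rewrite normrM; apply: ler_wpM2r => //.
  exact/ltW/carg_bound.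
by rewrite (I_Z tb) mulN1r => /eqP; rewrite oppr_eq0 => /eqP.
Qed.

(** The argument of [1 - e^(i (t - x))]. *)
Let saw x t : R := atan (- sin (t - x) / (1 - cos (t - x))).

(** Let the parameter of the logarithm tend radially to [e^(-ix)]: arguments stay below [pi / 2], so
    [|d|] provides an integrable majorant. *)
Let saw_pairing x : 0 <= x < 2 * pi -> tint (fun t => saw x t * d t) /\ I (fun t => saw x t * d t) = 0.
Proof.
move=> /andP[x0 x2].
pose c n : C := cR (rn R n) * expi (- x).
have c1 n : cmod (c n) < 1 by exact: rn_disc.
have ce n t : 1 - c n * expi t = 1 - cR (rn R n) * expi (t - x).
  by rewrite /c -mulrA -expiD [- x + t]addrC.
have cosne : aeT (fun t => cos (t - x) < 1).
  have ax : aeT (fun t => t != x).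
    exists [set x]; split; [exact: measurable_set1|exact: lebesgue_measure_set1|].
    by move=> t /= /not_implyP[_] /negP; rewrite negbK => /eqP.
  apply: (aeT2 _ (aeT_interior R) ax) => t _ /andP[t0 t2] tx.
  have [h|h] := ltP x t; first by apply: cos_lt1_interior; lra.
  have -> : cos (t - x) = cos (t - x + 2 * pi) by rewrite mulr_natl cosD2pi.
  have h' : t < x by rewrite lt_neqAle tx.
  by apply: cos_lt1_interior; lra.
have mf_ n : measurable_fun T (fun t => Im (clog (1 - c n * expi t)) * d t).
  apply: measurable_funM; last exact: tint_meas tint_d.
  by have [] := testfun_meas (testfun_log (c1 n)).
have cv : aeT (fun t => Im (clog (1 - c n * expi t)) * d t @[n --> \oo] --> saw x t * d t).
  apply: aeT1 cosne => t _ ct; apply: cvgM; last exact: cvg_cst.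
  have cc : cvgC \oo (fun n => 1 - c n * expi t) (1 - expi (t - x)).
    under eq_fun do rewrite ce.
    by apply: cvgC_sub; [exact: cvgC_cst|exact: cvg_radius].
  have re0 : 0 < Re (1 - expi (t - x) : C) by rewrite ReB /= subr_gt0.
  have [_ +] := cvgC_comp cc (contC_clog re0).
  by rewrite /saw /= ?ImB ?ReB /= ?sub0r ?add0r.
have msaw : measurable_fun T (fun t => saw x t * d t).
  apply: measurable_funM; last exact: tint_meas tint_d.
  apply: (measurableT_comp (continuous_measurable_fun (fun y : R => @continuous_atan R y))).
  have ms : measurable_fun T (fun t : R => sin (t - x)).
    by apply: measT_cont => t; apply: (cvg_comp (fun t : R => t - x) (@sin R)); [apply: cvgB; [exact: cvg_id|exact: cvg_cst]|exact: continuous_sin].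
  have mc : measurable_fun T (fun t : R => cos (t - x)).
    by apply: measT_cont => t; apply: (cvg_comp (fun t : R => t - x) (@cos R)); [apply: cvgB; [exact: cvg_id|exact: cvg_cst]|exact: continuous_cos].
  (* The quotient is rewritten as a power so that measurability of [powR] applies. *)
  have -> : (fun t => - sin (t - x) / (1 - cos (t - x))) = (fun t => - sin (t - x) * (1 - cos (t - x)) `^ (-1)).
    by apply/funext => t; rewrite powR_inv1 // subr_ge0 cos_le1.
  apply: measurable_funM; first exact: measurableT_comp.
  by apply: meas_powR; apply: measurable_funB.
have bnd n t : T t -> `|Im (clog (1 - c n * expi t)) * d t| <= pi / 2 * `|d t|.
  by move=> _; rewrite normrM; apply: ler_wpM2r => //; exact/ltW/carg_bound.
have [ti cvI] := I_dct mf_ msaw cv (tintZ (pi / 2) (tint_norm tint_d)) bnd.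
split; first exact: ti.
apply: (cvg_unique _ cvI) => //.
apply: (@cvg_trans _ ((fun=> 0) @ \oo)); last exact: cvg_cst.
by apply: near_eq_cvg; apply: nearW => n; rewrite log_pairing.
Qed.

(** For almost every [t] the indicator of [t <= x] equals [(saw x t - t / 2 + (x + pi) / 2) / pi]:
    the sawtooth jumps by [pi] at [x] and has slope [1 / 2] elsewhere. *)
Let d_below x : 0 <= x < 2 * pi -> I (d \_ `]-oo, x]) =
  (x / 2 + pi / 2) / pi * I d - pi^-1 * I (fun t => t / 2 * d t).
Proof.
move=> x02; have [ti e0] := saw_pairing x02; have [x0 x2] := andP x02.
have pi0 := pi_gt0 R; have pn0 : (pi : R) != 0 by rewrite gt_eqF.
have tt : tint (fun t => t / 2 * d t).
  apply: (tint_le _ _ (tintZ pi (tint_norm tint_d))).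
    by apply: measurable_funM; [exact: measurable_funM|exact: tint_meas tint_d].
  move=> t; rewrite /Tdom /= in_itv /= => /andP[t0 t2]; rewrite normrM; apply: ler_wpM2r => //.
  by rewrite ger0_norm; lra.
have tx := tintZ (x / 2 + pi / 2) tint_d.
have e : I (d \_ `]-oo, x]) = I (fun t => pi^-1 * (saw x t * d t - (t / 2 * d t - (x / 2 + pi / 2) * d t))).
  have ax : aeT (fun t => t != x).
    exists [set x]; split; [exact: measurable_set1|exact: lebesgue_measure_set1|].
    by move=> t /= /not_implyP[_] /negP; rewrite negbK => /eqP.
  apply: I_ae; apply: (aeT2 _ (aeT_interior R) ax) => t _ /andP[t0 t2] tx'.
  rewrite patchE; have [h|h] := ltP x t.
    rewrite memNset /=; last by rewrite in_itv /= => h'; move: h; rewrite ltNge h'.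
    rewrite /saw sawtooth; last lra.
    have -> : (t - x) / 2 - pi / 2 = t / 2 - (x / 2 + pi / 2) :> R by move: (pi : R) => q; field.
    by rewrite -mulrBl subrr mulr0.
  rewrite mem_set /=; last by rewrite in_itv.
  have h' : t < x by rewrite lt_neqAle tx'.
  have -> : saw x t = (t - x + 2 * pi) / 2 - pi / 2.
    by rewrite -sawtooth /saw ?mulr_natl ?cosD2pi ?sinD2pi // -mulr_natl; lra.
  have -> : (t - x + 2 * pi) / 2 - pi / 2 = t / 2 - (x / 2 + pi / 2) + pi by move: (pi : R) => q; field.
  by rewrite -!mulrBl addrAC subrr add0r mulKf.
rewrite e (I_Z (tintB ti (tintB tt tx))).
rewrite (I_B ti (tintB tt tx)) e0 (I_B tt tx).
by rewrite (I_Z tint_d); move: (I d) (I _) => a b; move: (pi : R) pn0 => q q0; field.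
Qed.

(** The primitive of [d] is linear, so [d] is almost everywhere its mean, and that mean is
    [- I u / (2 pi)] because [u] and [Re (G k)] have the same integral. *)
Lemma boundary_real_part : aeT (fun t => 2 * Re (G t * k t) = u t + I u / (2 * pi)).
Proof.
have pi0 := pi_gt0 R; have pn0 : (pi : R) != 0 by rewrite gt_eqF.
have Id : I d = - I u.
  rewrite /d (I_B tint_u (tintZ 2 tint_v)).
  by rewrite (I_Z tint_v) -I_u_v; ring.
have zero0 : I (d \_ `]-oo, 0]) = 0.
  have -> : I (d \_ `]-oo, 0]) = I (fun=> 0).
    apply: I_ae; apply: aeT1 (aeT_interior R) => t _ /andP[t0 _].
    by rewrite patchE memNset //= in_itv /= => tx; move: (lt_le_trans t0 tx); rewrite ltxx.
  by rewrite /Rintegral integral0.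
have below x : 0 <= x < 2 * pi -> I (d \_ `]-oo, x]) = x / (2 * pi) * I d.
  (* At [x = 0] the left side vanishes, which determines the first moment of [d]. *)
  move=> x02; have := @d_below 0; rewrite lexx mulr_gt0 // zero0 => /(_ isT) h.
  rewrite (d_below x02).
  have -> : pi^-1 * I (fun t => t / 2 * d t) = (0 / 2 + pi / 2) / pi * I d by lra.
  by move: (I d) => a; move: (pi : R) pn0 => q q0; field.
pose kap := I d / (2 * pi).
have tk := tint_cst kap.
have rest x (h : R -> R) : tint h -> tint (h \_ `]-oo, x]).
  move=> th; apply: (tint_le _ _ (tint_norm th)).
    apply/measurable_EFinP; rewrite -restrict_EFin; apply/measurable_restrict => //; rewrite ?setIid.
    apply: measurable_funS (measurable_int _ th) => //; exact: subIsetl.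
  by move=> t _; rewrite patchE; case: ifPn => // _; rewrite normr0.
have z : aeT (fun t => d t - kap = 0).
  apply: (ae_zero (tintB tint_d tk)).
    move=> x /andP[x0 x2].
    have -> : (fun t => d t - kap) \_ `]-oo, x] = (fun t => (d \_ `]-oo, x]) t - ((fun=> kap) \_ `]-oo, x]) t).
      by apply/funext => t; rewrite !patchE; case: ifP => // _; rewrite subrr.
    rewrite (I_B (rest x _ tint_d) (rest x _ tk)) below ?(ltW x0) //.
    have -> : I ((fun=> kap) \_ `]-oo, x]) = kap * x.
      rewrite -Rintegral_mkcondr.
      have -> : T `&` `]-oo, x] = `[0, x]%classic.
        apply/seteqP; split => t; rewrite /Tdom /= !in_itv /=.
          by move=> [/andP[-> _] ->].
        by move=> /andP[-> tx]; split => //; rewrite (le_trans tx) // ltW.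
      rewrite Rintegral_cst //=; rewrite lebesgue_measure_itv /= lte_fin x0 /= subr0 //.
    by rewrite /kap; move: (I d) => a; move: (pi : R) pn0 => q q0; field.
  rewrite (I_B tint_d tk) Rintegral_cst //=.
  by rewrite lebesgue_Tdom /= /kap divfK ?subrr // gt_eqF // mulr_gt0.
apply: aeT1 z => t _ /eqP; rewrite subr_eq0 /kap Id /d => /eqP.
have -> : - I u / (2 * pi) = - (I u / (2 * pi)) by rewrite mulNr.
by lra.
Qed.

End RealData.
End TestFunctions.

(** * The estimate for nonnegative data *)

Section PositiveData.
Variable R : realType.
Local Notation C := (R[i]).
Local Notation circ n t := (cR (rn R n) * expi t).

Lemma I_eq0 (u : R -> R) : tint u -> (forall t, T t -> 0 <= u t) -> I u = 0 -> aeT (fun t => u t = 0).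
Proof.
move=> tu u0 Iu; have mI := measurable_int _ tu.
have h0 : (\int[leb]_(t in T) `|(EFin \o u) t| = 0)%E.
  transitivity (E u); last by rewrite -(EFin_I tu) Iu.
  by apply: eq_integral => t /set_mem Tt; rewrite /= (ger0_norm (u0 t Tt)).
have /(ae_eq_integral_abs leb mT mI).1 ae0 := h0.
by move: ae0; rewrite /ae_eq /aeT; apply: filterS => t h Tt; have [] := h Tt.
Qed.

Lemma I_le_ae (f g : R -> R) : tint f -> tint g -> aeT (fun t => f t <= g t) -> I f <= I g.
Proof.
move=> tf tg fg; have e : aeT (fun t => f t = Num.min (f t) (g t)) by apply: aeT1 fg => t _ h; rewrite min_l.
have mm : measurable_fun T (fun t => Num.min (f t) (g t)).
  by apply: measurable_minr; [exact: tint_meas tf|exact: tint_meas tg].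
have tm := tint_ae mm e tf.
rewrite (I_ae e); apply: (I_le tm tg) => t _.
by rewrite ge_min lexx orbT.
Qed.

Lemma cvg_powR_nneg (f : nat -> R) (a s : R) : 0 <= s -> (forall x, 0 <= f x) ->
  f x @[x --> \oo] --> a -> f x `^ s @[x --> \oo] --> a `^ s.
Proof.
rewrite le_eqVlt => /orP[/eqP <-|s0] f0 fa; last exact: cvg_powR_ge0.
by under eq_fun do rewrite powRr0; rewrite powRr0; exact: cvg_cst.
Qed.

(* [Re (1 - z)^(-c)] is harmonic with value [1] at [0] and comparable to [|1 - z|^(-c)]. *)
Lemma tint_singular (c : R) : 0 <= c -> c < 1 -> tint (fun t => cmod (1 - expi t) `^ (- c)).
Proof.
move=> c0 c1; have pi0 := pi_gt0 R.
(* As [|arg (1 - z)| < pi / 2], this constant bounds the cosine of the argument of [(1 - z)^(-c)]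
   from below; it is positive because [c < 1]. *)
have k0 : 0 < cos (c * (pi / 2)).
  apply: cos_gt0_pihalf; apply/andP; split.
    by apply: (@lt_le_trans _ _ 0); [rewrite oppr_lt0 divr_gt0|rewrite mulr_ge0 // divr_ge0 // ltW].
  by rewrite gtr_pMl ?divr_gt0.
set kap := cos _ in k0.
have mc : cmeasurable (fun t => 1 - expi t : C).
  by apply: cmeas_add; [split; exact: measurable_cst|apply: cmeas_opp; exact: cmeas_expi].
have mf : measurable_fun T (fun t => cmod (1 - expi t) `^ (- c)) by apply: meas_powR; exact: meas_cmod.
have p0 t : T t -> 0 <= cmod (1 - expi t) `^ (- c) by move=> _; exact: powR_ge0.
have holg : hol (gz (- c) : C -> C) by exact: gz_hol.
pose h n t := cmod (1 - circ n t) `^ (- c).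
have hE n t : h n t = cmod (gz (- c) (circ n t)) by rewrite /gz cmod_cpow // Re_onem_gt0 // rn_disc.
have mh n : measurable_fun T (h n).
  have -> : h n = (fun t => cmod (gz (- c) (circ n t))) by apply/funext => t; exact: hE.
  by apply: meas_cmod; exact: meas_circle.
have tg n : tint (fun t => Re (gz (- c) (circ n t))).
  apply: tint_cont => t; have hr : 0 <= rn R n < 1 by rewrite ltW ?rn_gt0 //= rn_lt1.
  by have [] := cont_circle holg hr t.
have pw n t : h n t * kap <= Re (gz (- c) (circ n t)).
  have re0 := Re_onem_gt0 (rn_disc n t).
  rewrite /gz cpowE // ReM /= mul0r subr0 -/(h n t) ler_wpM2l ?powR_ge0 // mulNr cosN.
  have -> : cos (c * carg (1 - circ n t)) = cos `|c * carg (1 - circ n t)|.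
    by have [] := ger0P (c * carg (1 - circ n t)) => // _; rewrite cosN.
  have := carg_bound (1 - circ n t) => /ltW cb.
  have cb' : c * (pi / 2) <= pi by rewrite -[leRHS]mul1r ler_pM ?divr_ge0 ?(ltW pi0) ?(ltW c1) //; lra.
  by rewrite cos_nonincreasing // normrM (ger0_norm c0) ler_wpM2l.
have bn n : (E (h n) <= (2 * pi / kap)%:E)%E.
  have th : tint (h n).
    apply: (tint_le (mh n) _ (tintZ kap^-1 (tg n))) => t _.
    by rewrite ger0_norm ?powR_ge0 // mulrC ler_pdivlMr // pw.
  rewrite -(EFin_I th) lee_fin ler_pdivlMr // mulrC -(I_Z th).
  have -> : 2 * pi = I (fun t => Re (gz (- c) (circ n t))).
    have := mean_value holg (rho := rn R n); rewrite rn_gt0 rn_lt1 gz0 mulr1 => /(_ isT) <- //.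
  apply: (I_le (tintZ kap th) (tg n)) => t _.
  by rewrite mulrC pw.
apply: (tint_fin p0 mf); apply: (@le_lt_trans _ _ (2 * pi / kap)%:E); last exact: ltry.
apply: (fatouT mh); last exact: bn.
  by move=> n t _; exact: powR_ge0.
apply: aeT1 (aeT_interior R) => t _ ti.
have lim : cmod (gz (- c) (circ n t)) @[n --> \oo] --> cmod (gz (- c) (expi t)).
  apply: cvgC_cmod; apply: cvgC_comp; [exact: cvg_radius|exact: gz_cont].
under eq_fun do rewrite hE.
by have := cmod_gT (- c) ti; rewrite /gT => <-.
Qed.

Variable alpha : R.
Hypothesis alpha0 : 0 <= alpha.
Local Notation G t := (gT alpha t).
Variable p : R.
Hypotheses (p1 : 1 < p) (p2 : p < 2).
Local Notation b := (alpha * (2 - p)).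
Hypothesis bp : b < p - 1.

Let pp : 0 < p. Proof. by rewrite (lt_trans _ p1). Qed.
Let b0 : 0 <= b. Proof. by rewrite mulr_ge0 // subr_ge0 ltW. Qed.

Local Notation w t := (cmod (1 - expi t) `^ b).

Lemma meas_onem : cmeasurable (fun t => 1 - expi t : C).
Proof. by apply: cmeas_add; [split; exact: measurable_cst|apply: cmeas_opp; exact: cmeas_expi]. Qed.

Lemma meas_weight : measurable_fun T (fun t => w t).
Proof. by apply: meas_powR; exact: (meas_cmod meas_onem). Qed.

Lemma weight_le t : w t <= 2 `^ b.
Proof. by rewrite ge0_ler_powR ?nnegrE ?cmod_ge0 // cmod_onem_le2 // cmod_expi. Qed.

Lemma cmod_onem_gt0 t : 0 < t < 2 * pi -> 0 < cmod (1 - expi t : C).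
Proof. by move=> /Re_onem_expi_gt0; exact: Re_gt0_cmod. Qed.

(** The exponents add up: [alpha p + alpha (2 - p) = 2 alpha]. *)
Lemma weight_split (z : C) t : 0 < t < 2 * pi -> cmod (G t * z) `^ p * w t = cmod z `^ p * mu alpha t.
Proof.
move=> ti; have r0 := cmod_onem_gt0 ti.
rewrite cmodM (powRM _ (cmod_ge0 _) (cmod_ge0 _)) (cmod_gT _ ti) /mu [cmod (expi t - 1)]cmodBC.
move: (cmod (1 - expi t)) (cmod z `^ p) r0 => r x r0.
rewrite -powRrM mulrAC -powRD; last by apply/implyP => _; rewrite gt_eqF.
by rewrite mulrC; congr (_ * _ `^ _); ring.
Qed.

(* Young's inequality [u <= l^p u^p w + l^(-p') w^(-p'/p)] at the optimal [l]. *)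
Lemma mean_bound : exists2 D : R, 0 <= D & forall u : R -> R, measurable_fun T u -> tint u ->
  (forall t, T t -> 0 <= u t) -> tint (fun t => u t `^ p * w t) ->
  (I u / (2 * pi)) `^ p <= D * I (fun t => u t `^ p * w t).
Proof.
have pi0 := pi_gt0 R; have q0 : 0 < p - 1 by rewrite subr_gt0.
(* The exponent of the dual weight; [c < 1] is precisely [b < p - 1], which makes [|1 - z|^(-c)]
   integrable. *)
pose c := b / (p - 1).
have c0 : 0 <= c by rewrite divr_ge0 // ltW.
have c1 : c < 1 by rewrite ltr_pdivrMr // mul1r.
have ts := tint_singular c0 c1.
pose B := I (fun t => cmod (1 - expi t) `^ (- c)) + 1.
have B0 : 0 < B by rewrite ltr_wpDl // Rintegral_ge0 // => t _; exact: powR_ge0.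
exists (B `^ (p - 1) / pi `^ p); first by rewrite divr_ge0 ?powR_ge0.
move=> u mu_ tu u0 tA; set A := I (fun t => u t `^ p * w t).
have Iu0 : 0 <= I u by exact: Rintegral_ge0.
have A0 : 0 <= A by apply: Rintegral_ge0 => t _; rewrite mulr_ge0 ?powR_ge0.
have [Iu|Iu] := eqVneq (I u) 0.
  by rewrite Iu mul0r powR0 ?gt_eqF // mulr_ge0 // divr_ge0 ?powR_ge0.
have Iup : 0 < I u by rewrite lt_neqAle eq_sym Iu.
pose m := I u / (2 * pi).
have m0 : 0 < m by rewrite divr_gt0 // mulr_gt0.
have pm0 : 0 < pi * m by rewrite mulr_gt0.
pose q := p / (p - 1).
have qq : 0 < q by rewrite divr_gt0.
have pq : p^-1 + q^-1 = 1 by rewrite /q invf_div; field; rewrite gt_eqF.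
(* With this choice the second Young term integrates to at most [pi m], half of [I u], and is
   absorbed on the left. *)
pose l := (B / (pi * m)) `^ q^-1.
have l0 : 0 < l by rewrite powR_gt0 // divr_gt0.
have lq : l `^ (- q) = pi * m / B.
  by rewrite powRN /l -powRrM mulVf ?gt_eqF // powRr1 ?invf_div // ltW // divr_gt0.
have lp : l `^ p = (B / (pi * m)) `^ (p - 1).
  by rewrite /l -powRrM; congr (_ `^ _); rewrite /q invf_div divfK // gt_eqF.
have dle (x y : R) : 0 <= x -> 1 <= y -> x / y <= x.
  by move=> x0 y1; rewrite ler_pdivrMr ?(lt_le_trans ltr01) // ler_peMr.
have young : aeT (fun t => u t <= l `^ p * (u t `^ p * w t) + l `^ (- q) * cmod (1 - expi t) `^ (- c)).
  apply: aeT1 (aeT_interior R) => t Tt ti; have r0 := cmod_onem_gt0 ti.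
  set r := cmod _ in r0 *; have ut := u0 t Tt.
  have x0 : 0 <= l * u t * r `^ (b / p) by rewrite !mulr_ge0 ?powR_ge0 // ltW.
  have y0 : 0 <= l^-1 * r `^ (- (b / p)) by rewrite mulr_ge0 ?powR_ge0 // invr_ge0 ltW.
  have := conjugate_powR x0 y0 pp qq pq.
  have -> : l * u t * r `^ (b / p) * (l^-1 * r `^ (- (b / p))) = u t.
    rewrite powRN; have : r `^ (b / p) != 0 by rewrite gt_eqF // powR_gt0.
    by move: (r `^ (b / p)) => s s0; field; rewrite s0 gt_eqF.
  have -> : (l * u t * r `^ (b / p)) `^ p = l `^ p * (u t `^ p * r `^ b).
    rewrite powRM ?powR_ge0 ?mulr_ge0 ?(ltW l0) // powRM ?(ltW l0) // -powRrM divfK ?mulrA //.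
    by rewrite gt_eqF.
  have -> : (l^-1 * r `^ (- (b / p))) `^ q = l `^ (- q) * r `^ (- c).
    rewrite powRM ?powR_ge0 ?invr_ge0 ?(ltW l0) // -powRrM -powR_inv1 ?(ltW l0) // -powRrM mulN1r.
    congr (_ * _ `^ _); rewrite /q /c mulNr; congr (- _).
    by field; rewrite !gt_eqF.
  move=> /le_trans; apply; apply: lerD.
    apply: dle; last exact: ltW.
    by apply: mulr_ge0; [exact: powR_ge0|apply: mulr_ge0; exact: powR_ge0].
  apply: dle; first by apply: mulr_ge0; exact: powR_ge0.
  by rewrite /q ler_pdivlMr // mul1r gerBl.
have h : I u <= l `^ p * A + l `^ (- q) * (B - 1).
  have := I_le_ae tu (tintD (tintZ (l `^ p) tA) (tintZ (l `^ (- q)) ts)) young.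
  rewrite (I_D (tintZ (l `^ p) tA) (tintZ (l `^ (- q)) ts)).
  rewrite (I_Z tA) (I_Z ts).
  by rewrite /B addrK.
have e1 : I u = 2 * (pi * m) by rewrite mulrA mulrC /m divfK // gt_eqF // mulr_gt0.
have h2 : pi * m <= (B / (pi * m)) `^ (p - 1) * A.
  have : l `^ (- q) * (B - 1) <= pi * m.
    rewrite lq mulrAC ler_pdivrMr // ler_wpM2l ?(ltW pm0) //; lra.
  by move: h; rewrite lp e1; lra.
have e2 : (pi * m) `^ p = pi * m * (pi * m) `^ (p - 1).
  by rewrite -{2}(powRr1 (ltW pm0)) -powRD ?subrKC //; apply/implyP => _; rewrite gt_eqF.
have h3 : (pi * m) `^ p <= B `^ (p - 1) * A.
  rewrite e2; have s0 : 0 < (pi * m) `^ (p - 1) by rewrite powR_gt0.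
  apply: (@le_trans _ _ ((B / (pi * m)) `^ (p - 1) * A * (pi * m) `^ (p - 1))).
    by rewrite ler_wpM2r // ltW.
  rewrite mulrAC -powRM ?(ltW pm0) ?divr_ge0 ?(ltW B0) ?(ltW pm0) //.
  by rewrite divfK // gt_eqF.
move: h3; rewrite powRM ?(ltW pi0) ?(ltW m0) // -/m.
by rewrite mulrAC ler_pdivlMr ?powR_gt0 // mulrC.
Qed.

End PositiveData.

Section PositiveEstimate.
Variable R : realType.
Local Notation C := (R[i]).
Local Notation circ n t := (cR (rn R n) * expi t).
Variable alpha : R.
Hypothesis alpha0 : 0 <= alpha.
Local Notation G t := (gT alpha t).
Variable p : R.
Hypotheses (p1 : 1 < p) (p2 : p < 2).
Local Notation b := (alpha * (2 - p)).
Hypothesis bp : b < p - 1.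
Local Notation w t := (cmod (1 - expi t) `^ b).
Local Notation wn n t := (cmod (1 - circ n t) `^ b).

Let pp : 0 < p. Proof. by rewrite (lt_trans _ p1). Qed.
Let b0 : 0 <= b. Proof. by rewrite mulr_ge0 // subr_ge0 ltW. Qed.

(** The map [1 / (1 - z)] sends the disc into the half-plane [Re > 1 / 2]; equivalently the Poisson
    kernel [2 Re (1 - z)^-1 - 1] is positive. *)
Lemma Re_inv_ge (z : C) : cmod z < 1 -> 2^-1 <= Re (1 - z)^-1.
Proof.
move=> z1; have r0 := Re_onem_gt0 z1.
rewrite ReV -cmod_sqr ler_pdivlMr ?exprn_gt0 ?Re_gt0_cmod // cmod_sqr.
have : Re z ^+ 2 + Im z ^+ 2 <= 1 by rewrite -cmod_sqr expr_le1 ?cmod_ge0 // ltW.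
by rewrite ReB ImB /= sub0r; nra.
Qed.

Lemma Re_eq_cos_carg (z : C) : 0 < Re z -> Re z = cmod z * cos (carg z).
Proof. by move=> z0; rewrite -{1}(expi_arg z0) ReM /= mul0r subr0. Qed.

Section Fixed.
Variables (f k : R -> C) (H : C -> C) (u : R -> R).
Hypotheses (pr : isproj alpha f k) (kH : H2rep alpha k H) (mu_ : measurable_fun T u).
Hypotheses (u0 : forall t, T t -> 0 <= u t) (fu : aeT (fun t => G t * f t = cR (u t))).
Hypothesis Iu : 0 < I u.

Let tu : tint u. Proof. exact: (tint_u pr mu_ fu). Qed.

(** By [H_real_part] and [Re_inv_ge], [2 pi Re (H z)] is at least half of [I u]. This keeps [H] in
    the domain of the principal power. *)
Let ReH_gt0 z : cmod z < 1 -> 0 < Re (H z).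
Proof.
move=> z1; have pi0 := pi_gt0 R.
have p20 : 0 < 2 * pi :> R by rewrite mulr_gt0.
rewrite -(pmulr_rgt0 _ p20) (H_real_part pr kH fu z1).
have cz : cmod (conjc z) < 1 by rewrite cmod_conj.
have dt t : cmod (conjc z * expi t) < 1 by rewrite cmodM cmod_expi mulr1.
have [_ _ bq] := testfun_szego cz.
have mk : measurable_fun T (fun t => Re (1 - conjc z * expi t)^-1) by have [] := testfun_meas (testfun_szego cz).
have tk : tint (fun t => u t * Re (1 - conjc z * expi t)^-1).
  have mm : measurable_fun T (fun t => u t * Re (1 - conjc z * expi t)^-1) by exact: measurable_funM.
  apply: (tint_le mm _ (tintZ (1 - cmod (conjc z))^-1 tu)) => t Tt.
  rewrite normrM mulrC (ger0_norm (u0 Tt)); apply: ler_wpM2r; first exact: u0.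
  apply: (le_trans (Re_le_cmod _)); rewrite cmodV lef_pV2 ?posrE ?subr_gt0 //.
    by rewrite -{1}(cmod1 R) (le_trans _ (cmodB_ge _ _)) // cmodM cmod_expi mulr1.
  by rewrite cmod_gt0 onem_neq0.
apply: (@lt_le_trans _ _ (2^-1 * I u)); first by rewrite mulr_gt0 // invr_gt0.
rewrite -(I_Z tu).
apply: (I_le (tintZ 2^-1 tu) tk) => t Tt.
by rewrite mulrC; apply: ler_wpM2l; [exact: u0|exact: Re_inv_ge].
Qed.

Let hH : hol H. Proof. by case: kH. Qed.

(* The mean of [Re Psi] is nonnegative, while [cos_combination] bounds [Re Psi] by a multiple of [(Re H)^p |1 - z|^b] minus one of [|H|^p |1 - z|^b]. *)
Let Psi (z : C) : C := cpow (H z) p * gz b z.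

Let holPsi : hol Psi.
Proof.
apply: hol_mul; last exact: gz_hol.
apply: (hol_comp hH (G := fun w => cpow w p)) => z z1; eexists; exact: (derC_cpow p (ReH_gt0 z1)).
Qed.

(** The mean is [Re (Psi 0)], and [H 0] is a positive real, so its principal power is positive
    too. *)
Let Psi_mean n : 0 <= I (fun t => Re (Psi (circ n t))).
Proof.
have := mean_value holPsi (rho := rn R n); rewrite rn_gt0 rn_lt1 => /(_ isT).
rewrite /Jint -/(@Tdom R) => ->.
have z1 : cmod (0 : C) < 1 by rewrite cmod0.
rewrite mulr_ge0 ?mulr_ge0 ?pi_ge0 // /Psi gz0 mulr1 cpowE ?ReH_gt0 //.
rewrite (H0_real pr kH fu) /carg /= mul0r atan0 mulr0 cos0 mul0r subr0 mulr1.
exact: powR_ge0.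
Qed.

Let meas_H n : cmeasurable (fun t => H (circ n t)). Proof. exact: meas_circle. Qed.

Let meas_wn n : measurable_fun T (fun t => wn n t).
Proof.
apply: meas_powR; apply: meas_cmod; apply: cmeas_add; first by split; exact: measurable_cst.
by apply: cmeas_opp; exact: (meas_circle n (@hol_id R)).
Qed.

Let wn_le n t : wn n t <= 2 `^ b.
Proof. by rewrite ge0_ler_powR ?nnegrE ?cmod_ge0 // cmod_onem_le2 // ltW // rn_disc. Qed.

Let ReH0 n t : 0 <= Re (H (circ n t)). Proof. by rewrite ltW // ReH_gt0 // rn_disc. Qed.

Let ReH_le n t : Re (H (circ n t)) <= cmod (H (circ n t)).
Proof. by rewrite (le_trans (ler_norm _)) // Re_le_cmod. Qed.

Let a_ n t := Re (H (circ n t)) `^ p * wn n t.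
Let g_ n t := cmod (H (circ n t)) `^ p * wn n t.

Let meas_a n : measurable_fun T (a_ n).
Proof. by apply: measurable_funM => //; apply: meas_powR; have [] := meas_H n. Qed.
Let meas_g n : measurable_fun T (g_ n).
Proof. by apply: measurable_funM => //; apply: meas_powR; exact: meas_cmod. Qed.
Let a_ge0 n t : 0 <= a_ n t. Proof. by rewrite mulr_ge0 ?powR_ge0. Qed.
Let g_ge0 n t : 0 <= g_ n t. Proof. by rewrite mulr_ge0 ?powR_ge0. Qed.

Let a_le_g n t : a_ n t <= g_ n t.
Proof. by rewrite ler_wpM2r ?powR_ge0 // ge0_ler_powR ?nnegrE ?cmod_ge0 // ltW. Qed.

Let tint_g n : tint (g_ n).
Proof.
have [_ _ _ [M M0 bM]] := kH.
have tH : tint (fun t => cmod (H (circ n t)) ^+ 2).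
  apply: tint_fin; [by move=> t _; exact: sqr_ge0|by apply: measurable_funX; exact: meas_cmod|].
  by rewrite (le_lt_trans (bM n)) // ltry.
apply: (tint_le (meas_g n) _ (tintZ (2 `^ b) (tintD (tint_cst 1) tH))) => t _.
rewrite (ger0_norm (g_ge0 n t)) mulrC; apply: ler_pM; rewrite ?powR_ge0 //.
have h0 := cmod_ge0 (H (circ n t)); move: (cmod _) h0 => x x0.
have [x1|x1] := leP x 1.
  apply: (@le_trans _ _ (1 `^ p)); last by rewrite powR1 lerDl sqr_ge0.
  by apply: ge0_ler_powR; rewrite ?nnegrE ?ler01 // ltW.
by rewrite -powR_mulrn // ler_wpDl // ler_powR ?ltW.
Qed.

Let tint_a n : tint (a_ n).
Proof. by apply: (tint_le (meas_a n) _ (tint_g n)) => t _; rewrite (ger0_norm (a_ge0 n t)). Qed.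

(** Bounds [a_] in [L^(2/p)] by the circle means of [|H|^2]. *)
Let a_pow n t : a_ n t `^ (2 / p) <= (2 `^ b) `^ (2 / p) * cmod (H (circ n t)) ^+ 2.
Proof.
have := wn_le n t; have := ReH_le n t; have := ReH0 n t; rewrite /a_.
have := powR_ge0 (cmod (1 - circ n t)) b; have := powR_ge0 (2 : R) b.
move: (Re _) (cmod (H _)) (wn n t) (2 `^ b) => x y z B B0 z0 x0 xy zB.
have s0 : 0 <= 2 / p by rewrite divr_ge0 // ltW.
rewrite powRM ?powR_ge0 // mulrC; apply: ler_pM; rewrite ?powR_ge0 //.
  by apply: ge0_ler_powR; rewrite ?nnegrE.
rewrite -powRrM mulrCA divff ?gt_eqF // mulr1 powR_mulrn //.
by rewrite ler_pXn2r ?nnegrE // (le_trans x0).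
Qed.

Let step n (c K : R) : 0 < c -> 0 < K -> (forall x y : R, `|x| < pi / 2 -> `|y| < pi / 2 ->
    cos (p * x + b * y) <= K * cos x `^ p - c) -> c * I (g_ n) <= K * I (a_ n).
Proof.
move=> c0 K0 trig.
have pw t : Re (Psi (circ n t)) <= K * a_ n t - c * g_ n t.
  have zd := @rn_disc R n t; have h0 := ReH_gt0 zd; have o0 := Re_onem_gt0 zd.
  (* In polar form the phase of [Psi] is [p arg H + b arg (1 - z)], with both arguments below
     [pi / 2] in modulus. *)
  have -> : Re (Psi (circ n t)) = g_ n t * cos (p * carg (H (circ n t)) + b * carg (1 - circ n t)).
    rewrite /Psi /gz !cpowE // cosD /g_ !ReImE /=.
    by move: (cmod _ `^ p) (cmod _ `^ b) (cos _) (cos _) (sin _) (sin _) => *; ring.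
  have -> : K * a_ n t - c * g_ n t = g_ n t * (K * cos (carg (H (circ n t))) `^ p - c).
    have ca : 0 <= cos (carg (H (circ n t))).
      by apply/ltW/cos_gt0_pihalf; rewrite -ltr_norml carg_bound.
    rewrite /a_ (Re_eq_cos_carg h0) powRM ?cmod_ge0 // /g_; ring.
  by apply: ler_wpM2l => //; apply: trig; exact: carg_bound.
have tP : tint (fun t => Re (Psi (circ n t))).
  apply: tint_cont => t; have hr : 0 <= rn R n < 1 by rewrite ltW ?rn_gt0 //= rn_lt1.
  by have [] := cont_circle holPsi hr t.
have tr := tintB (tintZ K (tint_a n)) (tintZ c (tint_g n)).
have := le_trans (Psi_mean n) (I_le tP tr (fun t _ => pw t)).
rewrite (I_B (tintZ K (tint_a n)) (tintZ c (tint_g n))).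
by rewrite (I_Z (tint_a n)) (I_Z (tint_g n)) subr_ge0.
Qed.

Let v t : C := G t * k t.
Let a t := Re (v t) `^ p * w t.

Let lim_H : aeT (fun t => cvgC \oo (fun n => H (circ n t)) (v t)). Proof. by case: kH. Qed.

Let lim_w t : wn n t @[n --> \oo] --> w t.
Proof.
apply: cvg_powR_nneg => //; first by move=> n; exact: cmod_ge0.
by apply: cvgC_cmod; apply: cvgC_sub; [exact: cvgC_cst|exact: cvg_radius].
Qed.

Let mv : cmeasurable v.
Proof. by apply: cmeas_mul; [exact: cmeas_gT|exact: (isproj_L2 pr).1]. Qed.

(** Here [p < 2] is decisive: the exponent [2 / p > 1] gives uniform integrability, so the integrals
    of [a_] converge to that of [a]. *)
Let lim_a : tint a /\ I (a_ n) @[n --> \oo] --> I a.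
Proof.
have [_ _ _ [M M0 bM]] := kH.
have s1 : 1 < 2 / p by rewrite ltr_pdivlMr // mul1r.
apply: (@vitali R (2 / p) ((2 `^ b) `^ (2 / p) * M) a_ a s1 meas_a).
- by apply: measurable_funM; [apply: meas_powR; have [] := mv|exact: meas_weight].
- apply: aeT1 lim_H => t _ lt; apply: cvgM; last exact: lim_w.
  by apply: cvg_powR_ge0 => //; have [] := lt.
- move=> n; have mH2 : measurable_fun T (fun t => cmod (H (circ n t)) ^+ 2).
    by apply: measurable_funX; exact: meas_cmod.
  apply: (@le_trans _ _ (E (fun t => (2 `^ b) `^ (2 / p) * cmod (H (circ n t)) ^+ 2))).
    apply: E_le.
    + by apply: meas_powR; apply: measurableT_comp => //; exact: meas_a.
    + by apply: measurable_funM.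
    + by move=> t _; exact: powR_ge0.
    + by move=> t _; rewrite (ger0_norm (a_ge0 n t)); exact: a_pow.
  rewrite (E_scale (powR_ge0 _ _) mH2 (fun t _ => sqr_ge0 _)) [leRHS]EFinM.
  by apply: lee_wpmul2l (bM n); rewrite lee_fin powR_ge0.
Qed.

Lemma positive_fatou (c K : R) : 0 < c -> 0 < K -> (forall x y : R, `|x| < pi / 2 -> `|y| < pi / 2 ->
    cos (p * x + b * y) <= K * cos x `^ p - c) ->
  (wint alpha p k <= (K / c * I a)%:E)%E.
Proof.
move=> c0 K0 trig; have [ta cva] := lim_a.
have -> : wint alpha p k = E (fun t => cmod (v t) `^ p * w t).
  by apply: ae_integral; apply: aeT1 (aeT_interior R) => t _ ti; rewrite /v weight_split.
have Kc : 0 < K / c by rewrite divr_gt0.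
apply/lee_addgt0Pr => eps e0.
have e1 : 0 < eps / (K / c) by rewrite divr_gt0.
move/cvgrPdist_le : cva => /(_ _ e1)[N _ hN].
(* [fatouT] wants the bound at every index, so the sequence is shifted past the point where
   [I (a_ n)] is close to its limit. *)
apply: (@fatouT _ (fun n => g_ (n + N)%N)); [by move=> n; exact: meas_g|by move=> n t _; exact: g_ge0| |].
- apply: aeT1 lim_H => t _ lt.
  have lg : g_ n t @[n --> \oo] --> cmod (v t) `^ p * w t.
    apply: cvgM; last exact: lim_w.
    by apply: cvg_powR_ge0 => //; [move=> n; exact: cmod_ge0|exact: cvgC_cmod].
  rewrite -(@cvg_shiftn N _ (g_ ^~ t)) in lg; exact: lg.
- move=> n; rewrite -(EFin_I (tint_g _)) -EFinD lee_fin.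
  have := step (n + N)%N c0 K0 trig; have := hN (n + N)%N (leq_addl n N).
  rewrite /= ler_distl => /andP[h1 h2] h3.
  have h4 : I (g_ (n + N)%N) <= K / c * I (a_ (n + N)%N).
    by rewrite mulrAC ler_pdivlMr // mulrC.
  apply: (le_trans h4); clear h3 h4; move: (I a) (I (a_ _)) (K / c) Kc {e1} h1 h2 => x y Q Q0 h1 h2.
  apply: (@le_trans _ _ (Q * (x + eps / Q))); first by apply: ler_wpM2l; [exact: ltW|lra].
  by rewrite mulrDr [Q * (eps / Q)]mulrC divfK ?lexx // gt_eqF.
Qed.

Lemma positive_limit_tint : tint a. Proof. exact: lim_a.1. Qed.

End Fixed.
End PositiveEstimate.

Section RieszPositive.
Variable R : realType.
Local Notation C := (R[i]).
Variable alpha : R.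
Hypothesis alpha0 : 0 <= alpha.
Local Notation G t := (gT alpha t).
Variable p : R.
Hypotheses (p1 : 1 < p) (p2 : p < 2).
Local Notation b := (alpha * (2 - p)).
Hypothesis bp : b < p - 1.
Local Notation w t := (cmod (1 - expi t) `^ b).

Let pp : 0 < p. Proof. by rewrite (lt_trans _ p1). Qed.
Let b0 : 0 <= b. Proof. by rewrite mulr_ge0 // subr_ge0 ltW. Qed.

Lemma wint_ge0 q (f : R -> C) : (0 <= wint alpha q f)%E.
Proof. by apply: integral_ge0 => t _; rewrite lee_fin; exact: wint_ge0f. Qed.

Lemma wint_eq0 q (f : R -> C) : 0 < q -> aeT (fun t => f t = 0) -> wint alpha q f = 0%E.
Proof.
move=> q0 f0; rewrite (wint_ae _ q f0) /wint; apply: integral0_eq => t _.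
by rewrite cmod0 powR0 ?gt_eqF // mul0r.
Qed.

Lemma riesz_positive : exists2 K : R, 0 <= K & forall f k (u : R -> R), isproj alpha f k -> measurable_fun T u ->
  (forall t, T t -> 0 <= u t) -> aeT (fun t => G t * f t = cR (u t)) -> InLp alpha p f ->
  (wint alpha p k <= K%:E * wint alpha p f)%E.
Proof.
have [c [K [c0 K0 trig]]] := cos_combination p1 p2 b0 bp.
have [D D0 mean] := mean_bound alpha0 p1 p2 bp.
have tw : tint (fun t => w t).
  by apply: (tint_bounded (m := 2 `^ b) (meas_weight alpha p)) => t _; rewrite ger0_norm ?powR_ge0 // weight_le.
pose W := I (fun t => w t).
have W0 : 0 <= W by apply: Rintegral_ge0 => t _; exact: powR_ge0.
have Q0 : 0 <= K / c * (2 `^ p * (1 + D * W)).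
  by rewrite mulr_ge0 ?divr_ge0 ?(ltW K0) ?(ltW c0) // mulr_ge0 ?powR_ge0 // addr_ge0 ?ler01 // mulr_ge0.
(* [K / c] compares [|H|^p] with [(Re H)^p], [2^p] splits the power of [u + m], and [D W] accounts
   for the constant [m] through [mean_bound] and the total weight [W]. *)
exists (K / c * (2 `^ p * (1 + D * W))); first exact: Q0.
move=> f k u pr mu_ u0 fu lf; have [_ [H kH] _ _] := pr.
have tu := tint_u pr mu_ fu; have Iu0 : 0 <= I u by exact: Rintegral_ge0.
have lk := isproj_L2 pr.
(* Strict positivity of [Re H] fails when [u] vanishes almost everywhere; then [f] and its
   projection vanish as well. *)
have [Iu|Iu] := eqVneq (I u) 0.
  have uz := I_eq0 tu u0 Iu.
  have fz : aeT (fun t => f t = 0).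
    apply: (aeT2 _ fu uz) => t _ + ut; rewrite ut => /eqP.
    by rewrite mulf_eq0 (negbTE (gT_neq0 alpha t)) => /eqP.
  have kz : aeT (fun t => k t = 0).
    apply: (ip_eq0 lk); have ik : InH2 alpha k by case: pr.
    rewrite -(isproj_ip pr ik lk) (ip_ae alpha fz (aeTW (fun t _ => erefl (k t)))) /ip.
    rewrite (I_ae (g := fun=> 0)); first by rewrite /Rintegral integral0.
    by apply: aeTW => t _; rewrite mul0r mul0r.
  by rewrite (wint_eq0 pp kz) mule_ge0 ?wint_ge0 // lee_fin.
have Iup : 0 < I u by rewrite lt_neqAle eq_sym Iu.
pose v t : C := G t * k t.
have ta : tint (fun t => Re (v t) `^ p * w t) by exact: (positive_limit_tint alpha0 p1 p2 pr kH mu_ u0 fu Iup).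
have tA : tint (fun t => u t `^ p * w t).
  apply: (tint_ae _ _ (InLp_tint lf)).
    by apply: measurable_funM; [exact: meas_powR|exact: meas_weight].
  apply: (aeT2 _ (aeT_interior R) fu) => t Tt ti e.
  by rewrite -(weight_split _ _ _ ti) e cmod_cR ger0_norm // u0.
set A := I (fun t => u t `^ p * w t).
pose m := I u / (2 * pi); have mA : m `^ p <= D * A by exact: mean.
have m0 : 0 <= m by rewrite divr_ge0 // mulr_ge0 ?pi_ge0.
have fA : wint alpha p f = A%:E.
  rewrite (EFin_I tA); apply: ae_integral; apply: (aeT2 _ (aeT_interior R) fu) => t Tt ti e.
  by rewrite -(weight_split _ _ _ ti) e cmod_cR ger0_norm // u0.
have Ia : I (fun t => Re (v t) `^ p * w t) <= 2 `^ p * (1 + D * W) * A.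
  have tr := tintZ (2 `^ p) (tintD tA (tintZ (m `^ p) tw)).
  have := I_le_ae ta tr.
  rewrite (I_Z (tintD tA (tintZ (m `^ p) tw))).
  rewrite (I_D tA (tintZ (m `^ p) tw)) (I_Z tw).
  rewrite -/A -/W => h; apply: (le_trans (h _)); last first.
    rewrite -mulrA; apply: ler_wpM2l; first exact: powR_ge0.
    by rewrite mulrDl mul1r lerD2l mulrAC ler_wpM2r.
  apply: aeT1 (boundary_real_part pr kH mu_ fu) => t Tt; rewrite -/m -/(v t) => e.
  have ut := u0 t Tt; have eR : Re (v t) = (u t + m) / 2 by rewrite -e mulrC mulrA mulVf ?mul1r.
  rewrite -mulrDl mulrA; apply: ler_wpM2r; first exact: powR_ge0.
  apply: le_trans (powRD_le (ltW pp) ut m0).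
  apply: ge0_ler_powR; rewrite ?nnegrE ?(ltW pp) ?eR //; lra.
have := positive_fatou alpha0 p1 p2 pr kH mu_ u0 fu Iup c0 K0 trig.
move=> /le_trans; apply; rewrite fA -EFinM lee_fin -[leRHS]mulrA.
by apply: ler_wpM2l; rewrite // divr_ge0 // ltW.
Qed.

End RieszPositive.

(** * Boundedness inside the range *)

Section RieszTheorem.
Variable R : realType.
Local Notation C := (R[i]).
Variable alpha : R.
Hypothesis alpha0 : 0 <= alpha.
Hypothesis proj_ex : forall f, InLp alpha 2 f -> exists k, isproj alpha f k.
Local Notation G t := (gT alpha t).

Lemma wint_comb q (x y z : R -> C) (c : C) (A B : R) : 0 <= q -> cmeasurable x -> cmeasurable y ->
  cmod c <= 1 -> aeT (fun t => z t = x t + c * y t) ->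
  (wint alpha q x <= A%:E)%E -> (wint alpha q y <= B%:E)%E -> (wint alpha q z <= (2 `^ q * (A + B))%:E)%E.
Proof.
move=> q0 mx my c1 ze xA yB.
have lx : InLp alpha q x by split; [exact: mx|apply: (le_lt_trans xA); exact: ltry].
have ly : InLp alpha q y by split; [exact: my|apply: (le_lt_trans yB); exact: ltry].
have tx := InLp_tint lx; have ty := InLp_tint ly.
have tz := tintZ (2 `^ q) (tintD tx ty).
have mcy : cmeasurable (fun t => c * y t) by apply: cmeas_mul => //; split; exact: measurable_cst.
rewrite (wint_ae _ _ ze); apply: (@le_trans _ _ (E (fun t => 2 `^ q * (cmod (x t) `^ q * mu alpha t + cmod (y t) `^ q * mu alpha t)))).
  apply: E_le; [exact: (wint_meas alpha q (cmeas_add mx mcy))|exact: tint_meas tz|by move=> t _; exact: (wint_ge0f alpha q (fun t => x t + c * y t) t)|].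
  move=> t _; rewrite -mulrDl mulrA; apply: ler_wpM2r; first exact: mu_ge0.
  apply: (le_trans _ (powRD_le q0 (cmod_ge0 _) (cmod_ge0 _))).
  apply: ge0_ler_powR; rewrite ?nnegrE ?cmod_ge0 ?addr_ge0 ?cmod_ge0 //.
  apply: (le_trans (cmodD _ _)); rewrite lerD2l cmodM ler_piMl ?cmod_ge0 //.
rewrite -(EFin_I tz) lee_fin (I_Z (tintD tx ty)) (I_D tx ty).
apply: ler_wpM2l; first exact: powR_ge0.
by apply: lerD; rewrite -lee_fin (EFin_I _).
Qed.

Variable p : R.
Hypotheses (p1 : 1 < p) (p2 : p < 2).
Hypothesis bp : alpha * (2 - p) < p - 1.

Let pp : 0 < p. Proof. by rewrite (lt_trans _ p1). Qed.

(** [G f] is split into positive and negative parts of its real and imaginary parts. Each is at most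
    [|G f|], so after division by [G] it is dominated by [|f|] and stays in both spaces; linearity
    reassembles the four projections. *)
Lemma bdd_lt2 : bdd alpha p.
Proof.
have [K K0 pos] := riesz_positive alpha0 p1 p2 bp.
(* Two levels of the inequality [|x + y|^p <= 2^p (|x|^p + |y|^p)], one for signs and one for real
   and imaginary parts. *)
pose Q := 2 `^ p * (2 `^ p * (K + K) + 2 `^ p * (K + K)).
have Q0 : 0 <= Q by rewrite !(mulr_ge0, addr_ge0) ?powR_ge0.
exists (Q `^ p^-1); first exact: powR_ge0.
move=> f k lf pr; have l2 : InLp alpha 2 f by case: pr.
have [X X0 fX] : exists2 X : R, 0 <= X & wint alpha p f = X%:E.
  exists (I (fun t => cmod (f t) `^ p * mu alpha t)); last exact/esym/EFin_I/(InLp_tint lf).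
  by apply: Rintegral_ge0 => t _; exact: wint_ge0f.
rewrite fX -powRrM mulVf ?gt_eqF // powRr1 // -EFinM.
pose v t : C := G t * f t.
have mv : cmeasurable v by apply: cmeas_mul lf.1; exact: cmeas_gT.
pose part (u : R -> R) t : C := cR (u t) * gT (- alpha) t.
have part_ex (u : R -> R) : measurable_fun T u -> (forall t, 0 <= u t <= cmod (v t)) ->
    exists k1, [/\ isproj alpha (part u) k1, InLp alpha 2 (part u) & (wint alpha p k1 <= (K * X)%:E)%E].
  move=> mu_ uv.
  have mp : cmeasurable (part u).
    by apply: cmeas_mul; [exact: (cmeas_cR mu_)|exact: cmeas_gT].
  have le : aeT (fun t => cmod (part u t) <= cmod (f t)).
    apply: aeTW => t _; have /andP[u0 ul] := uv t.
    have -> : f t = v t * gT (- alpha) t by rewrite /v mulrAC gTN mul1r.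
    by rewrite /part cmodM cmod_cR ger0_norm // [leRHS]cmodM ler_wpM2r ?cmod_ge0.
  have [lu2 _] := InLp_le (ler0n R 2) mp le l2.
  have [lup lep] := InLp_le (ltW pp) mp le lf.
  have [k1 pr1] := proj_ex lu2; exists k1; split; [exact: pr1|exact: lu2|].
  have ut0 t : T t -> 0 <= u t by move=> _; have /andP[] := uv t.
  have e : aeT (fun t => G t * part u t = cR (u t)).
    by apply: aeTW => t _; rewrite /part mulrCA gTN mulr1.
  apply: (le_trans (pos _ _ _ pr1 mu_ ut0 e lup)); rewrite EFinM -fX.
  by apply: lee_wpmul2l lep; rewrite lee_fin.
have hmax (x : R) y : `|x| <= y -> 0 <= Num.max x 0 <= y.
  by move=> xy; rewrite le_max lexx orbT ge_max (le_trans (ler_norm _) xy) (le_trans (normr_ge0 _) xy).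
have mmax (g : R -> R) : measurable_fun T g -> measurable_fun T (fun t => Num.max (g t) 0).
  by move=> mg; apply: measurable_maxr => //; exact: measurable_cst.
have [mre mim] := mv.
have [k1 [pr1 l1 w1]] := part_ex _ (mmax _ mre) (fun t => hmax _ _ (Re_le_cmod (v t))).
have hmaxN (x : R) y : `|x| <= y -> 0 <= Num.max (- x) 0 <= y by rewrite -normrN; exact: hmax.
have [k2 [pr2 l2' w2]] := part_ex _ (mmax _ (measurableT_comp (@oppr_measurable R setT) mre))
   (fun t => hmaxN _ _ (Re_le_cmod (v t))).
have [k3 [pr3 l3 w3]] := part_ex _ (mmax _ mim) (fun t => hmax _ _ (Im_le_cmod (v t))).
have [k4 [pr4 l4 w4]] := part_ex _ (mmax _ (measurableT_comp (@oppr_measurable R setT) mim))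
   (fun t => hmaxN _ _ (Im_le_cmod (v t))).
have comb x y : InLp alpha 2 x -> InLp alpha 2 y -> exists k', isproj alpha (fun t => x t + (-1) * y t) k'.
  by move=> lx ly; apply: proj_ex; exact: (InLp_add (ler0n R 2) lx (InLp_scale (-1) ly)).
have [k12 pr12] := comb _ _ l1 l2'; have [k34 pr34] := comb _ _ l3 l4.
have cN1 : cmod (-1 : C) <= 1 by rewrite cmodN cmod1.
have ci : cmod (Complex 0 1 : C) <= 1 by rewrite /cmod /= expr0n add0r expr1n sqrtr1.
have e12 := isproj_lin pr1 pr2 pr12 (aeTW (fun t _ => erefl)).
have e34 := isproj_lin pr3 pr4 pr34 (aeTW (fun t _ => erefl)).
have ef : aeT (fun t => f t = part (fun t => Num.max (Re (v t)) 0) t + -1 * part (fun t => Num.max (- Re (v t)) 0) t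
    + Complex 0 1 * (part (fun t => Num.max (Im (v t)) 0) t + -1 * part (fun t => Num.max (- Im (v t)) 0) t)).
  have maxB (x : R) : Num.max x 0 - Num.max (- x) 0 = x.
    by have [h|h] := leP x 0; [rewrite max_l ?oppr_ge0 // sub0r opprK|rewrite max_r ?oppr_le0 ?(ltW h) // subr0].
  apply: aeTW => t _; have -> : f t = v t * gT (- alpha) t by rewrite /v mulrAC gTN mul1r.
  rewrite /part; set g := gT _ t; move: (v t) g => z g.
  have -> : cR (Num.max (Re z) 0) * g + -1 * (cR (Num.max (- Re z) 0) * g) + Complex 0 1 *
    (cR (Num.max (Im z) 0) * g + -1 * (cR (Num.max (- Im z) 0) * g)) = (cR (Num.max (Re z) 0 - Num.max (- Re z) 0) +
    Complex 0 1 * cR (Num.max (Im z) 0 - Num.max (- Im z) 0)) * g by apply: cmplx_eq; rewrite !ReImE /=; ring.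
  congr (_ * _); apply: cmplx_eq; rewrite !ReImE /= ?maxB; ring.
have ek := isproj_lin pr12 pr34 pr ef.
have m2 x y : isproj alpha x y -> cmeasurable y by move=> /isproj_L2[].
have w12 := wint_comb (ltW pp) (m2 _ _ pr1) (m2 _ _ pr2) cN1 e12 w1 w2.
have w34 := wint_comb (ltW pp) (m2 _ _ pr3) (m2 _ _ pr4) cN1 e34 w3 w4.
have := wint_comb (ltW pp) (m2 _ _ pr12) (m2 _ _ pr34) ci ek w12 w34.
have -> : Q * X = 2 `^ p * (2 `^ p * (K * X + K * X) + 2 `^ p * (K * X + K * X)) by rewrite /Q; ring.
exact.
Qed.

End RieszTheorem.

(** * Unboundedness outside the range *)

Section Pole.
Variable R : realType.

(* The integrals of [f] over [a, a + h] tend to [0] with [h] but stay above [c]. *)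
Lemma not_tint_pole (f : R -> R) (a d c : R) : 0 <= a -> 0 < d -> a + d <= 2 * pi -> 0 < c ->
  (forall t, T t -> 0 <= f t) -> (forall t, a < t < a + d -> c / (t - a) <= f t) -> ~ tint f.
Proof.
move=> a0 d0 ad c0 f0 fc tf.
(* The shift by 2 makes every [h n] strictly smaller than [d]. *)
pose h n : R := d / n.+2%:R.
have h0 n : 0 < h n by rewrite divr_gt0.
have hd n : h n < d by rewrite ltr_pdivrMr // ltr_pMr // ltr1n.
have ch : h n @[n --> \oo] --> (0 : R).
  have -> : h = (fun n => d * (n.+2%:R)^-1) by [].
  have -> : (0 : R) = d * 0 by rewrite mulr0.
  apply: cvgM; first exact: cvg_cst.
  by have := @cvg_harmonic R; rewrite -cvg_shiftS.
pose g n := f \_ `]a, a + h n].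
have mf := tint_meas tf.
have mg n : measurable_fun T (g n).
  apply/measurable_EFinP; rewrite -restrict_EFin; apply/measurable_restrict => //; rewrite ?setIid.
  apply: measurable_funS (measurable_int _ tf) => //; exact: subIsetl.
have cv : aeT (fun t => g n t @[n --> \oo] --> (0 : R)).
  apply: aeTW => t _; have [ta|ta] := leP t a.
    apply: cvg_near_cst; apply: nearW => n; rewrite /g patchE memNset //= in_itv /= => /andP[/(le_lt_trans ta)].
    by rewrite ltxx.
  apply: cvg_near_cst; have ta0 : 0 < t - a by rewrite subr_gt0.
  move/cvgrPdist_lt : ch => /(_ _ ta0); apply: filterS => n.
  rewrite sub0r normrN gtr0_norm // => hn; rewrite /g patchE memNset //= in_itv /= => /andP[_]; lra.
have dom n t : T t -> `|g n t| <= f t.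
  by move=> Tt; rewrite /g patchE; case: ifP => _; rewrite ?normr0 ?f0 // ger0_norm // f0.
have m0 : measurable_fun T ((fun=> 0) : R -> R) by exact: measurable_cst.
have [_ cvI] := I_dct mg m0 cv tf dom.
have low n : c <= I (g n).
  have tc : tint ((fun=> c / h n) \_ `]a, a + h n]).
    apply: (tint_le _ _ (tint_cst (c / h n))).
      apply/measurable_EFinP; rewrite -restrict_EFin; apply/measurable_restrict => //; rewrite ?setIid.
      exact: measurable_cst.
    by move=> t _; rewrite patchE; case: ifP => _; rewrite ?normr0 ?gtr0_norm // ?divr_ge0 ?divr_gt0 // ltW.
  have tg : tint (g n) by apply: (tint_le (mg n) (dom n) tf).
  have e : I ((fun=> c / h n) \_ `]a, a + h n]) = c.
    rewrite -Rintegral_mkcondr.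
    have -> : T `&` `]a, a + h n] = `]a, a + h n]%classic.
      apply/seteqP; split => t; rewrite /Tdom /= !in_itv /=; first by case.
      move=> /andP[t1 t2]; split; last by rewrite t1.
      have := hd n; rewrite (le_trans a0 (ltW t1)) /=; lra.
    rewrite Rintegral_cst //= lebesgue_measure_itv /= lte_fin ltrDl h0 /=.
    by rewrite addrAC subrr add0r divfK // gt_eqF.
  rewrite -{1}e; apply: (I_le tc tg) => t Tt.
  rewrite /g !patchE; case: ifPn => // /set_mem; rewrite /= in_itv /= => /andP[t1 t2].
  have t3 : t < a + d by have := hd n; lra.
  apply: (le_trans _ (fc t _)); last by rewrite t1.
  by rewrite ler_pM2l // lef_pV2 ?posrE ?subr_gt0 //; lra.
have : c <= I (fun=> 0 : R) by apply: (cvgr_to_ge cvI); apply: nearW; exact: low.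
rewrite {1}/Rintegral integral0 /=.
by rewrite leNgt c0.
Qed.

End Pole.

Section Unboundedness.
Variable R : realType.
Local Notation C := (R[i]).
Variable alpha : R.
Hypothesis alpha0 : 0 <= alpha.
Local Notation G t := (gT alpha t).
Local Notation circ n t := (cR (rn R n) * expi t).

Lemma testfun_add (q r : C -> C) A B : testfun q A -> testfun r B -> testfun (fun z => q z + r z) (A + B).
Proof.
move=> [hq bq cq] [hr br cr]; split; first exact: hol_add.
  by move=> z z1; apply: (le_trans (cmodD _ _)); apply: lerD; [exact: bq|exact: br].
move=> t ti; have [c1 b1] := cq t ti; have [c2 b2] := cr t ti; split; first exact: contC_add.
by apply: (le_trans (cmodD _ _)); apply: lerD.
Qed.

Lemma testfun_gz : testfun (gz alpha : C -> C) (2 `^ alpha).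
Proof.
have bd (z : C) : 0 < Re (1 - z) -> cmod z <= 1 -> cmod (gz alpha z) <= 2 `^ alpha.
  move=> r0 z1; rewrite /gz cmod_cpow //.
  by apply: ge0_ler_powR; rewrite ?nnegrE ?cmod_ge0 // cmod_onem_le2.
split; first exact: gz_hol.
  by move=> z z1; apply: bd; [exact: Re_onem_gt0|exact: ltW].
by move=> t ti; split; [exact: gz_cont|apply: bd; [exact: Re_onem_expi_gt0|rewrite cmod_expi]].
Qed.

(* Conjugates of holomorphic functions vanishing at [0] are orthogonal to the Hardy space. *)
Lemma isproj_anti (q r : C -> C) A B : testfun q A -> testfun r B -> r 0 = 0 ->
  isproj alpha (fun t => (q (expi t) + conjc (r (expi t))) * gT (- alpha) t) (fun t => q (expi t) * gT (- alpha) t).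
Proof.
move=> tq tr r0; have lq := testfun_L2 alpha tq; have lr := testfun_L2 alpha tr.
have lcr : InLp alpha 2 (fun t => conjc (r (expi t)) * gT (- alpha) t).
  have mr := cmeas_mul (cmeas_conj (testfun_meas tr)) (cmeas_gT (- alpha)).
  by apply: (InLp_le (ler0n R 2) mr _ lr).1; apply: aeTW => t _; rewrite !cmodM cmod_conj.
have fE : (fun t => (q (expi t) + conjc (r (expi t))) * gT (- alpha) t) =
    (fun t => q (expi t) * gT (- alpha) t + conjc (r (expi t)) * gT (- alpha) t).
  by apply/funext => t; rewrite mulrDl.
have lf : InLp alpha 2 (fun t => (q (expi t) + conjc (r (expi t))) * gT (- alpha) t).
  by rewrite fE; exact: (InLp_add (ler0n R 2) lq lcr).
have [hq bq _] := tq; have [hr br _] := tr.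
split; [exact: lf| |exact: (testfun_InH2 alpha tq)|].
  exists q; split; [exact: hq|exact: lq| |].
    apply: aeT1 (testfun_radial tq) => t _ /radial_limit_seq.
    by rewrite mulrCA gTN mulr1.
  have A0 : 0 <= A by apply: (le_trans (cmod_ge0 (q 0))); apply: bq; rewrite cmod0.
  exists (A ^+ 2 * (2 * pi)); first by rewrite mulr_ge0 ?sqr_ge0 // mulr_ge0 ?pi_ge0.
  move=> n; apply: (@le_trans _ _ (E (fun=> A ^+ 2))).
    apply: E_le; [by apply: measurable_funX; apply: meas_cmod; exact: meas_circle|exact: measurable_cst| |].
      by move=> t _; exact: sqr_ge0.
    by move=> t _; rewrite ler_pXn2r ?nnegrE ?cmod_ge0 // bq // rn_disc.
  by rewrite -(EFin_I (tint_cst _)) Rintegral_cst //= lebesgue_Tdom.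
move=> h ih lh; have [k [H [kH hk _]]] := InH2_rep ih.
have [_ e] := H2rep_pair kH hr br (testfun_meas tr) (testfun_radial tr).
rewrite r0 mulr0 mulr0 in e; rewrite -[RHS]e; apply: I_ae.
apply: (aeT2 _ (aeT_interior R) hk) => t _ ti ->.
rewrite -mulrBl addrAC subrr add0r.
transitivity (Re (G t * k t * conjc (conjc (r (expi t))))); last by rewrite conjcK.
rewrite -(@testfun_ip R alpha k (fun z => conjc (r z)) t ti); congr (_ * _).
by rewrite !ReImE /=; ring.
Qed.

Lemma not_bdd_high q : 0 < q -> alpha * (2 - q) <= -1 -> ~ bdd alpha q.
Proof.
move=> q0 aq [K K0 bK]; have pi2 := pi_ge2 R.
(* Splitting [conj(G) = 1 + conj(G - 1)], the second summand is the conjugate of a function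
   vanishing at 0, so [conj(G) / G] projects to [1 / G]. *)
have tr := testfun_add testfun_gz (testfun_cst (-1)).
have r0 : gz alpha 0 + -1 = 0 :> C by rewrite gz0 subrr.
have pr := isproj_anti (testfun_cst 1) tr r0.
set f := (fun t => _) in pr; set k := (fun t => _) in pr.
have lf : InLp alpha q f.
  have f2 : InLp alpha 2 f by case: pr.
  apply: (InLp_bounded alpha0 (B := 1) (ltW q0) f2.1); apply: aeTW => t _.
  have -> : f t = conjc (G t) * gT (- alpha) t.
    rewrite /f; congr (_ * _); rewrite -/(gT alpha t).
    by apply: cmplx_eq; rewrite !ReImE /=; ring.
  by rewrite cmodM cmod_conj -cmodM gTN cmod1.
have lk : InLp alpha q k.
  split; first by have [] := isproj_L2 pr.
  apply: (le_lt_trans (bK _ _ lf pr)); rewrite /wint -(EFin_I (InLp_tint lf)) -EFinM; exact: ltry.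
have := InLp_tint lk.
(* For [t < 1 / 2] one has [|1 - e^(it)| <= 2 t < 1], so an exponent at most -1 dominates
   [1 / |1 - e^(it)| >= 1 / (2 t)]. *)
apply: (@not_tint_pole R _ 0 2^-1 2^-1); rewrite ?add0r ?invr_gt0 //; first lra.
  by move=> t _; exact: wint_ge0f.
move=> t /andP[t0 t1]; have ti : 0 < t < 2 * pi by rewrite t0 /=; lra.
rewrite -(weight_split _ _ _ ti) /k mul1r gTN cmod1 powR1 mul1r subr0.
have rr := cmod_onem_gt0 ti.
have r2 : cmod (1 - expi t : C) <= 2 * t.
  have := expi_lipschitz 0 t; rewrite sub0r normrN gtr0_norm //.
  by have -> : expi 0 = 1 :> C by rewrite /expi cos0 sin0.
move: (cmod (1 - expi t)) rr r2 => x x0 x2.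
apply: (@le_trans _ _ (x `^ (-1))); last first.
  by apply: ger_powR => //; rewrite x0 /=; lra.
by rewrite powR_inv1 ?(ltW x0) // -invfM lef_pV2 ?posrE // mulr_gt0.
Qed.

(** The integrand is the Poisson kernel of the point [- rn n], whose total mass is [2 pi]. *)
Lemma mean_szego (n : nat) : let q := fun t => (1 - - cR (rn R n) * expi t)^-1 : C in
  tint (fun t => 2 * Re (q t) - 1) /\ I (fun t => 2 * Re (q t) - 1) = 2 * pi.
Proof.
move=> q; pose Q z : C := (1 - -1 * z)^-1.
have hQ : hol Q by apply: hol_szego; rewrite cmodN cmod1.
have qQ t : q t = Q (circ n t) by rewrite /q /Q !mulNr mul1r.
have tQ : tint (fun t => Re (q t)).
  under eq_fun do rewrite qQ.
  apply: tint_cont => t; have hr : 0 <= rn R n < 1 by rewrite ltW ?rn_gt0 //= rn_lt1.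
  by have [] := cont_circle hQ hr t.
split; first exact: (tintB (tintZ 2 tQ) (tint_cst 1)).
rewrite (I_B (tintZ 2 tQ) (tint_cst 1)) (I_Z tQ).
have -> : I (fun t => Re (q t)) = 2 * pi.
  have := mean_value hQ (rho := rn R n); rewrite rn_gt0 rn_lt1 => /(_ isT).
  have -> : Q 0 = 1 by rewrite /Q mulr0 subr0 invr1.
  by rewrite mulr1 => <-; congr Rintegral; apply/funext => t; rewrite qQ.
by rewrite Rintegral_cst //= lebesgue_Tdom /= mul1r; ring.
Qed.

Lemma not_bdd1 : ~ bdd alpha 1.
Proof.
move=> [K K0 bK]; have pi2 := pi_ge2 R; have pi0 := pi_gt0 R.
have cosp (t : R) : cos (t - pi) = - cos t by rewrite cosB cospi sinpi mulrN1 mulr0 addr0.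
(* The concentration point -1 is chosen away from 1, where the weight may vanish. *)
pose c n : C := - cR (rn R n).
have c1 n : cmod (c n) < 1 by rewrite cmodN cmod_cR gtr0_norm ?rn_gt0 // rn_lt1.
pose q n t : C := (1 - c n * expi t)^-1.
have tq n := testfun_szego (c1 n).
have tr n := testfun_add (tq n) (testfun_cst (-1)).
have r0 n : (1 - c n * 0)^-1 + -1 = 0 :> C by rewrite mulr0 subr0 invr1 subrr.
have pr n := isproj_anti (tq n) (tr n) (r0 n).
pose f n t : C := (q n t + conjc (q n t + -1)) * gT (- alpha) t.
pose k n t : C := q n t * gT (- alpha) t.
have prn n : isproj alpha (f n) (k n) := pr n.
have gmu t : 0 < t < 2 * pi -> cmod (gT (- alpha) t) * mu alpha t = cmod (G t).
  by move=> ti; rewrite muE // expr2 mulrA -[X in X * _]cmodM [gT (- alpha) t * _]mulrC gTN cmod1 mul1r.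
have wf n : (wint alpha 1 (f n) <= (2 `^ alpha * (2 * pi))%:E)%E.
  have [ts Is] := mean_szego n; rewrite -Is.
  have tz := tintZ (2 `^ alpha) ts.
  rewrite -(I_Z ts) (EFin_I tz).
  have f2 : InLp alpha 2 (f n) by case: (prn n).
  have pos t : 0 <= 2 * Re (q n t) - 1.
    have ce : cmod (c n * expi t) < 1 by rewrite cmodM cmod_expi mulr1.
    by have := Re_inv_ge ce; rewrite -/(q n t); lra.
  apply: ae_le_integral; [exact: (wint_meas alpha 1 f2.1)|exact: tint_meas tz|by move=> t _; exact: wint_ge0f|].
  apply: aeT1 (aeT_interior R) => t _ ti; rewrite -/(c n) -/(q n t).
  rewrite powRr1 ?cmod_ge0 // /f cmodM -mulrA gmu //.
  have -> : q n t + conjc (q n t + -1) = cR (2 * Re (q n t) - 1) by apply: cmplx_eq; rewrite !ReImE /=; ring.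
  rewrite cmod_cR ger0_norm // mulrC; apply: ler_wpM2r => //.
  by have [_ _ /(_ t ti)[]] := testfun_gz.
have lf n : InLp alpha 1 (f n).
  split; first by have [[]] := prn n.
  by apply: (le_lt_trans (wf n)); exact: ltry.
pose M := K `^ 1 * (2 `^ alpha * (2 * pi)).
have wk n : (wint alpha 1 (k n) <= M%:E)%E.
  apply: (le_trans (bK _ _ (lf n) (prn n))); rewrite EFinM.
  by apply: lee_wpmul2l (wf n); rewrite lee_fin powR_ge0.
(* The pointwise limit of [|k n| mu]; Fatou would make it integrable, but it has a simple pole at
   [pi]. *)
pose F t := cmod (1 + expi t : C) `^ (-1) * (cmod (gT (- alpha) t) * mu alpha t).
have m1 : cmeasurable (fun t => 1 + expi t : C).
  by apply: cmeas_add; [split; exact: measurable_cst|exact: cmeas_expi].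
have mF : measurable_fun T F.
  apply: measurable_funM; first by apply: meas_powR; exact: (meas_cmod m1).
  by apply: measurable_funM; [apply: meas_cmod; exact: cmeas_gT|exact: meas_mu].
have F0 t : T t -> 0 <= F t.
  by move=> _; apply: mulr_ge0; [exact: powR_ge0|apply: mulr_ge0; [exact: cmod_ge0|exact: mu_ge0]].
have tF : tint F.
  apply: (tint_fin F0 mF); apply: (@le_lt_trans _ _ M%:E); last exact: ltry.
  apply: (@fatouT R (fun n t => cmod (k n t) `^ 1 * mu alpha t) F M%:E _ _ _ wk).
  - by move=> n; exact: (wint_meas alpha 1 (isproj_L2 (prn n)).1).
  - by move=> n t _; exact: (wint_ge0f alpha 1 (k n) t).
  have ax : aeT (fun t => t != pi :> R).
    exists [set (pi : R)]; split; [exact: measurable_set1|exact: lebesgue_measure_set1|].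
    by move=> t /= /not_implyP[_] /negP; rewrite negbK => /eqP.
  apply: (aeT2 _ (aeT_interior R) ax) => t _ /andP[t0 t2] tp.
  have e0 : cmod (1 + expi t : C) != 0.
    rewrite gt_eqF // Re_gt0_cmod // ReD /= -[cos t]opprK -cosp subr_gt0.
    have [h|h] := ltP pi t; first by apply: cos_lt1_interior; lra.
    have h' : t < pi by rewrite lt_neqAle tp.
    by rewrite -cosN opprB; apply: cos_lt1_interior; lra.
  have kE n : cmod (k n t) `^ 1 * mu alpha t = (cmod (1 - c n * expi t))^-1 * (cmod (gT (- alpha) t) * mu alpha t).
    by rewrite powRr1 ?cmod_ge0 // /k /q cmodM cmodV mulrA.
  under eq_fun do rewrite kE.
  rewrite /F powR_inv1 ?cmod_ge0 //; apply: cvgM; last exact: cvg_cst.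
  apply: cvgV; first exact: e0.
  apply: cvgC_cmod; have -> : (fun n => 1 - c n * expi t) = (fun n => 1 + circ n t).
    by apply/funext => n; rewrite /c mulNr opprK.
  by apply: cvgC_add; [exact: cvgC_cst|exact: cvg_radius].
(* On [(pi, pi + 1)] one has [|1 + e^(it)| <= 2 (t - pi)], while [cos t <= 0] gives
   [|1 - e^(it)| >= 1] and hence [|G| >= 1]. *)
apply: (@not_tint_pole R _ pi 1 2^-1 _ _ _ _ F0 _ tF); [exact: ltW|exact: ltr01|lra|by rewrite invr_gt0|].
move=> t /andP[t0 t1]; have ti : 0 < t < 2 * pi by lra.
rewrite /F gmu //; have h1 : 0 <= cos (t - pi) by apply: cos_ge0_pihalf; lra.
have h2 : cmod (1 + expi t : C) <= 2 * (t - pi).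
  have := expi_lipschitz t pi; rewrite gtr0_norm ?subr_gt0 // /=.
  have -> : expi t - expi pi = 1 + expi t :> C.
    by rewrite /expi cospi sinpi; apply: cmplx_eq; rewrite !ReImE /=; ring.
  by [].
have h3 : 0 < cmod (1 + expi t : C).
  rewrite Re_gt0_cmod // ReD /= -[cos t]opprK -cosp subr_gt0; apply: cos_lt1_interior; lra.
have h4 : 1 <= cmod (G t).
  have r1 : 1 <= cmod (1 - expi t : C).
    by rewrite (le_trans _ (le_trans (ler_norm _) (Re_le_cmod _))) // ReB /= -[cos t]opprK -cosp; lra.
  by rewrite cmod_gT // -(powRr0 (cmod (1 - expi t))) ler_powR.
rewrite powR_inv1 ?cmod_ge0 //; apply: (@le_trans _ _ (cmod (1 + expi t))^-1).
  by rewrite -invfM lef_pV2 ?posrE // mulr_gt0 // subr_gt0.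
by rewrite ler_peMr // invr_ge0 ltW.
Qed.

End Unboundedness.

Theorem theorem3 (R : realType) (alpha : R) (halpha : 0 <= alpha)
  (S : (R -> R[i]) -> (R -> R[i])) (hS : is_Szego_projection alpha S)
  (p : R) (hp : 1 <= p) :
  bounded_on_Lp alpha p S <->
  ((2 * alpha + 1) / (alpha + 1) < p /\ (alpha = 0 \/ p < (2 * alpha + 1) / alpha)).
Proof.
have a1 : 0 < alpha + 1 by rewrite ltr_wpDl.
have pex f : InLp alpha 2 f -> exists k, isproj alpha f k.
  by move=> /(isproj_ex hS)[k pk _]; exists k.
(* The last identity, taken at [x = 1] and [x = 2], turns conditions on the conjugate exponent into
   polynomial ones in [r]. *)
have conj_exp (r : R) : 1 < r -> [/\ 1 < r / (r - 1), r^-1 + (r / (r - 1))^-1 = 1,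
    (r / (r - 1))^-1 + r^-1 = 1 & forall x : R, (r / (r - 1) - x) * (r - 1) = r - x * (r - 1)].
  move=> r1; have s0 : 0 < r - 1 by rewrite subr_gt0.
  have r0 : r != 0 by rewrite gt_eqF // (lt_trans ltr01).
  have e : r^-1 + (r / (r - 1))^-1 = 1 by rewrite invf_div; field.
  split; [by rewrite ltr_pdivlMr // mul1r gtrBl|exact: e|by rewrite addrC|].
  by move=> x; rewrite mulrBl divfK // gt_eqF.
rewrite (bounded_on_LpE hS) ltr_pdivrMr //; split=> [bp|[lo up]].
  (* The lower endpoint is at least 1, so [p = 1] is always outside the range, and duality cannot
     reach it. *)
  have p1 : 1 < p.
    rewrite lt_neqAle hp andbT; apply/eqP => p1; move: bp; rewrite -p1; exact: not_bdd1.
  have p0 : 0 < p by exact: lt_trans p1.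
  split.
    rewrite ltNge; apply/negP => lo; have [q1 e1 e2 eq] := conj_exp _ p1.
    have q0 : 0 < p / (p - 1) by exact: lt_trans q1.
    (* For the conjugate [q], [2 - q = (p - 2) / (p - 1)], so [alpha (2 - q) <= -1] amounts to
       [p (alpha + 1) <= 2 alpha + 1]. *)
    apply: (not_bdd_high halpha q0 _ (bdd_dual halpha pex q1 p1 e2 bp)).
    have s0 : 0 < p - 1 by rewrite subr_gt0.
    have := eq 2; move: (p / (p - 1)) => q; nra.
  have [->|an] := eqVneq alpha 0; [by left|right].
  have ap : 0 < alpha by rewrite lt_neqAle eq_sym an.
  rewrite ltNge ler_pdivrMr //; apply/negP => up.
  apply: (not_bdd_high halpha p0 _ bp); nra.
have p1 : 1 < p by nra.
have [p2|p2|->] := ltgtP p 2; last exact: bdd2.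
  by apply: (bdd_lt2 halpha pex p1 p2); nra.
have s0 : 0 < p - 1 by rewrite subr_gt0.
have [q1 e1 e2 eq] := conj_exp _ p1.
apply: (bdd_dual halpha pex p1 q1 e1); apply: (bdd_lt2 halpha pex q1).
  by have := eq 2; move: (p / (p - 1)) => q; nra.
(* The upper endpoint condition in a form that covers [alpha = 0]; multiplying by
   [q - 1 = 1 / (p - 1)] gives [alpha (2 - q) < q - 1] for the conjugate [q < 2]. *)
have apos : alpha * (p - 2) < 1.
  case: up => [->|]; first by rewrite mul0r.
  have [->|an] := eqVneq alpha 0; first by rewrite mul0r.
  by rewrite ltr_pdivlMr ?lt_neqAle 1?eq_sym ?an //; nra.
by have := eq 2; have := eq 1; move: (p / (p - 1)) => q; nra.
Qed.
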